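(* There exists a universal constant $c'$ such that the following holds. Let $n\ge3$ and $d\ge 1$ be integers, let $\alpha\in(0,1]$, and let $\mathcal{R}$ be any regression algorithm. Let $\widehat{C}_n^{\mathcal{R}}$ be the interval constructed via data splitting with regression algorithm $\mathcal{R}$ (as specified in the context). Then $\widehat{C}_n^{\mathcal{R}}$ provides a $(1-\alpha)$-distribution-free confidence interval for binary regression. Furthermore, for all distributions $P$ on $\mathbb{R}^d\times\{0,1\}$, with $(X_1,Y_1),\dots,(X_{n+1},Y_{n+1})$ drawn i.i.d. from $P$, \[\mathbb{E}\left[\mathrm{leb}(\widehat{C}_n^{\mathcal{R}}(X_{n+1}))\right]\le L_\alpha(\Pi_P)+2\sqrt{\frac{\Delta_{\lfloor n/2\rfloor,P}(\mathcal{R})}{\alpha}}+\frac{c'}{\sqrt\alpha}\sqrt[4]{\frac{\log n}{n}}.\]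
   Context: For a distribution $P$ on $(X,Y)\in\mathbb{R}^d\times\{0,1\}$, $P_X$ is the marginal of $X$, $\pi_P(x)=\mathbb{P}_P\{Y=1\mid X=x\}$, and $\Pi_P$ is the distribution of $\pi_P(X)$ on $[0,1]$. $\mathrm{leb}$ is Lebesgue measure on $\mathbb{R}$; $\log$ is the natural logarithm. A (possibly randomized) algorithm $\widehat{C}_n$, mapping training data $(X_i,Y_i)_{i\le n}$ and a point $x$ to a set $\widehat{C}_n(x)\subseteq\mathbb{R}$, provides a $(1-\alpha)$-distribution-free confidence interval for binary regression if, for all distributions $P$ on $\mathbb{R}^d\times\{0,1\}$, with $(X_i,Y_i)$, $i=1,\dots,n+1$, i.i.d. from $P$, $\mathbb{P}\{\pi_P(X_{n+1})\in\widehat{C}_n(X_{n+1})\}\ge1-\alpha$. Probabilities and expectations are also taken over any additional independent randomness used by the algorithm. The function $\ell$: for $t\in[0,\frac12]$, $a\in[0,1]$, \[\ell(t,a)=\begin{cases}2(1-a)t,& a\ge\frac12,\\ \frac{t}{2a},& a\ge t\text{ and }0<a<\frac12,\\ 1-\frac{a}{2t},& a<t,\\ 0,& a=t=0,\end{cases}\] and $\ell(t,a)=\ell(1-t,a)$ for $t\in(\frac12,1]$. For a distribution $Q$ on $[0,1]$, \[L_\alpha(Q)=\inf\{\mathbb{E}_{T\sim Q}[\ell(T,a(T))]: a:[0,1]\to[0,1]\text{ measurable},\ \mathbb{E}_{T\sim Q}[a(T)]\le\alpha\}.\] Functions $f_{t,a}:[0,1]\to[0,1]$: for $t\in[0,\frac12]$,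 \[f_{t,a}(s)=\begin{cases}(1-a)\cdot\mathbf{1}\{s=0\},& t=0,\\ 1-a,& t=\frac12,\\ 2(1-a)\max\{1-\frac{s}{2t},0\},& 0<t<\frac12,\ a\ge\frac12,\\ \max\{1-\frac{as}{t},0\},& 0<t<\frac12,\ a<\frac12,\end{cases}\] and $f_{t,a}(s)=f_{1-t,a}(1-s)$ for $t\in(\frac12,1]$. Regression algorithm: $\mathcal{R}$ maps a training data set of size $k$ (for any $k$) to a (measurable) function $\widehat\pi^{\mathcal{R}}_k:\mathbb{R}^d\to[0,1]$, viewed as an estimate of $\pi_P$. Its expected error is \[\Delta_{k,P}(\mathcal{R})=\mathbb{E}\big[|\widehat\pi^{\mathcal{R}}_k(X_{k+1})-\pi_P(X_{k+1})|\big],\] with expectation over the training data $(X_1,Y_1),\dots,(X_k,Y_k)$ i.i.d. from $P$ and an independent test point $X_{k+1}\sim P_X$. Construction of $\widehat{C}_n^{\mathcal{R}}$: let $\widehat\pi^{\mathcal{R}}_{\lfloor n/2\rfloor}$ be fitted on data points $i=1,\dots,\lfloor n/2\rfloor$. Let $M=\lceil\sqrt{n/\log n}\rceil$ and partition $\mathbb{R}^d$ into \[\widehat{\mathcal{X}}_m=\{x:\tfrac{m-1}{M}\le\widehat\pi^{\mathcal{R}}_{\lfloor n/2\rfloor}(x)<\tfrac mM\}\ (m=1,\dots,M-1),\qquad \widehat{\mathcal{X}}_M=\{x:\tfrac{M-1}{M}\le\widehat\pi^{\mathcal{R}}_{\lfloor n/2\rfloor}(x)\le1\},\] with $m(x)$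 the index such that $x\in\widehat{\mathcal{X}}_{m(x)}$. Write $N=\lceil n/2\rceil$. Let \[\widehat p_m=\frac{\sum_{i=\lfloor n/2\rfloor+1}^n\mathbf 1\{X_i\in\widehat{\mathcal{X}}_m\}}{N},\qquad \widehat\pi_m=\frac{\sum_{i=\lfloor n/2\rfloor+1}^n\mathbf 1\{X_i\in\widehat{\mathcal{X}}_m,Y_i=1\}}{N\widehat p_m},\] with $\widehat\pi_m=\frac12$ if $\widehat p_m=0$. Let \[\tilde p_m=\widehat p_m+\sqrt{\widehat p_m\cdot\tfrac{3\log(4MN/\alpha)}{N}}+\tfrac{3\log(4MN/\alpha)}{N},\] \[\tilde\pi_m=\begin{cases}\min\Big\{\frac12,\ \widehat\pi_m+\sqrt{\widehat\pi_m\cdot\frac{2\log(4MN/\alpha)}{N\widehat p_m}}+\frac{2\log(4MN/\alpha)}{N\widehat p_m}\Big\},&\widehat\pi_m\le\frac12,\\[4pt] \max\Big\{\frac12,\ \widehat\pi_m-\sqrt{(1-\widehat\pi_m)\cdot\frac{2\log(4MN/\alpha)}{N\widehat p_m}}-\frac{2\log(4MN/\alpha)}{N\widehat p_m}\Big\},&\widehat\pi_m>\frac12\end{cases}\] (so $\tilde\pi_m=\frac12$ when $\widehat p_m=0$). Let $\tilde{\mathbf a}=(\tilde a_1,\dots,\tilde a_M)$ be a minimizer \[\tilde{\mathbf a}\in\operatorname*{argmin}_{a_1,\dots,a_M\in[0,1]}\Big\{\sum_{m=1}^M\tilde p_m\,\ell(\tilde\pi_m,a_m)\ :\ \sum_{m=1}^M\tilde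 p_m a_m\le\alpha\Big\}.\] Finally, with $U\sim\mathrm{Unif}[0,1]$ independent of the data, \[\widehat{C}_n^{\mathcal{R}}(x)=\{s\in[0,1]: f_{\tilde\pi_{m(x)},\tilde a_{m(x)}}(s)\ge U\}.\] *)

(* Defs.v *)
(* MathComp-Analysis, over an abstract [R : realType]. *)
From HB Require Import structures.
From mathcomp Require Import all_boot all_order all_algebra.
From mathcomp Require Import all_classical all_reals all_analysis.

Set Implicit Arguments.
Unset Strict Implicit.
Unset Printing Implicit Defensive.

Import Order.TTheory GRing.Theory Num.Theory.
Import numFieldNormedType.Exports.

Local Open Scope classical_set_scope.
Local Open Scope ring_scope.

Section iid_law.
Context d (T : measurableType d) (R : realType).

Definition tuple_cons n (p : T * n.-tuple T) : n.+1.-tuple T :=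
  [tuple of p.1 :: p.2].

Lemma measurable_tuple_cons n : measurable_fun [set: _] (@tuple_cons n).
Proof. exact: measurable_cons. Qed.

HB.instance Definition _ n :=
  isMeasurableFun.Build _ _ _ _ (@tuple_cons n) (@measurable_tuple_cons n).

(* Joint law of [n] i.i.d. draws from [P], i.e. the [n]-fold product measure of
   [P]; [iid_law_box] below is its defining property. *)
Fixpoint iid_law (P : probability T R) (n : nat) : probability (n.-tuple T) R :=
  match n with
  | 0%N => dirac [tuple]
  | n'.+1 => distribution (P \x iid_law P n')%E (@tuple_cons n')
  end.

Lemma measurable_box n (A : 'I_n -> set T) : (forall i, measurable (A i)) ->
  measurable [set t : n.-tuple T | forall i, A i (tnth t i)].
Proof.
move=> mA.
rewrite (_ : [set _ | _] =
    \bigcap_(i in [set: 'I_n]) ((fun t : n.-tuple T => tnth t i) @^-1` A i)).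
  apply: fin_bigcap_measurable => [|i _]; first exact: finite_finset.
  by rewrite -[X in measurable X]setTI; apply: measurable_tnth => //; exact: mA.
by apply/seteqP; split=> t /= tA i => [_|]; exact: tA.
Qed.

Lemma iid_law_box (P : probability T R) n (A : 'I_n -> set T) :
  (forall i, measurable (A i)) ->
  (iid_law P n [set t | forall i, A i (tnth t i)] = \prod_(i < n) P (A i))%E.
Proof.
elim: n A => [A _|n IH A mA] /=.
  by rewrite big_ord0 diracE mem_set// => -[].
rewrite big_ord_recl /distribution /pushforward /=.
rewrite (_ : _ @^-1` _ =
  A ord0 `*` [set t : n.-tuple T | forall i, A (lift ord0 i) (tnth t i)]).
  have mA' (i : 'I_n) : measurable (A (lift ord0 i)) by exact: mA.
  rewrite product_measure1E//; first by congr *%E; exact: IH.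
  exact: (measurable_box mA').
apply/seteqP; split=> -[x t] /=.
- move=> xtA; split; first exact: (xtA ord0).
  by move=> i; have := xtA (lift ord0 i); rewrite /tuple_cons tnthS.
- move=> [xA tA] i; case: (unliftP ord0 i) => [j|] ->; last exact: xA.
  by rewrite /tuple_cons tnthS.
Qed.

End iid_law.

HB.instance Definition _ d1 d2 (T1 : measurableType d1)
    (T2 : measurableType d2) :=
  isMeasurableFun.Build _ _ _ _ (@fst T1 T2) measurable_fst.

(* [R^d] is [d.-tuple R] with the product (Borel) sigma-algebra. *)
Notation covariate R d := (d.-tuple R).

(* An observation [(x, y)]; the label is [1] when [y = true]. *)
Notation observation R d := (covariate R d * bool)%type.

Section setting.
Context (R : realType) (d : nat).
Let X := covariate R d.
Let Z := observation R d.

Implicit Types (P : probability Z R) (eta : {mfun X >-> R}).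

Definition marginal P : probability X R := distribution P (@fst X bool).

(* [eta] is a version of the regression function
   [x |-> P (Y = 1 | X = x)] of [P]. *)
Definition regression_function P eta :=
  (forall x, 0 <= eta x <= 1) /\
  forall A : set X, measurable A ->
    (P (A `*` [set true]) = \int[marginal P]_(x in A) (eta x)%:E)%E.

(* Law of [eta X] when [(X, Y)] has law [P]. *)
Definition regression_law P eta : probability R R :=
  distribution (marginal P) eta.

(* [C D x w] is the set output for the training data [D] at the point [x], with
   additional randomness [w], drawn from [Q] independently of the data. *)
Definition distribution_free_CI n dW (W : measurableType dW)
    (Q : probability W R) (alpha : R) (C : n.-tuple Z -> X -> W -> set R) :=
  forall P eta, regression_function P eta ->
    ((1 - alpha)%:E <= ((iid_law P n \x P) \x Q)
       [set w | C w.1.1 w.1.2.1 w.2 (eta w.1.2.1)])%E.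

Definition expected_length n dW (W : measurableType dW)
    (Q : probability W R) (C : n.-tuple Z -> X -> W -> set R) P : \bar R :=
  (\int[(iid_law P n \x P) \x Q]_w lebesgue_measure (C w.1.1 w.1.2.1 w.2))%E.

(* Measurability is joint in the training data and the point, as needed for the
   expected error below to be meaningful. *)
Record regression_algorithm := RegressionAlgorithm {
  fit : forall k, k.-tuple Z -> X -> R ;
  fit_measurable : forall k,
    measurable_fun [set: k.-tuple Z * X] (fun p => fit p.1 p.2) ;
  fit_ge0_le1 : forall k (D : k.-tuple Z) x, 0 <= fit D x <= 1 }.

Definition regression_error P eta (A : regression_algorithm) k : R :=
  \int[(iid_law P k \x marginal P)%E]_w `|fit A w.1 w.2 - eta w.2|.

End setting.

Section loss.
Context (R : realType).
Implicit Types t a s : R.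
Let I01 : set R := `[0, 1].

Definition ell_low t a : R :=
  if 2^-1 <= a then 2 * (1 - a) * t
  else if (t <= a) && (0 < a) then t / (2 * a)
  else if a < t then 1 - a / (2 * t)
  else 0.

Definition ell t a : R := if t <= 2^-1 then ell_low t a else ell_low (1 - t) a.

(* A distribution on [[0, 1]] is seen as a probability on [R]; only its
   restriction to [[0, 1]] matters. *)
Definition optimal_length (alpha : R) (Q : probability R R) : \bar R :=
  ereal_inf [set (\int[Q]_(t in I01) (ell t (a t))%:E)%E | a in
    [set a : R -> R |
      [/\ measurable_fun I01 a,
          forall t, I01 t -> 0 <= a t <= 1 &
          (\int[Q]_(t in I01) (a t)%:E <= alpha%:E)%E]]].

Definition fsel_low t a s : R :=
  if t == 0 then (1 - a) * (s == 0)%:R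
  else if t == 2^-1 then 1 - a
  else if 2^-1 <= a then 2 * (1 - a) * Num.max (1 - s / (2 * t)) 0
  else Num.max (1 - a * s / t) 0.

(* The selection function [f_{t,a}]. *)
Definition fsel t a s : R :=
  if t <= 2^-1 then fsel_low t a s else fsel_low (1 - t) a (1 - s).

End loss.

Definition nbins (R : realType) (n : nat) : nat :=
  `|Num.ceil (Num.sqrt (n%:R / ln n%:R) : R)|%N.

Section construction.
Context (R : realType) (d n : nat) (alpha : R) (A : regression_algorithm R d).
Let X := covariate R d.
Let Z := observation R d.
Let M := nbins R n.
Let N := uphalf n.

Lemma half_le : (n./2 <= n)%N.
Proof. by rewrite leq_half_double -addnn -addnS leq_addr. Qed.

Section data.
Variable D : n.-tuple Z.

Definition fit_half : X -> R :=
  fit A [tuple tnth D (widen_ord half_le i) | i < n./2].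

(* Indices are shifted: the bins are numbered from [0] to [M - 1]. *)
Definition bin (m : 'I_M) : set X := [set x |
  if m.+1 == M then m%:R / M%:R <= fit_half x <= 1
  else m%:R / M%:R <= fit_half x < m.+1%:R / M%:R].

Definition phat (m : 'I_M) : R :=
  (\sum_(i < n | (n./2 <= i)%N) \1_(bin m) (tnth D i).1) / N%:R.

Definition pihat (m : 'I_M) : R :=
  if phat m == 0 then 2^-1
  else (\sum_(i < n | (n./2 <= i)%N) \1_(bin m `*` [set true]) (tnth D i))
       / (N%:R * phat m).

Let L : R := ln (4 * M%:R * N%:R / alpha).

Definition ptilde (m : 'I_M) : R :=
  phat m + Num.sqrt (phat m * (3 * L / N%:R)) + 3 * L / N%:R.

(* If [phat m = 0], division by [0] yields [0] and the value is [1/2], as it is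
   when the quotients are read as [+oo]. *)
Definition pitilde (m : 'I_M) : R :=
  let r := 2 * L / (N%:R * phat m) in
  if pihat m <= 2^-1 then
    Num.min 2^-1 (pihat m + Num.sqrt (pihat m * r) + r)
  else
    Num.max 2^-1 (pihat m - Num.sqrt ((1 - pihat m) * r) - r).

Definition feasible (a : 'I_M -> R) :=
  (forall m, 0 <= a m <= 1) /\ \sum_m ptilde m * a m <= alpha.

Definition is_minimizer (a : 'I_M -> R) :=
  feasible a /\
  forall b, feasible b ->
    \sum_m ptilde m * ell (pitilde m) (a m) <=
    \sum_m ptilde m * ell (pitilde m) (b m).

End data.

(* The argmin need not be a singleton: [a] is a measurable choice of one of its
   elements for each training data set. *)
Definition minimizer_selection (a : n.-tuple Z -> 'I_M -> R) :=
  (forall m, measurable_fun [set: n.-tuple Z] (fun D => a D m)) /\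
  forall D, is_minimizer D (a D).

(* The bins partition the space since [fit] takes values in [[0, 1]], so [m] is
   the index of the bin of [x]. *)
Definition split_CI (a : n.-tuple Z -> 'I_M -> R)
    (D : n.-tuple Z) (x : X) (u : R) : set R :=
  [set s | 0 <= s <= 1 /\
    exists m : 'I_M, bin D m x /\ u <= fsel (pitilde D m) (a D m) s].

End construction.

(* Main.v *)
Require Import Defs.
From HB Require Import structures.
From mathcomp Require Import all_boot all_order all_algebra.
From mathcomp Require Import all_classical all_reals all_analysis.
From mathcomp Require Import measurable_realfun ring lra.
Import Order.TTheory GRing.Theory Num.Theory.
Import numFieldNormedType.Exports.
Set Implicit Arguments.
Unset Strict Implicit.
Unset Printing Implicit Defensive.
Local Open Scope classical_set_scope.
Local Open Scope ring_scope.

(** Condition on the first half of the data.  The bins then form a fixed finite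
    partition of the covariate space; let p_m be the mass of bin m and pi_m the
    mean of eta on it.

    Coverage.  As U is uniform, the conditional coverage at x is f (eta x), where
    f is the selection function of the bin of x, with parameters t and a.  It has
    a supporting line at t with value 1 - a there, sloping down away from the
    nearer end of the unit interval.  So as soon as the shrunk rate t lies between
    pi_m and 1/2, the mean coverage on the bin is at least 1 - a, and the total
    coverage is at least 1 - sum_m p_m a_m ([coverage_given_bins]).  On a good
    sample each inflated mass is at least p_m + L/N with L = ln (4MN/alpha), so
    the constraint satisfied by the a_m gives sum_m p_m a_m <= alpha / (1 + L/N).
    This gain over alpha pays for the probability alpha/N that some empirical
    quantity strays ([good_coverage], [coverage_budget]).

    Length.  The conditional mean length on a bin is ell t a, the integral of f.
    It is compared with the optimum by Lagrange duality.  For lam >= 0 the minimum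
    of ell t a + lam a over a is
      [dual_loss lam t] = min (1, lam, sqrt (2 lam min (t, 1 - t))).
    The chosen a solves a finite convex program, hence has a multiplier lam, at
    most (sum of the inflated masses) / alpha, for which its value is at most the
    sum of inflated mass times [dual_loss] over the bins, minus lam alpha
    ([minimizer_le_dual_loss]).  In the population problem every lam, and this one
    in particular, yields the lower bound E [dual_loss lam (eta X)] - lam alpha
    ([expect_dual_loss_le_optimal_length]).  Only two values of the same explicit
    function remain to be compared.  It is Lipschitz in sqrt (min (t, 1 - t)), the
    scale in which t is within O(sqrt (L / N p_m)) of pi_m, and Cauchy-Schwarz
    over the bins bounds that cost by O(sqrt (M L / N alpha)).  Passing from pi_m
    to eta costs sqrt (2 lam E |pi_m - eta|), and E |pi_m - eta| is at most twice
    the regression error plus 2/M; this is where 2 sqrt (Delta / alpha) comes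
    from.  With M of order sqrt (n / ln n), everything else is of order
    (ln n / n)^(1/4) / sqrt alpha ([rate_bound]).

    Deviations.  Given the number k of points in a bin, the number of those with
    a given label is binomial.  The identity [hits_mgf] separates the values of k,
    so Chernoff's parameter may depend on k without a union bound over k, and
    the probability of a deviation in either direction is at most e^-L
    ([hits_lower_tail], [hits_upper_tail]). *)

(** * The Lagrangian dual of the loss *)

Section loss_duality.
Context (R : realType).
Implicit Types t a lam b th : R.

Definition folded t : R := Num.min t (1 - t).

(** The minimum over a in the unit interval of ell t a + lam * a. The three
    terms of the minimum are the values at a = 0, a = 1 and, for t <= 1/2, the
    stationary point sqrt (t / (2 lam)). *)
Definition dual_loss lam t : R :=
  Num.min 1 (Num.min lam (Num.sqrt (2 * lam * folded t))).

Lemma sqrt_le_of_sq (x y : R) : 0 <= y -> x <= y ^+ 2 -> Num.sqrt x <= y.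
Proof.
move=> y0 xy; rewrite -[leRHS](ger0_norm y0) -sqrtr_sqr ler_wsqrtr//.
Qed.

Lemma le_sqrt_of_sq (x y : R) : y ^+ 2 <= x -> y <= Num.sqrt x.
Proof.
by move=> yx; rewrite (le_trans (ler_norm y))// -sqrtr_sqr ler_wsqrtr.
Qed.

Lemma folded01 t : 0 <= t <= 1 -> 0 <= folded t <= 2^-1.
Proof. by rewrite /folded => t01; case: (leP t) => h; apply/andP; split; lra. Qed.

Lemma ellE t a : 0 <= t <= 1 -> ell t a = ell_low (folded t) a.
Proof.
rewrite /ell /folded => t01; case: (leP t 2^-1) => h; congr ell_low; case: leP => //= ?; lra.
Qed.

(** Where ell is linear in a, its Lagrangian is a weighted mean of two end
    values, and at the shared end a = t or a = 1/2 as well as on the hyperbolic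
    piece the bound by the square root is the inequality of arithmetic and
    geometric means. *)
Lemma ell_low_ge_dual_loss lam t a : 0 <= lam -> 0 <= t <= 2^-1 -> 0 <= a <= 1 ->
  Num.min 1 (Num.min lam (Num.sqrt (2 * lam * t))) <= ell_low t a + lam * a.
Proof.
move=> lam0 /andP[t0 t2] /andP[a0 a1]; set S := Num.sqrt _; set m := Num.min _ _.
have m1 : m <= 1 by rewrite ge_min lexx.
have ml : m <= lam by rewrite /m !ge_min lexx orbT.
have mS : m <= S by rewrite /m !ge_min lexx !orbT.
have S0 : 0 <= S by exact: sqrtr_ge0.
have SS : S ^+ 2 = 2 * lam * t by rewrite sqr_sqrtr//; nra.
rewrite /ell_low; case: ifPn => [a2|]; last rewrite -ltNge => a2.
  have : S <= t + lam / 2.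
    by apply: sqrt_le_of_sq; [lra | have := sqr_ge0 (t - lam / 2); nra].
  nra.
case: ifPn => [/andP[ta ap]|].
  have -> : t / (2 * a) + lam * a = (t + 2 * lam * a ^+ 2) / (2 * a).
    by field; lra.
  rewrite (le_trans mS)// ler_pdivlMr; last lra.
  have e : (S * (2 * a)) ^+ 2 = 8 * lam * t * a ^+ 2 by rewrite exprMn SS; ring.
  rewrite -(@ler_pXn2r _ 2)// ?nnegrE; [|nra|nra].
  by rewrite e; have := sqr_ge0 (t - 2 * lam * a ^+ 2); nra.
case: ifPn => [at_ _|].
  have tp : 0 < t by lra.
  have h : S <= 2^-1 + lam * t.
    by apply: sqrt_le_of_sq; [nra | have := sqr_ge0 (2^-1 - lam * t); nra].
  pose u := a / t; have ua : a = u * t by rewrite /u; field; lra.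
  have u1 : u <= 1 by rewrite /u ler_pdivrMr ?mul1r; lra.
  have u0 : 0 <= u by rewrite /u divr_ge0.
  have -> : a / (2 * t) = u / 2 by rewrite /u; field; lra.
  rewrite ua.
  have := mS; have := m1; nra.
rewrite -leNgt => ta /nandP[|]; rewrite -?ltNge -?leNgt => h; first lra.
have t00 : t = 0 by lra.
by rewrite (le_trans mS)// /S t00 mulr0 sqrtr0 add0r mulr_ge0.
Qed.

Lemma ell_ge_dual_loss lam t a : 0 <= lam -> 0 <= t <= 1 -> 0 <= a <= 1 ->
  dual_loss lam t <= ell t a + lam * a.
Proof.
by move=> l0 t01 a01; rewrite ellE// /dual_loss ell_low_ge_dual_loss// folded01.
Qed.

Lemma ell_low01 t a : 0 <= t <= 2^-1 -> 0 <= a <= 1 -> 0 <= ell_low t a <= 1.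
Proof.
move=> t01 a01; rewrite /ell_low; case: ifPn => [a2|_]; first by apply/andP; split; nra.
case: ifPn => [/andP[ta a0]|_].
  by rewrite divr_ge0 /= ?ler_pdivrMr ?mul1r; lra.
case: ifPn => [at_|_]; last by rewrite lexx ler01.
rewrite subr_ge0 ler_pdivrMr ?mul1r; last lra.
by rewrite gerBl divr_ge0 ?andbT; lra.
Qed.

Lemma ell01 t a : 0 <= t <= 1 -> 0 <= a <= 1 -> 0 <= ell t a <= 1.
Proof. by move=> t01 a01; rewrite ellE// ell_low01// folded01. Qed.

Lemma dual_loss_attained lam t : 0 <= lam -> 0 <= t <= 1 ->
  exists2 b, 0 <= b <= 1 & ell t b + lam * b <= dual_loss lam t.
Proof.
move=> l0 t01; rewrite /dual_loss; set u := folded t.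
have /andP[u0 u2] : 0 <= u <= 2^-1 by exact: folded01.
set S := Num.sqrt _.
have SS : S ^+ 2 = 2 * lam * u by rewrite sqr_sqrtr//; nra.
have S0 : 0 <= S by exact: sqrtr_ge0.
have [h1|h1] := leP 1 (Num.min lam S).
  have z01 : 0 <= (0 : R) <= 1 by rewrite lexx ler01.
  by exists 0 => //; rewrite mulr0 addr0; have /andP[] := ell01 t01 z01.
have [h2|h2] := leP lam S.
  exists 1; first by rewrite ler01 lexx.
  rewrite ellE// /ell_low ifT; lra.
have lp : 0 < lam by lra.
have Slt : S < 1 by move: h1; rewrite (min_idPr (ltW h2)).
pose b := S / (2 * lam).
have bS : S = 2 * lam * b by rewrite /b; field; lra.
have b0 : 0 <= b by rewrite /b divr_ge0//; lra.
have b2 : b <= 2^-1 by nra.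
have ub : u = 2 * lam * b ^+ 2.
  apply: (@mulfI _ (2 * lam)); first by lra.
  by rewrite -SS bS; ring.
have ule : u <= b by rewrite bS in Slt; rewrite ub; nra.
exists b; first by apply/andP; split; lra.
rewrite ellE// -/u /ell_low.
case: ifPn => [b2'|].
  by have e : b = 2^-1 by [lra|]; rewrite bS ub e; lra.
rewrite -ltNge => b2'; rewrite ule/=; case: ifPn => [bp|].
  by rewrite bS {1}ub (_ : _ / _ = lam * b); [lra|field; lra].
by rewrite -leNgt => bn; have -> : b = 0 by [lra|]; rewrite ifF ?mulr0 ?addr0//; lra.
Qed.

(** The multiplier is minus the slope of ell t at a. *)
Lemma ell_supported t a : 0 <= t <= 1 -> 0 <= a <= 1 ->
  exists2 lam, 0 <= lam & ell t a + lam * a <= dual_loss lam t.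
Proof.
move=> t01 a01; rewrite ellE// /dual_loss; set u := folded t.
have /andP[u0 u2] : 0 <= u <= 2^-1 by exact: folded01.
rewrite /ell_low; case: ifPn => [a2|]; last rewrite -ltNge => a2.
  exists (2 * u); first lra.
  rewrite (_ : _ + _ = 2 * u); last by ring.
  rewrite !le_min lexx/=; apply/andP; split; first lra.
  by apply: le_sqrt_of_sq; nra.
case: ifPn => [/andP[ua a0]|].
  exists (u / (2 * a ^+ 2)); first by rewrite divr_ge0//; nra.
  have -> : u / (2 * a) + u / (2 * a ^+ 2) * a = u / a by field; lra.
  have ua1 : u / a <= 1 by rewrite ler_pdivrMr// mul1r.
  rewrite !le_min ua1/=; apply/andP; split.
    rewrite ler_pdivrMr// (_ : _ * a = u / (2 * a)); last by field; lra.
    by rewrite ler_pdivlMr; nra.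
  by apply: le_sqrt_of_sq; rewrite le_eqVlt; apply/orP; left; apply/eqP; field; lra.
case: ifPn => [au _|].
  have up : 0 < u by lra.
  exists (1 / (2 * u)); first by rewrite divr_ge0; lra.
  have -> : 1 - a / (2 * u) + 1 / (2 * u) * a = 1 by field; lra.
  rewrite !le_min lexx/= ler_pdivlMr; last lra.
  rewrite mul1r; apply/andP; split; first lra.
  by apply: le_sqrt_of_sq; rewrite le_eqVlt; apply/orP; left; apply/eqP; field; lra.
move=> h1 h2; exists 0 => //.
by rewrite mul0r addr0 !le_min ler01 lexx sqrtr_ge0.
Qed.

(** A function with a supporting line at every point is convex; the lines are
    those of [ell_supported] and [ell_ge_dual_loss]. *)
Lemma ell_convex t a b th : 0 <= t <= 1 -> 0 <= a <= 1 -> 0 <= b <= 1 ->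
  0 <= th <= 1 ->
  ell t (th * a + (1 - th) * b) <= th * ell t a + (1 - th) * ell t b.
Proof.
move=> t01 a01 b01 th01.
have c01 : 0 <= th * a + (1 - th) * b <= 1 by apply/andP; split; nra.
have [lam l0 lP] := ell_supported t01 c01.
have := ell_ge_dual_loss l0 t01 a01; have := ell_ge_dual_loss l0 t01 b01.
nra.
Qed.

End loss_duality.

(** * A multiplier for the finite program *)

Section lagrange_multiplier.
Context (R : realType) (M : nat).
Implicit Types w t a b : 'I_M -> R.

Definition unit_valued b := forall m, 0 <= b m <= 1.

Lemma total_ell_convex w t a b (th : R) : (forall m, 0 <= w m) ->
  unit_valued t -> unit_valued a -> unit_valued b -> 0 <= th <= 1 ->
  \sum_m w m * ell (t m) (th * a m + (1 - th) * b m) <=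
  th * (\sum_m w m * ell (t m) (a m)) +
  (1 - th) * (\sum_m w m * ell (t m) (b m)).
Proof.
move=> w0 t01 a01 b01 th01; rewrite !mulr_sumr -big_split/= ler_sum// => m _.
have := ler_wpM2l (w0 m) (ell_convex (t01 m) (a01 m) (b01 m) th01).
by move=> /le_trans; apply; rewrite le_eqVlt; apply/orP; left; apply/eqP; ring.
Qed.

(** Mixing a point above the budget with one below it produces a point that
    spends exactly alpha, which cannot beat the minimizer. Hence every rate of
    gain above the budget is at most every rate of loss below it, and the
    supremum of the former is a multiplier. Comparing with b = 0 bounds it. *)
Lemma lagrange_multiplier w t a (alpha : R) :
  (forall m, 0 <= w m) -> unit_valued t -> unit_valued a -> 0 < alpha ->
  (forall b, unit_valued b -> \sum_m w m * b m <= alpha ->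
    \sum_m w m * ell (t m) (a m) <= \sum_m w m * ell (t m) (b m)) ->
  exists lam, [/\ 0 <= lam, lam * alpha <= \sum_m w m &
    forall b, unit_valued b ->
      \sum_m w m * ell (t m) (a m) + lam * alpha <=
      \sum_m w m * ell (t m) (b m) + lam * \sum_m w m * b m].
Proof.
move=> w0 t01 a01 al0 amin.
pose v b := \sum_m w m * ell (t m) (b m); pose c b := \sum_m w m * b m.
rewrite -/(v a).
have v0 b : unit_valued b -> 0 <= v b.
  by move=> b01; apply: sumr_ge0 => m _; rewrite mulr_ge0//; have /andP[] := ell01 (t01 m) (b01 m).
have crossing b b' : unit_valued b -> unit_valued b' -> alpha < c b ->
    c b' < alpha -> (v a - v b) / (c b - alpha) <= (v b' - v a) / (alpha - c b').
  move=> b01 b'01 cb cb'.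
  pose th := (c b - alpha) / (c b - c b').
  have th01 : 0 <= th <= 1.
    by rewrite /th divr_ge0/= ?ler_pdivrMr ?mul1r; lra.
  pose e m := th * b' m + (1 - th) * b m.
  have ce : c e = alpha.
    have -> : c e = th * c b' + (1 - th) * c b.
      rewrite /c /e !mulr_sumr -big_split/=; apply: eq_bigr => m _; ring.
    by rewrite /th; field; lra.
  have e01 : unit_valued e.
    move=> m; have /andP[? ?] := b01 m; have /andP[? ?] := b'01 m.
    by move: th01 => /andP[? ?]; rewrite /e; apply/andP; split; nra.
  have h1 := amin e e01; rewrite -/(c e) ce -/(v a) -/(v e) in h1.
  have h2 := total_ell_convex w0 t01 b'01 b01 th01.
  rewrite -/(v e) -/(v b) -/(v b') in h2.
  have {h1 h2} h : v a <= th * v b' + (1 - th) * v b by exact: le_trans (h1 _) h2.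
  have D0 : 0 < c b - c b' by lra.
  have : (c b - c b') * v a <= (c b - alpha) * v b' + (alpha - c b') * v b.
    have := ler_wpM2l (ltW D0) h; move=> /le_trans; apply.
    rewrite le_eqVlt; apply/orP; left; apply/eqP; rewrite /th; field; lra.
  move=> {}h; rewrite ler_pdivrMr ?subr_gt0// mulrAC ler_pdivlMr ?subr_gt0//.
  nra.
pose S := [set x | x = 0 \/ exists b, [/\ unit_valued b, alpha < c b &
                                       x = (v a - v b) / (c b - alpha)]].
have ubS b' : unit_valued b' -> c b' < alpha ->
    ubound S ((v b' - v a) / (alpha - c b')).
  move=> b'01 cb' x [->|[b [b01 cb ->]]]; last exact: crossing.
  rewrite divr_ge0// subr_ge0; last exact: ltW.
  by apply: amin => //; exact: ltW.
have z01 : unit_valued (fun=> 0) by move=> m; rewrite lexx ler01.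
have cz : c (fun=> 0) = 0 by rewrite /c big1// => m _; rewrite mulr0.
have Sne : S !=set0 by exists 0; left.
have Sub : has_ubound S.
  by exists ((v (fun=> 0) - v a) / (alpha - c (fun=> 0))); apply: ubS => //; rewrite cz.
have l0 : 0 <= sup S by apply: ub_le_sup => //; left.
exists (sup S); split => //.
- rewrite -ler_pdivlMr//; apply: ge_sup => // x /ubS-/(_ _ z01).
  rewrite cz => /(_ al0)/le_trans; apply; rewrite subr0 ler_pM2r ?invr_gt0//.
  rewrite (@le_trans _ _ (v (fun=> 0)))// ?gerBl ?v0//.
  apply: ler_sum => m _; rewrite ler_piMr//.
  by have /andP[] := ell01 (t01 m) (z01 m).
- move=> b b01; rewrite -/(v b) -/(c b).
  have [cb|cb|cb] := ltgtP (c b) alpha.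
  + have h : sup S <= (v b - v a) / (alpha - c b) by apply: ge_sup => //; exact: ubS.
    by move: h; rewrite ler_pdivlMr ?subr_gt0//; nra.
  + have h : (v a - v b) / (c b - alpha) <= sup S.
      by apply: ub_le_sup => //; right; exists b.
    by move: h; rewrite ler_pdivrMr ?subr_gt0//; nra.
  + by rewrite cb lerD2r; apply: amin => //; rewrite -/(c b) cb.
Qed.

(** Given the multiplier, the Lagrangian is minimized coordinate by coordinate. *)
Lemma minimizer_le_dual_loss w t a (alpha : R) :
  (forall m, 0 <= w m) -> unit_valued t -> unit_valued a -> 0 < alpha ->
  (forall b, unit_valued b -> \sum_m w m * b m <= alpha ->
    \sum_m w m * ell (t m) (a m) <= \sum_m w m * ell (t m) (b m)) ->
  exists lam, [/\ 0 <= lam, lam * alpha <= \sum_m w m &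
    \sum_m w m * ell (t m) (a m) + lam * alpha <=
    \sum_m w m * dual_loss lam (t m)].
Proof.
move=> w0 t01 a01 al0 amin.
have [lam [l0 lS lP]] := lagrange_multiplier w0 t01 a01 al0 amin.
exists lam; split => //.
have /choice[b bP] : forall m, exists c : R,
    0 <= c <= 1 /\ ell (t m) c + lam * c <= dual_loss lam (t m).
  by move=> m; have [c ? ?] := dual_loss_attained l0 (t01 m); exists c.
have b01 : unit_valued b by move=> m; have [] := bP m.
rewrite (le_trans (lP b b01))// mulr_sumr -big_split/= ler_sum// => m _.
by rewrite mulrCA -mulrDr ler_wpM2l//; have [] := bP m.
Qed.

End lagrange_multiplier.

(** * Measurability of the losses and selection functions *)

Section measurability.
Context d (T : measurableType d) (R : realType).
Implicit Types f g h : T -> R.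

(** The inverse is a real power on each side of zero. *)
Lemma measurable_funV f :
  measurable_fun setT f -> measurable_fun setT (fun x => (f x)^-1).
Proof.
move=> mf; suff mV : measurable_fun [set: R] (@GRing.inv R).
  exact: (measurableT_comp mV mf).
rewrite (_ : @GRing.inv R =
    fun x => if 0 <= x then x `^ (-1) else - ((- x) `^ (-1))); last first.
  apply/funext => x; case: ifPn => x0; first by rewrite powR_inv1.
  by rewrite powR_inv1 ?invrN ?opprK// oppr_ge0 ltW// ltNge.
apply: measurable_fun_ifT; first exact: measurable_fun_ler.
- exact: measurable_powR.
- apply: measurableT_comp => //.
  exact: (measurableT_comp (measurable_powR (-1))).
Qed.

Lemma measurable_fun_div f g : measurable_fun setT f -> measurable_fun setT g ->
  measurable_fun setT (fun x => f x / g x).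
Proof. by move=> mf mg; apply: measurable_funM => //; exact: measurable_funV. Qed.

Lemma measurable_fun_sqrt f :
  measurable_fun setT f -> measurable_fun setT (fun x => Num.sqrt (f x)).
Proof.
move=> mf; suff mS : measurable_fun [set: R] (@Num.sqrt R).
  exact: (measurableT_comp mS mf).
rewrite (_ : @Num.sqrt R = fun x => if 0 <= x then x `^ 2^-1 else 0); last first.
  apply/funext => x; case: ifPn => x0; first by rewrite powR12_sqrt.
  by rewrite ler0_sqrtr// ltW// ltNge.
by apply: measurable_fun_ifT => //; exact: measurable_fun_ler.
Qed.

Lemma measurable_fun_nat (b : T -> bool) : measurable_fun setT b ->
  measurable_fun setT (fun x => (b x)%:R : R).
Proof.
move=> mb; rewrite (_ : (fun x => _) = fun x => if b x then 1 else 0); last first.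
  by apply/funext => x; case: (b x).
exact: measurable_fun_ifT.
Qed.

End measurability.

Ltac mfun := repeat lazymatch goal with
  | |- measurable_fun _ (fun _ => ?c) => exact: measurable_cst
  | |- measurable_fun _ (fun x => (nat_of_bool (@?b x))%:R) =>
      apply: measurable_fun_nat
  | |- measurable_fun _ (fun x => (@?f x <= @?g x)%R) => apply: measurable_fun_ler
  | |- measurable_fun _ (fun x => (@?f x < @?g x)%R) => apply: measurable_fun_ltr
  | |- measurable_fun _ (fun x => @?f x == @?g x) => apply: measurable_fun_eqr
  | |- measurable_fun _ (fun x => @?f x && @?g x) => apply: measurable_and
  | |- measurable_fun _ (fun x => Num.max (@?f x) (@?g x)) => apply: measurable_maxr
  | |- measurable_fun _ (fun x => Num.min (@?f x) (@?g x)) => apply: measurable_minr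
  | |- measurable_fun _ (fun x => Num.sqrt (@?f x)) => apply: measurable_fun_sqrt
  | |- measurable_fun _ (fun x => @?f x / @?g x) => apply: measurable_fun_div
  | |- measurable_fun _ (fun x => @?f x * @?g x) => apply: measurable_funM
  | |- measurable_fun _ (fun x => @?f x - @?g x) => apply: measurable_funB
  | |- measurable_fun _ (fun x => @?f x + @?g x) => apply: measurable_funD
  | _ => first [assumption | apply: measurable_fun_ifT]
  end.

Section measurability_of_losses.
Context d (T : measurableType d) (R : realType).
Implicit Types f g h : T -> R.

Lemma measurable_ell f g : measurable_fun setT f -> measurable_fun setT g ->
  measurable_fun setT (fun x => ell (f x) (g x)).
Proof. by move=> mf mg; rewrite /ell /ell_low; mfun. Qed.

Lemma measurable_fsel f g h : measurable_fun setT f -> measurable_fun setT g ->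
  measurable_fun setT h ->
  measurable_fun setT (fun x => fsel (f x) (g x) (h x)).
Proof. by move=> mf mg mh; rewrite /fsel /fsel_low; mfun. Qed.

Lemma measurable_dual_loss (lam : R) f : measurable_fun setT f ->
  measurable_fun setT (fun x => dual_loss lam (f x)).
Proof. by move=> mf; rewrite /dual_loss /folded; mfun. Qed.

End measurability_of_losses.

(** * Supporting lines of the selection functions *)

Section selection_function.
Context (R : realType).
Implicit Types t a s : R.

Lemma fsel_low01 t a s : 0 <= t <= 2^-1 -> 0 <= a <= 1 -> 0 <= s <= 1 ->
  0 <= fsel_low t a s <= 1.
Proof.
move=> /andP[t0 t2] /andP[a0 a1] /andP[s0 s1]; rewrite /fsel_low.
case: (eqVneq t 0) => [_|tn0]; first by case: (s == 0); rewrite ?mulr1 ?mulr0; lra.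
case: (eqVneq t 2^-1) => [_|tn2]; first by apply/andP; split; lra.
have tp : 0 < t by rewrite lt_neqAle eq_sym tn0.
case: ifPn => a2.
  have : Num.max (1 - s / (2 * t)) 0 <= 1.
    by rewrite ge_max ler01 andbT gerBl divr_ge0//; lra.
  have : 0 <= Num.max (1 - s / (2 * t)) 0 by rewrite le_max lexx orbT.
  by move=> ? ?; apply/andP; split; nra.
rewrite le_max lexx orbT/= ge_max ler01 andbT gerBl divr_ge0//; nra.
Qed.

Lemma fsel01 t a s : 0 <= t <= 1 -> 0 <= a <= 1 -> 0 <= s <= 1 ->
  0 <= fsel t a s <= 1.
Proof.
move=> t01 a01 s01; rewrite /fsel; case: (leP t 2^-1) => t2;
  by apply: fsel_low01 => //; apply/andP; split; lra.
Qed.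

Lemma fsel_low_support t a : 0 < t <= 2^-1 -> 0 <= a <= 1 ->
  exists2 k : R, 0 <= k & (t = 2^-1 -> k = 0) /\
    forall s, 1 - a - k * (s - t) <= fsel_low t a s.
Proof.
move=> /andP[t0 t2] /andP[a0 a1]; rewrite /fsel_low gt_eqF//.
case: (eqVneq t 2^-1) => [_|tn2].
  by exists 0 => //; split => // s; rewrite mul0r subr0.
have [a2|a2] := leP 2^-1 a.
  exists ((1 - a) / t); first by rewrite divr_ge0//; lra.
  split=> [/eqP|s]; first by rewrite (negbTE tn2).
  have : 1 - s / (2 * t) <= Num.max (1 - s / (2 * t)) 0 by rewrite le_max lexx.
  have -> : 1 - a - (1 - a) / t * (s - t) = 2 * (1 - a) * (1 - s / (2 * t)).
    by field; lra.
  by move=> h; rewrite ler_wpM2l//; lra.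
exists (a / t); first by rewrite divr_ge0//; lra.
split=> [/eqP|s]; first by rewrite (negbTE tn2).
rewrite le_max; apply/orP; left; rewrite le_eqVlt; apply/orP; left; apply/eqP.
by field; lra.
Qed.

(** The line decreases towards 1/2, and is flat when t = 1/2; so if t lies
    between a mean p and 1/2, the value of the line at p is at least 1 - a. At t
    = 0 and t = 1 there is no such line when a < 1, as f jumps there. *)
Lemma fsel_support t a : 0 < t < 1 -> 0 <= a <= 1 ->
  exists k : R, (forall s, 1 - a - k * (s - t) <= fsel t a s) /\
    forall p, (t < 2^-1 -> p <= t) -> (2^-1 < t -> t <= p) -> 0 <= k * (t - p).
Proof.
move=> /andP[t0 t1] a01; rewrite /fsel; case: (leP t 2^-1) => t2.
  have [|k k0 [k2 kP]] := @fsel_low_support t a _ a01; first by rewrite t0.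
  exists k; split => // p pt _; have [tE|tn] := eqVneq t 2^-1.
    by rewrite k2// mul0r.
  by rewrite mulr_ge0// subr_ge0 pt// lt_neqAle tn.
have [|k k0 [k2 kP]] := @fsel_low_support (1 - t) a _ a01.
  by apply/andP; split; lra.
exists (- k); split => [s|p _ /(_ isT) tp].
  by have := kP (1 - s); rewrite (_ : 1 - s - (1 - t) = - (s - t)) ?mulrN ?mulNr//; ring.
by rewrite mulNr -mulrN mulr_ge0//; lra.
Qed.

End selection_function.

(** * The integral of a selection function is the loss *)

Section selection_function_integral.
Context (R : realType).
Local Notation leb := (@lebesgue_measure R).
Implicit Types t a s c : R.

Lemma integral_affine c (r : R) : 0 < r ->
  (\int[leb]_(s in `[0%R, r]) (1 - c * s)%:E = (r - c * r ^+ 2 / 2)%:E)%E.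
Proof.
move=> r0; pose F : R -> R := fun s => s - c / 2 * s ^+ 2.
have dF (x : R) : is_derive x 1 F (1 - c * x).
  rewrite /F; apply: is_derive_eq.
  by rewrite /GRing.scale/=; lra.
have cF : continuous F.
  by move=> x; apply/differentiable_continuous/derivable1_diffP; exact: (@ex_derive _ _ _ _ _ _ _ (dF x)).
rewrite (@continuous_FTC2 _ _ F)//.
- by rewrite /F; congr EFin; rewrite expr0n/=; lra.
- apply: continuous_subspaceT => x.
  by apply: cvgB; [exact: cvg_cst|apply: cvgM; [exact: cvg_cst|exact: cvg_id]].
- split.
  + by move=> x _; exact: (@ex_derive _ _ _ _ _ _ _ (dF x)).
  + by apply: cvg_at_right_filter; exact: cF.
  + by apply: cvg_at_left_filter; exact: cF.
- by move=> x _; rewrite derive1E; exact: derive_val.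
Qed.


Lemma continuous_ramp c : continuous (fun s : R => Num.max (1 - c * s) 0).
Proof.
move=> x; apply: (@continuous_max R R (fun s => 1 - c * s) (cst 0)); last exact: cst_continuous.
by apply: cvgB; [exact: cvg_cst|apply: cvgM; [exact: cvg_cst|exact: cvg_id]].
Qed.

(** Above 1 the slope makes the ramp vanish on the right of 1/c, which leaves a
    triangle. *)
Lemma integral_ramp c : 0 <= c ->
  (\int[leb]_(s in `[0%R, 1%R]) (Num.max (1 - c * s) 0)%:E =
   (if c <= 1 then 1 - c / 2 else 1 / (2 * c))%:E)%E.
Proof.
move=> c0; case: ifPn => [c1|]; last rewrite -ltNge => c1.
  rewrite (@eq_integral _ _ _ leb _ (fun s : R => (1 - c * s)%:E)); last first.
    move=> s; rewrite inE/= in_itv/= => /andP[s0 s1]; congr EFin.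
    by apply/max_idPl; nra.
  by rewrite integral_affine ?ltr01// expr1n mulr1.
have r0 : 0 < c^-1 by rewrite invr_gt0; lra.
have r1 : c^-1 <= 1 by rewrite invf_le1; lra.
have mramp : measurable_fun [set: R] (fun s : R => (Num.max (1 - c * s) 0)%:E).
  by apply/measurable_EFinP; mfun.
rewrite (@itv_bndbnd_setU _ _ _ (BRight c^-1)) ?bnd_simp ?(ltW r0)//.
rewrite ge0_integral_setU//=; last 3 first.
- exact: measurable_funTS.
- by move=> x _; rewrite lee_fin le_max lexx orbT.
- by apply/disj_setPS => x [/=]; rewrite !in_itv/= => /andP[_ xc] /andP[cx _]; lra.
rewrite [X in (_ + X)%E]integral0_eq ?adde0; last first.
  move=> s /=; rewrite in_itv/= => /andP[cs s1]; congr EFin; apply/max_idPr.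
  rewrite subr_le0; have : c * c^-1 = 1 by rewrite mulfV; lra.
  nra.
rewrite (@eq_integral _ _ _ leb _ (fun s : R => (1 - c * s)%:E)); last first.
  move=> s; rewrite inE/= in_itv/= => /andP[s0 s1]; congr EFin.
  apply/max_idPl; have : c * c^-1 = 1 by rewrite mulfV; lra.
  nra.
by rewrite integral_affine//; congr EFin; field; lra.
Qed.

Lemma continuous_fsel_low t a : t != 0 -> continuous (fsel_low t a).
Proof.
move=> t0; rewrite /fsel_low (negbTE t0).
case: (t == 2^-1); first exact: cst_continuous.
case: (2^-1 <= a).
  rewrite (_ : (fun s => _) =
    fun s => 2 * (1 - a) * Num.max (1 - (2 * t)^-1 * s) 0); last first.
    by apply/funext => s; rewrite (mulrC (2 * t)^-1).
  by move=> x; apply: cvgM; [exact: cvg_cst|exact: continuous_ramp].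
rewrite (_ : (fun s => _) = fun s => Num.max (1 - a / t * s) 0); last first.
  by apply/funext => s; rewrite mulrAC.
exact: continuous_ramp.
Qed.

Lemma integral_fsel_low t a : 0 < t <= 2^-1 -> 0 <= a <= 1 ->
  (\int[leb]_(s in `[0%R, 1%R]) (fsel_low t a s)%:E = (ell_low t a)%:E)%E.
Proof.
move=> /andP[t0 t2] /andP[a0 a1]; rewrite /fsel_low /ell_low gt_eqF//.
have I1 (r : R) : (\int[leb]_(s in `[0%R, 1%R]) r%:E = r%:E)%E.
  by rewrite integral_cst//= lebesgue_measure_itv/= lte_fin ltr01 -EFinB subr0 mule1.
case: (eqVneq t 2^-1) => [->|tn2].
  rewrite I1; congr EFin; case: (leP 2^-1 a) => a2; first lra.
  by rewrite /=; lra.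
have t2' : t < 2^-1 by rewrite lt_neqAle tn2.
case: (leP 2^-1 a) => a2.
  under eq_integral do rewrite EFinM.
  have e (s : R) : s / (2 * t) = (2 * t)^-1 * s by rewrite mulrC.
  under eq_integral do rewrite e.
  rewrite ge0_integralZl//; last 3 first.
  - by apply/measurable_EFinP/measurable_funTS; mfun.
  - by move=> s _; rewrite lee_fin le_max lexx orbT.
  - by rewrite lee_fin; nra.
  rewrite integral_ramp ?invr_ge0; last lra.
  rewrite ifF; last by apply/negbTE; rewrite -ltNge invf_gt1; lra.
  by rewrite -EFinM; congr EFin; field; lra.
have e (s : R) : a * s / t = a / t * s by rewrite mulrAC.
under eq_integral do rewrite e.
rewrite integral_ramp ?divr_ge0//; last exact: ltW.
congr EFin; rewrite ler_pdivrMr// !mul1r.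
case: (ltgtP a t) => [at_|ta|->].
- by rewrite /=; field; lra.
- by rewrite (lt_trans t0 ta)/=; field; lra.
- by rewrite t0/=; field; lra.
Qed.

(** For t > 1/2 the function is reflected. *)
Lemma integral_fsel t a : 0 < t < 1 -> 0 <= a <= 1 ->
  (\int[leb]_(s in `[0%R, 1%R]) (fsel t a s)%:E = (ell t a)%:E)%E.
Proof.
move=> /andP[t0 t1] a01; rewrite /fsel /ell.
case: (leP t 2^-1) => t2; first by rewrite integral_fsel_low// t0.
rewrite -integral_fsel_low//; last by apply/andP; split; lra.
rewrite [RHS]integration_by_substitution_onem ?ler01 ?lexx//; last first.
  by apply: continuous_subspaceT; apply: continuous_fsel_low; rewrite gt_eqF//; lra.
by rewrite /unstable.onem subrr.
Qed.

End selection_function_integral.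

(** * Uniform thresholds *)

Section uniform_threshold.
Context (R : realType).
Local Notation leb := (@lebesgue_measure R).
Local Notation U := (uniform_prob (@ltr01 R)).

Lemma uniform_prob_le (c : R) : 0 <= c <= 1 -> U [set u | u <= c] = c%:E.
Proof.
move=> /andP[c0 c1].
have mc : measurable [set u : R | u <= c].
  have -> : [set u : R | u <= c] = `]-oo, c]%classic.
    by apply/seteqP; split => x /=; rewrite in_itv.
  exact: measurable_itv.
rewrite -(setIT [set u : R | u <= c]) -integral_indic// integral_uniform//; last first.
  exact/measurable_EFinP/measurable_indic.
rewrite subr0 invr1 mul1e integral_indic//=.
have -> : [set u : R | u <= c] `&` `[0%R, 1%R] = `[0%R, c]%classic.
  apply/seteqP; split => x /=; rewrite !in_itv/=.
  - by move=> [-> /andP[-> _]].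
  - by move=> /andP[-> xc]; split => //; rewrite (le_trans xc).
by rewrite lebesgue_measure_itv/= lte_fin; case: ltgtP c0 => // [c0|<-] _; rewrite ?subr0// -EFinB subr0.
Qed.

(** Tonelli: both sides are the area of the region under the graph of f. *)
Lemma uniform_superlevel_length (f : R -> R) : measurable_fun setT f ->
  (forall s, 0 <= s <= 1 -> 0 <= f s <= 1) ->
  (\int[U]_u leb [set s : R | (0 <= s <= 1)%R /\ (u <= f s)%R] =
   \int[leb]_(s in `[0%R, 1%R]) (f s)%:E)%E.
Proof.
move=> mf f01.
pose b (w : R * R) := (0 <= w.2) && ((w.2 <= 1) && (w.1 <= f w.2)).
pose E := [set w : R * R | b w].
have mb : measurable_fun setT b.
  apply: measurable_and; first exact: measurable_fun_ler.
  apply: measurable_and; first exact: measurable_fun_ler.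
  by apply: measurable_fun_ler => //; apply: measurableT_comp.
have mE : measurable E.
  by rewrite -[E]setTI; exact: mb.
have mE1 : measurable_fun setT (fun w : R * R => (\1_E w : R)%:E).
  exact/measurable_EFinP/measurable_indic.
have xE u : [set s : R | (0 <= s <= 1)%R /\ (u <= f s)%R] = xsection E u.
  apply/seteqP; split => s; rewrite /xsection/= inE /E/= /b/=.
    by move=> [/andP[-> ->] ->].
  by move=> /and3P[-> -> ->].
transitivity (\int[U]_u \int[leb]_s (\1_E (u, s))%:E)%E.
  apply: eq_integral => u _; rewrite xE.
  rewrite -[X in leb X]setIT -integral_indic//; last exact: measurable_xsection.
  by apply: eq_integral => s _; congr EFin; rewrite !indicE mem_xsection.
rewrite (@fubini_tonelli _ _ _ _ _ U leb (fun w => (\1_E w)%:E))//.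
rewrite [RHS]integral_mkcond/=; apply: eq_integral => s _.
rewrite patchE; case: ifPn => [|/negP s01].
  rewrite inE/= in_itv/= => s01.
  rewrite -(uniform_prob_le (f01 s s01)) -(setIT [set u : R | u <= f s]).
  rewrite -integral_indic//; last first.
    have -> : [set u : R | u <= f s] = `]-oo, f s]%classic.
      by apply/seteqP; split => x /=; rewrite in_itv.
    exact: measurable_itv.
  apply: eq_integral => u _; congr EFin; rewrite !indicE; congr (nat_of_bool _)%:R.
  apply/idP/idP => /set_mem h; apply/mem_set; move: h; rewrite /E/= /b/=.
    by move=> /and3P[].
  by move: s01 => /andP[-> ->] ->.
apply: integral0_eq => u _; congr EFin; rewrite indicE memNset// /E/= /b/= => /and3P[s0 s1 _].
by apply: s01; rewrite inE/= in_itv/= s0.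
Qed.
End uniform_threshold.

(** * Inflating masses and shrinking rates towards one half *)

Section one_bin.
Context (R : realType).
Implicit Types x y c p t lam : R.

Definition inflate x c : R := x + Num.sqrt (x * c) + c.

(** This is the map from the empirical rate to the one used by the procedure,
    with c = 2 L / (number of points in the bin). *)
Definition shrink_to_half t c : R :=
  if t <= 2^-1 then Num.min 2^-1 (inflate t c)
  else Num.max 2^-1 (t - Num.sqrt ((1 - t) * c) - c).

(** If sqrt p exceeded sqrt x + sqrt c, then p - sqrt (p c) would exceed x;
    inserting sqrt p <= sqrt x + sqrt c once into p <= x + sqrt (p c) gives the
    claim with the right constant. *)
Lemma inflate_ge x c p : 0 <= x -> 0 <= c -> 0 <= p ->
  p - Num.sqrt (p * c) <= x -> p <= inflate x c.
Proof.
move=> x0 c0 p0; rewrite /inflate !sqrtrM//.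
have : Num.sqrt p ^+ 2 = p by rewrite sqr_sqrtr.
have : Num.sqrt x ^+ 2 = x by rewrite sqr_sqrtr.
have : Num.sqrt c ^+ 2 = c by rewrite sqr_sqrtr.
have := sqrtr_ge0 p; have := sqrtr_ge0 x; have := sqrtr_ge0 c.
move: (Num.sqrt p) (Num.sqrt x) (Num.sqrt c) => s y k k0 y0 s0 kk yy ss.
rewrite -ss -yy -kk => h.
have : s <= k + y by rewrite leNgt; apply/negP => sky; nra.
nra.
Qed.

(** Inflation is dominated by a translation in square-root scale. *)
Lemma sqrt_inflate x c : 0 <= x -> 0 <= c ->
  Num.sqrt (inflate x c) <= Num.sqrt x + Num.sqrt c.
Proof.
move=> x0 c0; apply: sqrt_le_of_sq; first by rewrite addr_ge0// sqrtr_ge0.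
rewrite /inflate sqrtrM// sqrrD !sqr_sqrtr//.
have := sqrtr_ge0 x; have := sqrtr_ge0 c; nra.
Qed.

Lemma shrink_to_half_conservative t c p : 0 <= t <= 1 -> 0 <= c -> 0 <= p <= 1 ->
  p - Num.sqrt (p * c) <= t -> (1 - p) - Num.sqrt ((1 - p) * c) <= 1 - t ->
  (shrink_to_half t c < 2^-1 -> p <= shrink_to_half t c) /\
  (2^-1 < shrink_to_half t c -> shrink_to_half t c <= p).
Proof.
move=> /andP[t0 t1] c0 /andP[p0 p1] h1 h2.
have i1 := inflate_ge t0 c0 p0 h1.
have i2 : 1 - p <= inflate (1 - t) c by apply: inflate_ge => //; lra.
rewrite /shrink_to_half; case: (leP t 2^-1) => th; split.
- by rewrite gt_min ltxx/= => h; rewrite (min_idPr (ltW h)).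
- by rewrite lt_min ltxx.
- by rewrite gt_max ltxx.
- by rewrite lt_max ltxx/= => h; rewrite (max_idPr (ltW h)); move: i2; rewrite /inflate; lra.
Qed.

Lemma shrink_to_half_gt0_lt1 t c : 0 <= t <= 1 -> 0 < c ->
  0 < shrink_to_half t c < 1.
Proof.
move=> /andP[t0 t1] c0; rewrite /shrink_to_half /inflate.
have s1 := sqrtr_ge0 (t * c); have s2 := sqrtr_ge0 ((1 - t) * c).
case: (leP t 2^-1) => th.
  by rewrite lt_min gt_min; apply/andP; split; [apply/andP; split; lra | apply/orP; left; lra].
by rewrite lt_max gt_max; apply/andP; split; [apply/orP; left; lra | apply/andP; split; lra].
Qed.

Lemma folded_sym t : folded (1 - t) = folded t.
Proof. by rewrite /folded minC (_ : 1 - (1 - t) = t)//; ring. Qed.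

Lemma sqrt_folded_shrink t c : 0 <= t <= 1 -> 0 <= c ->
  Num.sqrt (folded (shrink_to_half t c)) <= Num.sqrt (folded t) + Num.sqrt c.
Proof.
move=> /andP[t0 t1] c0.
suff low u : 0 <= u <= 2^-1 ->
    Num.sqrt (folded (Num.min 2^-1 (inflate u c))) <= Num.sqrt (folded u) + Num.sqrt c.
  rewrite /shrink_to_half; case: (leP t 2^-1) => th; first by apply: low; rewrite t0.
  rewrite -(folded_sym t) -folded_sym.
  rewrite (_ : 1 - Num.max _ _ = Num.min 2^-1 (inflate (1 - t) c)).
    by apply: low; apply/andP; split; lra.
  rewrite /inflate minEle maxEle.
  case: (leP 2^-1 (1 - t + Num.sqrt ((1 - t) * c) + c)) => h1;
  case: (leP 2^-1 (t - Num.sqrt ((1 - t) * c) - c)) => h2; lra.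
move=> /andP[u0 u1]; rewrite [folded u]min_l; last lra.
apply: le_trans (sqrt_inflate u0 c0); apply: ler_wsqrtr.
by rewrite /folded !ge_min lexx ?orbT.
Qed.

Lemma sqrt_folded_dist x y : 0 <= x <= 1 -> 0 <= y <= 1 ->
  Num.sqrt (folded x) <= Num.sqrt (folded y) + Num.sqrt `|x - y|.
Proof.
move=> x01 y01; have /andP[f0 _] := folded01 y01.
apply: sqrt_le_of_sq; first by rewrite addr_ge0// sqrtr_ge0.
rewrite sqrrD !sqr_sqrtr//.
have := mulr_ge0 (sqrtr_ge0 (folded y)) (sqrtr_ge0 `|x - y|).
suff : folded x <= folded y + `|x - y| by lra.
have h1 := ler_norm (x - y); have h2 := ler_norm (y - x); rewrite distrC in h2.
rewrite /folded; case: (leP y (1 - y)) => h; rewrite ge_min; apply/orP; [left|right]; lra.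
Qed.

Lemma dual_loss_le1 lam t : dual_loss lam t <= 1.
Proof. by rewrite /dual_loss ge_min lexx. Qed.

Lemma dual_loss_ge0 lam t : 0 <= lam -> 0 <= dual_loss lam t.
Proof. by move=> l0; rewrite /dual_loss !le_min ler01 l0 sqrtr_ge0. Qed.

(** Truncation by 1 and lam does not increase distances, and inside the
    truncation the dual loss is sqrt (2 lam) times sqrt (folded t). *)
Lemma dual_loss_dist lam x y e : 0 <= lam -> 0 <= x <= 1 -> 0 <= y <= 1 -> 0 <= e ->
  Num.sqrt (folded x) <= Num.sqrt (folded y) + e ->
  dual_loss lam x - dual_loss lam y <= Num.sqrt (2 * lam) * e.
Proof.
move=> l0 x01 y01 e0 h; rewrite /dual_loss.
have l20 : 0 <= 2 * lam by lra.
rewrite !(sqrtrM _ l20); have k0 := sqrtr_ge0 (2 * lam).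
have h2 := ler_wpM2l k0 h; rewrite mulrDr in h2; move: h2.
have ke := mulr_ge0 k0 e0.
move: (_ * e) ke (_ * Num.sqrt (folded x)) (_ * Num.sqrt (folded y)) => u u0 X Y XY.
rewrite lerBlDl !minEle; case: (leP lam X) => ?; case: (leP lam Y) => ?.
- case: (leP 1 lam) => ?; lra.
- case: (leP 1 lam) => ?; case: (leP 1 Y) => ?; lra.
- case: (leP 1 X) => ?; case: (leP 1 lam) => ?; lra.
- case: (leP 1 X) => ?; case: (leP 1 Y) => ?; lra.
Qed.

End one_bin.

(** * Estimates in one bin *)

Section one_bin_estimates.
Context (R : realType).
Variables (N L p rho kA kB : R).
Hypotheses (N0 : 0 < N) (L0 : 0 < L) (p0 : 0 <= p) (rho01 : 0 <= rho <= 1).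
Hypotheses (kA0 : 0 <= kA) (kB0 : 0 <= kB) (kBA : kB <= kA).
Let ph := kA / N.
Let pih := if ph == 0 then 2^-1 else kB / (N * ph).
Let c := 2 * L / (N * ph).
Let pit := shrink_to_half pih c.

Let Nph : N * ph = kA. Proof. by rewrite /ph; field; rewrite gt_eqF. Qed.

Let ph0 : (ph == 0) = (kA == 0).
Proof. by rewrite /ph mulf_eq0 invr_eq0 [N == 0]gt_eqF// orbF. Qed.

Let rho0 : 0 <= rho. Proof. by case/andP: rho01. Qed.
Let rho1 : 0 <= 1 - rho. Proof. by rewrite subr_ge0; case/andP: rho01. Qed.

Lemma empirical_rate01 : 0 <= pih <= 1.
Proof.
rewrite /pih; case: ifPn => [_|]; first by apply/andP; split; lra.
rewrite ph0 => kn; have kp : 0 < kA by rewrite lt_neqAle eq_sym kn.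
by rewrite Nph divr_ge0//= ler_pdivrMr// mul1r.
Qed.

Let c0 : 0 <= c.
Proof. by rewrite /c Nph divr_ge0// mulr_ge0// ltW. Qed.

(** The rate stays away from the end points, where selection functions lack
    supporting lines; an empty bin is given the rate 1/2. *)
Lemma shrunk_rate_gt0_lt1 : 0 < pit < 1.
Proof.
rewrite /pit; have [kE|kn] := eqVneq kA 0.
  rewrite /c Nph kE invr0 mulr0 /pih ph0 kE eqxx /shrink_to_half lexx /inflate.
  by rewrite mulr0 sqrtr0 !addr0 minxx; apply/andP; split; lra.
apply: shrink_to_half_gt0_lt1; first exact: empirical_rate01.
have kp : 0 < kA by rewrite lt_neqAle eq_sym kn.
by rewrite /c Nph divr_gt0// mulr_gt0.
Qed.

(** The deviation bound already gives p <= inflate ph (2 * L / N); the constant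
    3 in place of 2 leaves the surplus L / N. *)
Lemma inflated_mass_ge :
  ~ (kA < p * N - Num.sqrt (2 * L * (p * N))) ->
  p + L / N <= inflate ph (3 * L / N).
Proof.
move/negP; rewrite -leNgt => h.
have r0 : 0 < L / N by rewrite divr_gt0.
have php : 0 <= ph by rewrite /ph divr_ge0// ltW.
have h1 : p <= inflate ph (2 * (L / N)).
  apply: inflate_ge => //; first by rewrite mulr_ge0// ltW.
  rewrite /ph ler_pdivlMr// mulrBl.
  have -> : Num.sqrt (p * (2 * (L / N))) * N = Num.sqrt (2 * L * (p * N)).
    rewrite -{2}(ger0_norm (ltW N0)) -sqrtr_sqr -sqrtrM.
      by congr Num.sqrt; field; rewrite gt_eqF.
    by rewrite mulr_ge0// mulr_ge0// ltW.
  by [].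
have h2 : Num.sqrt (ph * (2 * (L / N))) <= Num.sqrt (ph * (3 * L / N)).
  by apply: ler_wsqrtr; apply: ler_wpM2l => //; lra.
by move: h1; rewrite /inflate; lra.
Qed.

Hypothesis not_low1 : ~ (kB < rho * kA - Num.sqrt (2 * L * (rho * kA))).
Hypothesis not_low0 :
  ~ (kA - kB < (1 - rho) * kA - Num.sqrt (2 * L * ((1 - rho) * kA))).

Let rescale (x : R) : 0 < kA ->
  Num.sqrt (x * c) * kA = Num.sqrt (2 * L * (x * kA)) \/ x < 0.
Proof.
move=> kp; have [x0|x0] := leP 0 x; [left|by right].
rewrite -[X in _ * X](ger0_norm kA0) -sqrtr_sqr -sqrtrM; last exact: mulr_ge0.
by congr Num.sqrt; rewrite /c Nph; field; rewrite gt_eqF.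
Qed.

Lemma shrunk_rate_conservative :
  (pit < 2^-1 -> rho <= pit) /\ (2^-1 < pit -> pit <= rho).
Proof.
have [kE|kn] := eqVneq kA 0.
  rewrite /pit /c Nph kE invr0 mulr0 /pih ph0 kE eqxx /shrink_to_half lexx.
  by rewrite /inflate mulr0 sqrtr0 !addr0 minxx ltxx.
have kp : 0 < kA by rewrite lt_neqAle eq_sym kn.
have pihE : pih = kB / kA by rewrite /pih ph0 (negbTE kn) Nph.
apply: shrink_to_half_conservative => //; first exact: empirical_rate01.
- move/negP: not_low1; rewrite -leNgt pihE ler_pdivlMr// mulrBl.
  by have [->|] := rescale rho kp => //; rewrite ltNge rho0.
- move/negP: not_low0; rewrite -leNgt pihE.
  rewrite (_ : 1 - kB / kA = (kA - kB) / kA); last by field.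
  rewrite ler_pdivlMr// (mulrBl kA (1 - rho) (Num.sqrt _)).
  by have [->|] := rescale (1 - rho) kp => //; rewrite ltNge rho1.
Qed.

Hypothesis not_high :
  if rho <= 2^-1 then kB <= (Num.sqrt (rho * kA) + Num.sqrt L) ^+ 2
  else kA - kB <= (Num.sqrt ((1 - rho) * kA) + Num.sqrt L) ^+ 2.

(** Both the sampling error and the shrinking are translations of size O(sqrt (L
    / kA)) in square-root scale. The upper tail is only needed for the rarer
    label. *)
Lemma sqrt_folded_shrunk_rate : 0 < kA ->
  Num.sqrt (folded pit) <= Num.sqrt (folded rho) + 3 * Num.sqrt (L / kA).
Proof.
move=> kp; have kn : kA != 0 by rewrite gt_eqF.
have pihE : pih = kB / kA by rewrite /pih ph0 (negbTE kn) Nph.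
have Lk0 : 0 <= L / kA by rewrite divr_ge0// ltW.
have key (x y : R) : 0 <= y -> x <= (Num.sqrt (y * kA) + Num.sqrt L) ^+ 2 ->
    Num.sqrt (x / kA) <= Num.sqrt y + Num.sqrt (L / kA).
  move=> y0 h; apply: sqrt_le_of_sq; first by rewrite addr_ge0// sqrtr_ge0.
  rewrite ler_pdivrMr//; apply: le_trans h _.
  rewrite -[X in _ <= _ * X](sqr_sqrtr kA0) -exprMn mulrDl -!sqrtrM//.
  by rewrite divfK.
have h1 : Num.sqrt (folded pih) <= Num.sqrt (folded rho) + Num.sqrt (L / kA).
  have [h|h] := leP rho 2^-1; move: not_high; rewrite ?h => nh.
  - rewrite [folded rho]min_l; last lra.
    apply: le_trans (key _ _ rho0 nh); apply: ler_wsqrtr.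
    by rewrite /folded pihE ge_min lexx.
  - rewrite leNgt h/= in nh; rewrite [folded rho]min_r; last lra.
    apply: le_trans (key _ _ rho1 nh); apply: ler_wsqrtr.
    rewrite /folded pihE ge_min; apply/orP; right.
    by rewrite mulrBl divff.
have h2 := sqrt_folded_shrink empirical_rate01 c0.
have h3 : Num.sqrt c <= 2 * Num.sqrt (L / kA).
  apply: sqrt_le_of_sq; first by rewrite mulr_ge0// sqrtr_ge0.
  rewrite exprMn sqr_sqrtr// /c Nph -mulrA; lra.
by apply: le_trans h2 _; lra.
Qed.

(** The cost, in units of max (1, sqrt (2 lam)), of using the shrunk rate in
    place of the true one; truncated at 1 because the dual loss never exceeds 1. *)
Definition bin_price : R := if kA == 0 then 1 else Num.min 1 (3 * Num.sqrt (L / kA)).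

Lemma bin_price_ge0 : 0 <= bin_price.
Proof.
by rewrite /bin_price; case: ifP => // _; rewrite le_min ler01 mulr_ge0// sqrtr_ge0.
Qed.

(** The price is stated with the empirical count; a bin whose empirical mass is
    far below its true mass has mass O(L / N), and then the truncation at 1
    suffices. *)
Lemma bin_price_le : ~ (kA < p * N - Num.sqrt (2 * L * (p * N))) ->
  p * bin_price <= 6 * Num.sqrt (p * (L / N)).
Proof.
move=> h; have r0 : 0 < L / N by rewrite divr_gt0.
rewrite sqrtrM//; set r := Num.sqrt (L / N).
have rr : r ^+ 2 = L / N by rewrite sqr_sqrtr// ltW.
have rp : 0 < r by rewrite sqrtr_gt0.
have pp : Num.sqrt p ^+ 2 = p by rewrite sqr_sqrtr.
have sp0 := sqrtr_ge0 p; set s := Num.sqrt p in pp sp0 *.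
(* in square-root scale the lower deviation bound reads s <= y + 2 r *)
pose y := Num.sqrt ph.
have php : 0 <= ph by rewrite /ph divr_ge0// ltW.
have y0 : 0 <= y := sqrtr_ge0 _.
have yy : y ^+ 2 = ph by rewrite sqr_sqrtr.
have sy : s <= y + 2 * r.
  move/negP: h; rewrite -leNgt.
  rewrite (_ : 2 * L * (p * N) = 2 * (p * (L / N)) * N ^+ 2); last first.
    by field; rewrite gt_eqF.
  rewrite -pp -rr sqrtrM; last by rewrite mulr_ge0// mulr_ge0// sqr_ge0.
  rewrite sqrtr_sqr (ger0_norm (ltW N0)) -mulrBl -ler_pdivlMr//.
  rewrite -/ph -yy => h.
  have : Num.sqrt (2 * (s ^+ 2 * r ^+ 2)) <= 2 * (s * r).
    by apply: sqrt_le_of_sq; nra.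
  by move=> h'; rewrite leNgt; apply/negP => ?; nra.
have w1 : bin_price <= 1.
  by rewrite /bin_price; case: ifP => // _; rewrite ge_min lexx.
have w0 := bin_price_ge0.
rewrite -pp; have [yr|ry] := leP y (2 * r).
  by apply: (@le_trans _ _ (s ^+ 2)); [have := sqr_ge0 s; nra | nra].
have kn : kA != 0.
  apply: contraTN ry => /eqP kE.
  by rewrite -leNgt /y /ph kE mul0r sqrtr0 mulr_ge0// ltW.
have e : Num.sqrt (L / kA) = r / y.
  rewrite /r /y -sqrtrV// -sqrtrM; last exact: ltW.
  by congr Num.sqrt; rewrite /ph; field; rewrite kn gt_eqF.
have yp : 0 < y by lra.
have w2 : bin_price <= 3 * (r / y).
  by rewrite /bin_price (negbTE kn) e ge_min lexx orbT.
have ry0 : 0 < r / y by rewrite divr_gt0.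
apply: (@le_trans _ _ (s ^+ 2 * (3 * (r / y)))); first by rewrite ler_wpM2l// sqr_ge0.
have h5 : s * (r / y) <= 2 * r.
  by rewrite mulrA ler_pdivrMr//; nra.
by rewrite expr2; nra.
Qed.

Lemma dual_loss_shrunk_rate lam y K : 0 <= lam -> 0 <= y <= 1 -> 1 <= K ->
  Num.sqrt (2 * lam) <= K ->
  dual_loss lam pit - dual_loss lam y <=
    bin_price * K + Num.sqrt (2 * lam) * Num.sqrt `|rho - y|.
Proof.
move=> l0 y01 K1 lK.
have t0 : 0 <= Num.sqrt (2 * lam) * Num.sqrt `|rho - y|.
  by rewrite mulr_ge0// sqrtr_ge0.
have trivial : bin_price = 1 -> dual_loss lam pit - dual_loss lam y <=
    bin_price * K + Num.sqrt (2 * lam) * Num.sqrt `|rho - y|.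
  by move=> ->; have := dual_loss_le1 lam pit; have := dual_loss_ge0 y l0; lra.
have [kE|kn] := eqVneq kA 0.
  by apply: trivial; rewrite /bin_price kE eqxx.
have kp : 0 < kA by rewrite lt_neqAle eq_sym kn.
have [h|h] := leP 1 (3 * Num.sqrt (L / kA)).
  by apply: trivial; rewrite /bin_price (negbTE kn) (min_idPl h).
have -> : bin_price = 3 * Num.sqrt (L / kA).
  by rewrite /bin_price (negbTE kn) (min_idPr (ltW h)).
have s0 := sqrtr_ge0 (L / kA).
apply: (@le_trans _ _ (Num.sqrt (2 * lam) * (Num.sqrt `|rho - y| + 3 * Num.sqrt (L / kA)))).
  apply: dual_loss_dist => //.
  - by have /andP[? ?] := shrunk_rate_gt0_lt1; apply/andP; split; exact: ltW.
  - have := sqrt_folded_dist rho01 y01; have := sqrt_folded_shrunk_rate kp; lra.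
by rewrite mulrDr; nra.
Qed.

End one_bin_estimates.

Lemma sum_sqrt_le (R : realType) M (p : 'I_M -> R) : (forall m, 0 <= p m) ->
  \sum_m p m <= 1 -> \sum_m Num.sqrt (p m) <= Num.sqrt M%:R.
Proof.
move=> p0 p1; case: M p p0 p1 => [|M] p p0 p1; first by rewrite big_ord0 sqrtr_ge0.
set t : R := Num.sqrt M.+1%:R.
have t0 : 0 < t by rewrite sqrtr_gt0 ltr0n.
have tt : t ^+ 2 = M.+1%:R by rewrite sqr_sqrtr// ler0n.
(* AM-GM with the weight that is exact when all p m equal 1/M *)
apply: (@le_trans _ _ (\sum_m (p m * t / 2 + (t^-1 / 2)))).
  apply: ler_sum => m _; rewrite -[p m in leRHS](sqr_sqrtr (p0 m)).
  move: (Num.sqrt (p m)) => s.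
  have e : s ^+ 2 * t / 2 + t^-1 / 2 - s = (s * t - 1) ^+ 2 / (2 * t).
    by field; rewrite gt_eqF.
  by rewrite -subr_ge0 e divr_ge0// ?sqr_ge0// mulr_ge0// ltW.
rewrite big_split/= sumr_const card_ord -[_ *+ M.+1]mulr_natr -!mulr_suml -tt.
rewrite (_ : t^-1 / 2 * t ^+ 2 = t / 2); last by field; rewrite gt_eqF.
nra.
Qed.

(** * The partition into bins *)

Section construction_facts.
Context (R : realType) (d n : nat) (alpha : R) (A : regression_algorithm R d).
Local Notation X := (covariate R d).
Local Notation Z := (observation R d).
Local Notation M := (nbins R n).
Local Notation N := (uphalf n).
Implicit Types (D : n.-tuple Z) (x : X) (m : 'I_M).

Lemma fit_half01 D x : 0 <= fit_half A D x <= 1.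
Proof. exact: fit_ge0_le1. Qed.

Lemma bin_bounds D x m : bin A D m x ->
  m%:R / M%:R <= fit_half A D x /\
  (fit_half A D x < m.+1%:R / M%:R \/ m.+1 = M).
Proof.
by rewrite /bin/=; case: eqVneq => [e|_] /andP[h1 h2]; split => //; [right|left].
Qed.

Lemma bin_exists D x : (0 < M)%N -> exists m, bin A D m x.
Proof.
move=> M0; have /andP[v0 v1] := fit_half01 D x.
have M0' : 0 < M%:R :> R by rewrite ltr0n.
pose k := Num.truncn (fit_half A D x * M%:R).
have kM : k%:R <= fit_half A D x * M%:R.
  by rewrite truncn_le// mulr_ge0// ltW.
have Mk : fit_half A D x * M%:R < k.+1%:R by rewrite truncnS_gt.
have [kl|kl] := ltnP k M.-1.
  have km : (k < M)%N by rewrite (leq_trans kl)// leq_pred.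
  exists (Ordinal km); rewrite /bin/= ifF; last first.
    by apply/negbTE; rewrite neq_ltn -(prednK M0) !ltnS kl.
  by rewrite ler_pdivrMr// kM/= ltr_pdivlMr.
have ml : (M.-1 < M)%N by rewrite prednK.
exists (Ordinal ml); rewrite /bin/= prednK// eqxx v1 andbT ler_pdivrMr//.
by apply: le_trans kM; rewrite ler_nat.
Qed.

Lemma bin_lt D x m m' : bin A D m x -> bin A D m' x -> ~ (m < m')%N.
Proof.
move=> /bin_bounds[_ h1] /bin_bounds[h2 _] mm'.
case: h1 => [h1|mM].
  have := le_lt_trans h2 h1.
  by rewrite ltNge ler_wpM2r ?invr_ge0 ?ler0n// ler_nat.
have := leq_trans (ltn_ord m') (eq_leq (esym mM)).
by rewrite ltnS leqNgt mm'.
Qed.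

Lemma bin_uniq D x m m' : bin A D m x -> bin A D m' x -> m = m'.
Proof.
move=> h h'; apply/val_inj; case: (ltngtP m m') => //= mm'.
- by case: (bin_lt h h' mm').
- by case: (bin_lt h' h mm').
Qed.

Lemma sum_bin D x m (F : 'I_M -> R) : bin A D m x ->
  \sum_m' \1_(bin A D m') x * F m' = F m.
Proof.
move=> h; rewrite (bigD1 m)//= indicE mem_set// mul1r big1 ?addr0// => m' mm'.
rewrite indicE memNset ?mul0r// => h'.
by move: mm'; rewrite (bin_uniq h' h) eqxx.
Qed.

Definition bin_count D m : R := \sum_(i < n | (n./2 <= i)%N) \1_(bin A D m) (tnth D i).1.

Definition bin_ones D m : R :=
  \sum_(i < n | (n./2 <= i)%N) \1_(bin A D m `*` [set true]) (tnth D i).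

Definition log_term : R := ln (4 * M%:R * N%:R / alpha).

Lemma phatE D m : phat A D m = bin_count D m / N%:R.
Proof. by []. Qed.

Lemma ptildeE D m : ptilde alpha A D m =
  inflate (bin_count D m / N%:R) (3 * log_term / N%:R).
Proof. by []. Qed.

Lemma pitildeE D m : pitilde alpha A D m =
  shrink_to_half
    (if bin_count D m / N%:R == 0 then 2^-1
     else bin_ones D m / (N%:R * (bin_count D m / N%:R)))
    (2 * log_term / (N%:R * (bin_count D m / N%:R))).
Proof. by []. Qed.

Lemma bin_ones_ge0 D m : 0 <= bin_ones D m.
Proof. by apply: sumr_ge0. Qed.

Lemma bin_ones_le D m : bin_ones D m <= bin_count D m.
Proof.
apply: ler_sum => i _; rewrite !indicE ler_nat.
case: (boolP (_ \in bin A D m `*` _)) => // /set_mem[/= h _].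
by rewrite mem_set.
Qed.

Lemma bin_count_ge0 D m : 0 <= bin_count D m.
Proof. by apply: sumr_ge0. Qed.

Hypothesis M0 : (0 < M)%N.

Lemma sum_bin_count D : \sum_m bin_count D m = N%:R.
Proof.
rewrite exchange_big/= (eq_bigr (fun=> 1)) => [|i _]; last first.
  have [m h] := bin_exists D (tnth D i).1 M0.
  rewrite -[RHS](@sum_bin D (tnth D i).1 m (fun=> 1))//.
  by apply: eq_bigr => m' _; rewrite mulr1.
have e : (n./2 + N)%N = n by rewrite uphalf_half addnCA addnn odd_double_half.
move: (uphalf n) e => k e; rewrite -(@big_mkord _ 0 +%R n (fun i => (n./2 <= i)%N) (fun=> 1)).
move: (n./2) e => h <-; rewrite (@big_cat_nat _ _ _ h)//= ?leq_addr//.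
rewrite big_nat_cond big_pred0 ?add0r => [|i]; last by case: ltngtP => //; rewrite ?andbF.
rewrite big_nat_cond (eq_bigl (fun i => (h <= i < h + k)%N)); last first.
  by move=> i; rewrite andbC; case: (leqP h i).
by rewrite -big_nat sumr_const_nat addKn.
Qed.

Hypothesis N0 : (0 < N)%N.

Lemma sum_phat D : \sum_m phat A D m = 1.
Proof.
rewrite (eq_bigr (fun m => bin_count D m / N%:R))// -mulr_suml sum_bin_count.
by rewrite divff// pnatr_eq0 -lt0n.
Qed.

End construction_facts.

(** * Measurability of the construction *)

Section construction_measurability.
Context (R : realType) (d n : nat) (alpha : R) (A : regression_algorithm R d).
Local Notation X := (covariate R d).
Local Notation Z := (observation R d).
Local Notation M := (nbins R n).
Local Notation N := (uphalf n).
Context d' (W : measurableType d').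
Variables (fD : W -> n.-tuple Z) (fx : W -> X).
Hypotheses (mD : measurable_fun setT fD) (mx : measurable_fun setT fx).
Implicit Types (m : 'I_M).

(** Measurability is proved jointly in the data and the point, through arbitrary
    measurable maps into both, since it is applied on several product spaces. *)
Lemma measurable_fit_half :
  measurable_fun setT (fun w => fit_half A (fD w) (fx w)).
Proof.
pose prefix (D : n.-tuple Z) : n./2.-tuple Z :=
  [tuple tnth D (widen_ord (half_le n) i) | i < n./2].
have mp : measurable_fun setT prefix.
  apply/measurable_fun_tnthP => i.
  rewrite (_ : _ \o _ = fun D => tnth D (widen_ord (half_le n) i)).
    exact: measurable_tnth.
  by apply/funext => D /=; rewrite tnth_mktuple.
exact: (measurableT_comp (@fit_measurable R d A n./2)
  (measurable_fun_pair (measurableT_comp mp mD) mx)).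
Qed.

Lemma measurable_bin_indic m :
  measurable_fun setT (fun w => \1_(bin A (fD w) m) (fx w) : R).
Proof.
rewrite (_ : (fun w => _) = fun w => (if m.+1 == M
    then (m%:R / M%:R <= fit_half A (fD w) (fx w)) && (fit_half A (fD w) (fx w) <= 1)
    else (m%:R / M%:R <= fit_half A (fD w) (fx w)) &&
         (fit_half A (fD w) (fx w) < m.+1%:R / M%:R))%:R); last first.
  apply/funext => w; rewrite indicE; congr (nat_of_bool _)%:R.
  apply/idP/idP => [/set_mem|h]; first by rewrite /bin/=; case: (_ == M).
  by apply/mem_set; move: h; rewrite /bin/=; case: (_ == M).
have mf := measurable_fit_half.
by case: (_ == M); mfun.
Qed.

End construction_measurability.

Section construction_measurability2.
Context (R : realType) (d n : nat) (alpha : R) (A : regression_algorithm R d).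
Local Notation X := (covariate R d).
Local Notation Z := (observation R d).
Local Notation M := (nbins R n).
Local Notation N := (uphalf n).
Implicit Types (m : 'I_M).

Lemma measurable_bin (D : n.-tuple Z) m : measurable (bin A D m).
Proof.
have h := @measurable_bin_indic R d n A _ X (fun=> D) id
  (measurable_cst _) (@measurable_id _ X setT) m.
rewrite -[X in measurable X]setTI.
rewrite (_ : bin A D m = (fun x => 0 < \1_(bin A D m) x :> R) @^-1` [set true]).
  by apply: measurable_fun_ltr.
apply/seteqP; split => x /=; rewrite indicE ltr0n lt0b; first exact: mem_set.
exact: set_mem.
Qed.


Lemma measurable_bin_count m :
  measurable_fun [set: n.-tuple Z] (fun D => bin_count A D m).
Proof.
rewrite /bin_count; under eq_fun do rewrite big_mkcond/=.
apply: measurable_sum => i; case: (n./2 <= i)%N; last exact: measurable_cst.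
apply: (@measurable_bin_indic R d n A _ _ id (fun D => (tnth D i).1)) => //.
by apply: (measurableT_comp measurable_fst); exact: measurable_tnth.
Qed.

Lemma measurable_bin_ones m :
  measurable_fun [set: n.-tuple Z] (fun D => bin_ones A D m).
Proof.
rewrite /bin_ones; under eq_fun do rewrite big_mkcond/=.
apply: measurable_sum => i; case: (n./2 <= i)%N; last exact: measurable_cst.
rewrite (_ : (fun D => _) =
    (fun D : n.-tuple Z => \1_(bin A D m) (tnth D i).1 * (tnth D i).2%:R)); last first.
  apply/funext => D; rewrite !indicE -natrM mulnb; congr (nat_of_bool _)%:R.
  apply/idP/idP => [/set_mem[/= h ->]|/andP[/set_mem h e]].
    by rewrite andbT mem_set.
  by apply/mem_set; split.
apply: measurable_funM.
  apply: (@measurable_bin_indic R d n A _ _ id (fun D => (tnth D i).1)) => //.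
  by apply: (measurableT_comp measurable_fst); exact: measurable_tnth.
apply: measurable_fun_nat.
by apply: (measurableT_comp measurable_snd); exact: measurable_tnth.
Qed.

Lemma measurable_pitilde m :
  measurable_fun [set: n.-tuple Z] (fun D => pitilde alpha A D m).
Proof.
under eq_fun do rewrite pitildeE /shrink_to_half /inflate.
by have mc := measurable_bin_count m; have mo := measurable_bin_ones m; mfun.
Qed.

Variable a : n.-tuple Z -> 'I_M -> R.
Hypothesis ma : forall m, measurable_fun [set: n.-tuple Z] (fun D => a D m).

(** The indicators single out the selection function of the bin of x. *)
Definition select D (x : X) (s : R) : R :=
  \sum_m \1_(bin A D m) x * fsel (pitilde alpha A D m) (a D m) s.

Definition select_length D (x : X) : R :=
  \sum_m \1_(bin A D m) x * ell (pitilde alpha A D m) (a D m).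

Section joint.
Context d' (W : measurableType d').
Variables (fD : W -> n.-tuple Z) (fx : W -> X) (fs : W -> R).
Hypotheses (mD : measurable_fun setT fD) (mx : measurable_fun setT fx)
  (ms : measurable_fun setT fs).

Lemma measurable_select : measurable_fun setT (fun w => select (fD w) (fx w) (fs w)).
Proof.
apply: measurable_sum => m; apply: measurable_funM; first exact: measurable_bin_indic.
apply: measurable_fsel => //.
- exact: (measurableT_comp (measurable_pitilde m) mD).
- exact: (measurableT_comp (ma m) mD).
Qed.

Lemma measurable_select_length :
  measurable_fun setT (fun w => select_length (fD w) (fx w)).
Proof.
apply: measurable_sum => m; apply: measurable_funM; first exact: measurable_bin_indic.
apply: measurable_ell.
- exact: (measurableT_comp (measurable_pitilde m) mD).
- exact: (measurableT_comp (ma m) mD).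
Qed.

End joint.

End construction_measurability2.

(** * Expectations of bounded functions *)

Section bounded_expectation.
Context d (T : measurableType d) (R : realType) (mu : probability T R).
Implicit Types f g : T -> R.

Definition bounded_measurable f :=
  measurable_fun setT f /\ exists K, forall x, `|f x| <= K.

Lemma bounded_measurable_integrable f :
  bounded_measurable f -> mu.-integrable setT (EFin \o f).
Proof.
move=> [mf [K fK]]; apply: measurable_bounded_integrable => //.
  by apply: le_lt_trans (ltry 1); exact: probability_le1.
exists K; split; first exact: num_real.
by move=> x Kx t _; apply: le_trans (fK t) (ltW Kx).
Qed.

Lemma bounded_measurable01 f : measurable_fun setT f ->
  (forall x, 0 <= f x <= 1) -> bounded_measurable f.
Proof.
by move=> mf f01; split=> //; exists 1 => x; have /andP[? ?] := f01 x; rewrite ger0_norm.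
Qed.

Lemma bounded_measurable_cst (c : R) : bounded_measurable (fun=> c).
Proof. by split => //; exists `|c|. Qed.

Lemma bounded_measurableD f g : bounded_measurable f -> bounded_measurable g ->
  bounded_measurable (fun x => f x + g x).
Proof.
move=> [mf [K fK]] [mg [L gL]]; split; first exact: measurable_funD.
by exists (K + L) => x; rewrite (le_trans (ler_normD _ _))// lerD.
Qed.

Lemma bounded_measurableM f g : bounded_measurable f -> bounded_measurable g ->
  bounded_measurable (fun x => f x * g x).
Proof.
move=> [mf [K fK]] [mg [L gL]]; split; first exact: measurable_funM.
by exists (K * L) => x; rewrite normrM ler_pM.
Qed.

Lemma bounded_measurable_norm f : bounded_measurable f ->
  bounded_measurable (fun x => `|f x|).
Proof.
move=> [mf [K fK]]; split; first exact: measurableT_comp.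
by exists K => x; rewrite normr_id.
Qed.

Lemma bounded_measurable_indic (B : set T) : measurable B ->
  bounded_measurable (\1_B : T -> R).
Proof.
move=> mB; apply: bounded_measurable01 => [|x]; first exact: measurable_indic.
by rewrite indicE; case: (_ \in _); rewrite ?lexx ler01.
Qed.

Lemma bounded_measurable_sum (I : Type) (s : seq I) (F : I -> T -> R) :
  (forall i, bounded_measurable (F i)) ->
  bounded_measurable (fun x => \sum_(i <- s) F i x).
Proof.
move=> mF; elim: s => [|i s IH].
  by under eq_fun do rewrite big_nil; exact: bounded_measurable_cst.
by under eq_fun do rewrite big_cons; exact: bounded_measurableD.
Qed.

Lemma expect_le f g : bounded_measurable f -> bounded_measurable g ->
  (forall x, f x <= g x) -> \int[mu]_x f x <= \int[mu]_x g x.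
Proof.
by move=> bf bg fg; apply: le_Rintegral => //; exact: bounded_measurable_integrable.
Qed.

Lemma expectD f g : bounded_measurable f -> bounded_measurable g ->
  \int[mu]_x (f x + g x) = \int[mu]_x f x + \int[mu]_x g x.
Proof.
by move=> bf bg; apply: RintegralD => //; exact: bounded_measurable_integrable.
Qed.

Lemma expectZ (c : R) f : bounded_measurable f ->
  \int[mu]_x (c * f x) = c * \int[mu]_x f x.
Proof. by move=> bf; apply: RintegralZl => //; exact: bounded_measurable_integrable. Qed.

Lemma expect_cst (c : R) : \int[mu]_x c = c.
Proof. by rewrite Rintegral_cst//= probability_setT mulr1. Qed.

Lemma expect_indic (B : set T) : measurable B -> \int[mu]_x \1_B x = fine (mu B).
Proof. by move=> mB; rewrite /Rintegral integral_indic// setIT. Qed.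

Lemma expect_sum (I : Type) (s : seq I) (F : I -> T -> R) :
  (forall i, bounded_measurable (F i)) ->
  \int[mu]_x (\sum_(i <- s) F i x) = \sum_(i <- s) \int[mu]_x F i x.
Proof.
move=> mF; elim: s => [|i s IH].
  rewrite big_nil -[RHS](expect_cst 0); apply: eq_Rintegral => x _.
  by rewrite big_nil.
rewrite big_cons -IH -expectD//; last exact: bounded_measurable_sum.
by apply: eq_Rintegral => x _; rewrite big_cons.
Qed.

Lemma expect_norm f : bounded_measurable f ->
  `|\int[mu]_x f x| <= \int[mu]_x `|f x|.
Proof. by move=> bf; apply: le_normr_Rintegral => //; exact: bounded_measurable_integrable. Qed.

Lemma expectE f : bounded_measurable f ->
  (\int[mu]_x (f x)%:E = (\int[mu]_x f x)%:E)%E.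
Proof.
move=> bf; rewrite /Rintegral fineK//; apply: integrable_fin_num => //.
exact: bounded_measurable_integrable.
Qed.

Lemma expect01 f : measurable_fun setT f -> (forall x, 0 <= f x <= 1) ->
  0 <= \int[mu]_x f x <= 1.
Proof.
move=> mf f01; have bf := bounded_measurable01 mf f01.
apply/andP; split; first by apply: Rintegral_ge0 => x _; have /andP[] := f01 x.
rewrite -[leRHS](expect_cst 1); apply: expect_le => //.
  exact: bounded_measurable_cst.
by move=> x; have /andP[] := f01 x.
Qed.

End bounded_expectation.

(** * A finite partition of the population *)

Section bounded_measurable_sub.
Context d (T : measurableType d) (R : realType).

Lemma bounded_measurableB (f g : T -> R) :
  bounded_measurable f -> bounded_measurable g ->
  bounded_measurable (fun x => f x - g x).
Proof.
move=> bf bg; rewrite (_ : (fun x => _) = fun x => f x + (-1) * g x).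
  by apply: bounded_measurableD => //; apply: bounded_measurableM => //; exact: bounded_measurable_cst.
by apply/funext => x; rewrite mulN1r.
Qed.

End bounded_measurable_sub.

Ltac bmfun :=
  repeat first
  [ assumption
  | exact: bounded_measurable_cst
  | apply: bounded_measurable_sum => ?
  | apply: bounded_measurable_indic; by []
  | apply: bounded_measurable_norm
  | apply: bounded_measurableB
  | apply: bounded_measurableD
  | apply: bounded_measurableM ].

Section population.
Context d (X : measurableType d) (R : realType) (mu : probability X R).
Variables (eta : X -> R) (M : nat) (B : 'I_M -> set X).
Hypotheses (meta : measurable_fun setT eta) (eta01 : forall x, 0 <= eta x <= 1).
Hypotheses (mB : forall m, measurable (B m)).
Hypothesis partB : forall x, exists2 m, B m x &
  forall F : 'I_M -> R, \sum_m' \1_(B m') x * F m' = F m.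

Definition mass m : R := \int[mu]_x \1_(B m) x.
Definition ones m : R := \int[mu]_x (\1_(B m) x * eta x).
(** The regression function averaged over a cell; for a cell of mass zero the
    value is 0 / 0 = 0, still a rate in the unit interval. *)
Definition rate m : R := ones m / mass m.

Let beta : bounded_measurable eta.
Proof. exact: bounded_measurable01. Qed.

Let bB m : bounded_measurable (\1_(B m) : X -> R).
Proof. exact: bounded_measurable_indic. Qed.

Lemma indic01 (C : set X) x : 0 <= (\1_C x : R) <= 1.
Proof. by rewrite indicE; case: (_ \in _); rewrite ?lexx ler01. Qed.

Lemma mass_ge0 m : 0 <= mass m.
Proof.
by have /andP[] := expect01 mu (measurable_indic (mB m)) (indic01 (B m)).
Qed.

Lemma expect_bins (F : 'I_M -> R) :
  \int[mu]_x (\sum_m \1_(B m) x * F m) = \sum_m mass m * F m.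
Proof.
rewrite expect_sum => [|m]; last by bmfun.
apply: eq_bigr => m _; rewrite mulrC -expectZ; last by bmfun.
by apply: eq_Rintegral => x _; rewrite mulrC.
Qed.

Lemma sum_mass : \sum_m mass m = 1.
Proof.
transitivity (\int[mu]_x (\sum_m \1_(B m) x * (1 : R))).
  by rewrite expect_bins; apply: eq_bigr => m _; rewrite mulr1.
rewrite -[RHS](expect_cst mu 1); apply: eq_Rintegral => x _.
by have [m _ ->] := partB x.
Qed.

Lemma ones_ge0 m : 0 <= ones m.
Proof.
apply: Rintegral_ge0 => x _; have /andP[? _] := indic01 (B m) x.
by have /andP[? _] := eta01 x; rewrite mulr_ge0.
Qed.

Lemma ones_le_mass m : ones m <= mass m.
Proof.
apply: expect_le => //; first by bmfun.
by move=> x; have /andP[? _] := indic01 (B m) x; have /andP[? ?] := eta01 x; rewrite ler_piMr.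
Qed.

Lemma rate_mass m : rate m * mass m = ones m.
Proof.
rewrite /rate; have [m0|m0] := eqVneq (mass m) 0; last by rewrite divfK.
have := ones_ge0 m; have := ones_le_mass m; rewrite m0 mulr0 => ? ?.
by apply/eqP; rewrite eq_le; apply/andP; split.
Qed.

Lemma rate01 m : 0 <= rate m <= 1.
Proof.
rewrite /rate divr_ge0 ?ones_ge0 ?mass_ge0//=.
have [m0|m0] := eqVneq (mass m) 0; first by rewrite m0 invr0 mulr0 ler01.
have mp : 0 < mass m by rewrite lt_neqAle eq_sym m0 mass_ge0.
by rewrite ler_pdivrMr// mul1r ones_le_mass.
Qed.

Lemma expect_bins_linear (F G : 'I_M -> R) :
  \int[mu]_x (\sum_m \1_(B m) x * (F m + G m * eta x)) =
  \sum_m mass m * (F m + G m * rate m).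
Proof.
rewrite expect_sum => [|m]; last by bmfun.
apply: eq_bigr => m _.
transitivity (\int[mu]_x (F m * \1_(B m) x + G m * (\1_(B m) x * eta x))).
  by apply: eq_Rintegral => x _; ring.
rewrite expectD ?expectZ; [|bmfun..].
by rewrite -/(mass m) -/(ones m) -rate_mass; ring.
Qed.

(** Integrate the supporting line of the selection function at t m over each
    cell; being linear it only sees the mean of eta. *)
Lemma coverage_given_bins (t a : 'I_M -> R) :
  (forall m, 0 < t m < 1) -> (forall m, 0 <= a m <= 1) ->
  (forall m, (t m < 2^-1 -> rate m <= t m) /\ (2^-1 < t m -> t m <= rate m)) ->
  \sum_m mass m * (1 - a m) <=
  \int[mu]_x (\sum_m \1_(B m) x * fsel (t m) (a m) (eta x)).
Proof.
move=> t01 a01 tcons.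
have /choice[k kP] : forall m, exists k : R,
    (forall s, 1 - a m - k * (s - t m) <= fsel (t m) (a m) s) /\
    forall p, (t m < 2^-1 -> p <= t m) -> (2^-1 < t m -> t m <= p) ->
      0 <= k * (t m - p) by move=> m; exact: fsel_support.
have bf m : bounded_measurable (fun x => fsel (t m) (a m) (eta x)).
  apply: bounded_measurable01 => [|x]; first by apply: measurable_fsel.
  by apply: fsel01 => //; have /andP[/ltW ? /ltW ?] := t01 m; apply/andP; split.
apply: (@le_trans _ _ (\int[mu]_x (\sum_m \1_(B m) x *
    ((1 - a m + k m * t m) + (- k m) * eta x)))).
  rewrite expect_bins_linear; apply: ler_sum => m _.
  rewrite ler_wpM2l ?mass_ge0//.
  have [c1 c2] := tcons m; have := (kP m).2 _ c1 c2; lra.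
apply: expect_le; [by bmfun|by bmfun|move=> x].
have [m _ partx] := partB x; rewrite !partx.
by have := (kP m).1 (eta x); lra.
Qed.

(** Both f and the mean of eta over a cell are compared with the left end m h of
    the range of f on that cell. A mean deviates from a constant by no more than
    the mean deviation, which doubles the regression error. *)
Lemma expect_rate_gap (f : X -> R) (h : R) : measurable_fun setT f ->
  (forall x, 0 <= f x <= 1) -> 0 <= h -> 
  (forall m x, B m x -> `|f x - m%:R * h| <= h) ->
  \int[mu]_x (\sum_m \1_(B m) x * `|rate m - eta x|) <=
  2 * \int[mu]_x `|f x - eta x| + 2 * h.
Proof.
move=> mf f01 h0 fB.
have bf : bounded_measurable f by exact: bounded_measurable01.
pose c m : R := m%:R * h.
have b1 m : bounded_measurable (fun x => \1_(B m) x * `|c m - eta x|) by bmfun.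
have b2 m : bounded_measurable (fun x => \1_(B m) x * (c m - eta x)) by bmfun.
have centre m : mass m * `|rate m - c m| <= \int[mu]_x (\1_(B m) x * `|c m - eta x|).
  have -> : mass m * `|rate m - c m| = `|\int[mu]_x (\1_(B m) x * (c m - eta x))|.
    rewrite -[in LHS](ger0_norm (mass_ge0 m)) -normrM mulrBr mulrC rate_mass distrC.
    congr `|_|; transitivity (\int[mu]_x (c m * \1_(B m) x - \1_(B m) x * eta x)).
      transitivity (\int[mu]_x (c m * \1_(B m) x + (-1) * (\1_(B m) x * eta x))).
        by rewrite expectD ?expectZ; [rewrite mulN1r mulrC|bmfun..].
      by apply: eq_Rintegral => x _; rewrite mulN1r.
    by apply: eq_Rintegral => x _; ring.
  apply: le_trans (expect_norm mu (b2 m)) _; apply: expect_le.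
  - by bmfun.
  - by bmfun.
  by move=> x; have /andP[i0 _] := indic01 (B m) x; rewrite normrM (ger0_norm i0).
apply: (@le_trans _ _ (\int[mu]_x (\sum_m \1_(B m) x * `|rate m - c m|) +
    \int[mu]_x (\sum_m \1_(B m) x * `|c m - eta x|))).
  rewrite -expectD; [|bmfun..].
  apply: expect_le; [by bmfun|by bmfun|move=> x].
  have [m _ partx] := partB x; rewrite !partx.
  by rewrite (le_trans _ (ler_normD _ _))// addrA subrK.
rewrite expect_bins.
have h1 : \sum_m mass m * `|rate m - c m| <=
    \int[mu]_x (\sum_m \1_(B m) x * `|c m - eta x|).
  by rewrite expect_sum//; apply: ler_sum => m _; exact: centre.
have h2 : \int[mu]_x (\sum_m \1_(B m) x * `|c m - eta x|) <=
    \int[mu]_x `|f x - eta x| + h.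
  rewrite -[h in leRHS](expect_cst mu) -expectD; [|bmfun..].
  apply: expect_le; [by bmfun|by bmfun|move=> x].
  have [m Bm partx] := partB x; rewrite partx.
  have := fB m x Bm; rewrite distrC -/(c m) => fc.
  have := ler_normD (c m - f x) (f x - eta x); rewrite addrA subrK; lra.
lra.
Qed.

(** The mean of a square root is bounded by sqrt z <= (z / th + th) / 2 with a
    free th instead of by concavity. The bound stays linear in the mean gap, so
    it can later be averaged over the first half before th is chosen. *)
Lemma expect_dual_loss_bins (t W : 'I_M -> R) (lam K th : R) : 0 <= lam -> 0 < th ->
  Num.sqrt (2 * lam) <= K ->
  (forall m y, 0 <= y <= 1 -> dual_loss lam (t m) - dual_loss lam y <=
     W m * K + Num.sqrt (2 * lam) * Num.sqrt `|rate m - y|) ->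
  \sum_m mass m * dual_loss lam (t m) <=
  \int[mu]_x dual_loss lam (eta x) + K * (\sum_m mass m * W m) +
  K * ((\int[mu]_x (\sum_m \1_(B m) x * `|rate m - eta x|) / th + th) / 2).
Proof.
move=> l0 th0 lK Wt.
have K0 : 0 <= K by apply: le_trans lK; exact: sqrtr_ge0.
have bdual_loss : bounded_measurable (fun x => dual_loss lam (eta x)).
  apply: bounded_measurable01 => [|x]; first exact: measurable_dual_loss.
  by rewrite dual_loss_ge0// dual_loss_le1.
pose g x : R := \sum_m \1_(B m) x * `|rate m - eta x|.
have bg : bounded_measurable g by bmfun.
pose u x : R := \sum_m \1_(B m) x * W m.
have bu : bounded_measurable u by bmfun.
apply: (@le_trans _ _ (\int[mu]_x (dual_loss lam (eta x) + K * u x +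
    (K / (2 * th) * g x + K * th / 2)))).
  rewrite -expect_bins; apply: expect_le; [by bmfun|by bmfun|move=> x].
  rewrite /u /g; have [m Bm partx] := partB x; rewrite !partx.
  have := Wt m _ (eta01 x); set z := `|_|.
  have z0 : 0 <= z by exact: normr_ge0.
  have : Num.sqrt (2 * lam) * Num.sqrt z <= K / (2 * th) * z + K * th / 2.
    apply: (@le_trans _ _ (K * Num.sqrt z)); first by rewrite ler_wpM2r// sqrtr_ge0.
    have -> : K / (2 * th) * z + K * th / 2 = K * ((z / th + th) / 2).
      by field; rewrite gt_eqF.
    rewrite ler_wpM2l// -{2}(sqr_sqrtr z0); move: (Num.sqrt z) => s.
    rewrite -subr_ge0 (_ : _ - _ = (s - th) ^+ 2 / (2 * th)); last first.
      by field; rewrite gt_eqF.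
    by rewrite divr_ge0// ?sqr_ge0// mulr_ge0// ltW.
  by rewrite [W m * K]mulrC; lra.
rewrite expectD; [|bmfun..].
rewrite expectD; [|bmfun..].
rewrite expectD; [|bmfun..].
rewrite (expect_cst mu (K * th / 2)). rewrite !expectZ// /u expect_bins -/g lerD2l.
rewrite le_eqVlt; apply/orP; left; apply/eqP; field; by rewrite gt_eqF.
Qed.

End population.

(** * Counts in an i.i.d. sample *)

Section iid_integration.
Context d (T : measurableType d) (R : realType) (P : probability T R).
Local Open Scope ereal_scope.

Lemma iid_law_integralS n (f : n.+1.-tuple T -> \bar R) :
  measurable_fun setT f -> (forall t, 0 <= f t) ->
  \int[iid_law P n.+1]_t f t =
  \int[P]_z \int[iid_law P n]_t f (tuple_cons (z, t)).
Proof.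
move=> mf f0; rewrite /= ge0_integral_distribution//.
rewrite (@fubini_tonelli1 _ _ _ _ _ P (iid_law P n) (f \o @tuple_cons _ T n))//.
  by apply: measurableT_comp => //; exact: measurable_tuple_cons.
by move=> x /=; exact: f0.
Qed.

End iid_integration.

Section hits.
Context d (T : measurableType d) (R : realType).

Definition hits n (A : set T) (t : n.-tuple T) : nat :=
  \sum_(i < n) (tnth t i \in A).

Lemma hits_cons n A z (t : n.-tuple T) :
  hits A (tuple_cons (z, t)) = ((z \in A) + hits A t)%N.
Proof.
rewrite /hits big_ord_recl/=; congr (_ + _)%N.
by apply: eq_bigr => i _; rewrite /tuple_cons tnthS.
Qed.

Lemma hits_le n A (t : n.-tuple T) : (hits A t <= n)%N.
Proof.
rewrite /hits -[leqRHS]card_ord -sum1_card leq_sum// => i _.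
by case: (_ \in _).
Qed.

Lemma hitsE n A (t : n.-tuple T) :
  (hits A t)%:R = \sum_(i < n) \1_A (tnth t i) :> R.
Proof. by rewrite /hits natr_sum. Qed.

Lemma measurable_hits n A : measurable A ->
  measurable_fun [set: n.-tuple T] (fun t => (hits A t)%:R : R).
Proof.
move=> mA; under eq_fun do rewrite hitsE.
apply: measurable_sum => i.
apply: measurableT_comp; first exact: measurable_indic.
exact: measurable_tnth.
Qed.

(** A function of two bounded counts is a finite combination of indicators of
    their values. *)
Lemma measurable_hits2 n A B (f : nat -> nat -> R) : measurable A -> measurable B ->
  measurable_fun [set: n.-tuple T] (fun t => f (hits A t) (hits B t)).
Proof.
move=> mA mB; rewrite (_ : (fun t => _) = (fun t => \sum_(i < n.+1) \sum_(j < n.+1)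
   ((hits A t)%:R == i%:R :> R)%:R * ((hits B t)%:R == j%:R :> R)%:R * f i j)).
  apply: measurable_sum => i; apply: measurable_sum => j.
  have mhA := @measurable_hits n A mA; have mhB := @measurable_hits n B mB.
  by mfun.
apply/funext => t.
have hA : (hits A t < n.+1)%N by rewrite ltnS hits_le.
have hB : (hits B t < n.+1)%N by rewrite ltnS hits_le.
rewrite (bigD1 (Ordinal hA))//= (bigD1 (Ordinal hB))//= !eqxx !mul1r.
rewrite big1 ?addr0 => [|j jB]; last first.
  rewrite eqr_nat (_ : (hits B t == j) = false) ?mulr0 ?mul0r//.
  by apply: contraNF jB => /eqP e; apply/eqP/val_inj.
rewrite big1 ?addr0// => i iA; rewrite big1// => j _.
rewrite eqr_nat (_ : (hits A t == i) = false) ?mul0r//.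
by apply: contraNF iA => /eqP e; apply/eqP/val_inj.
Qed.

Lemma measurable_hits_set n A B (q : nat -> nat -> bool) : measurable A -> measurable B ->
  measurable [set t : n.-tuple T | q (hits A t) (hits B t)].
Proof.
move=> mA mB; have := @measurable_hits2 n A B (fun i j => (q i j)%:R) mA mB.
move=> mq; rewrite -[X in measurable X]setTI.
rewrite (_ : [set t | _] = (fun t : n.-tuple T => 0 < (q (hits A t) (hits B t))%:R :> R) @^-1` [set true]).
  by apply: measurable_fun_ltr => //.
by apply/seteqP; split => t /=; rewrite ltr0n lt0b.
Qed.

End hits.

(** * The conditional binomial law of the counts *)

Section hits_law.
Context d (T : measurableType d) (R : realType) (P : probability T R).

(** The binomial probabilities, in the recursive form in which they arise when
    one observation is drawn after another. *)
Fixpoint binom_law (p : R) n k : R :=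
  match n with
  | 0%N => (k == 0%N)%:R
  | n'.+1 => (1 - p) * binom_law p n' k
             + p * (if k is k'.+1 then binom_law p n' k' else 0)
  end.

Lemma binom_law_ge0 (p : R) n k : 0 <= p <= 1 -> 0 <= binom_law p n k.
Proof.
move=> /andP[p0 p1]; elim: n k => [|n IH] k /=; first exact: ler0n.
by case: k => [|k]; rewrite addr_ge0// mulr_ge0// subr_ge0.
Qed.

Lemma binom_law_le1 (p : R) n m : 0 <= p <= 1 -> \sum_(k < m) binom_law p n k <= 1.
Proof.
move=> /andP[p0 p1]; elim: n m => [|n IH] m /=.
  case: m => [|m]; first by rewrite big_ord0 ler01.
  by rewrite big_ord_recl/= big1 ?addr0.
rewrite big_split/= -!mulr_sumr.
have : \sum_(k < m) (if k : nat is k'.+1 then binom_law p n k' else 0) <= 1.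
  case: m => [|m]; first by rewrite big_ord0 ler01.
  by rewrite big_ord_recl/= add0r; exact: IH.
by have := IH m; nra.
Qed.

(** Given that A is hit k times, the hits of B are binomial with parameters k
    and rho; this is the corresponding generating function restricted to that
    event. By induction on n, according to whether the first draw falls in B, in
    A minus B, or outside A. *)
Lemma hits_mgf (A B : set T) (p rho x : R) n k :
  measurable A -> measurable B -> B `<=` A ->
  P A = p%:E -> P B = (rho * p)%:E -> 0 <= p <= 1 -> 0 <= rho <= 1 -> 0 <= x ->
  (\int[iid_law P n]_t ((hits A t == k)%:R * x ^+ hits B t)%:E =
   (binom_law p n k * (1 - rho + rho * x) ^+ k)%:E)%E.
Proof.
move=> mA mB BA PA PB p01 r01 x0.
have [[p0 p1] [r0 r1]] := (andP p01, andP r01).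
set mu := 1 - rho + rho * x.
have mu0 : 0 <= mu by rewrite /mu; nra.
elim: n k => [|n IH] k.
  rewrite /= integral_dirac//; last first.
    apply/measurable_EFinP.
    exact: (@measurable_hits2 _ _ _ 0 A B (fun i j => (i == k)%:R * x ^+ j)).
  rewrite diracT mul1e /hits !big_ord0 expr0 mulr1.
  by case: k => [|k]; rewrite ?mulr1 ?mul0r.
rewrite iid_law_integralS; last 2 first.
- apply/measurable_EFinP.
  exact: (@measurable_hits2 _ _ _ n.+1 A B (fun i j => (i == k)%:R * x ^+ j)).
- by move=> t; rewrite lee_fin mulr_ge0// exprn_ge0.
pose c := binom_law p n k * mu ^+ k.
pose c' := if k is k'.+1 then binom_law p n k' * mu ^+ k' else 0.
have c0 : 0 <= c by rewrite mulr_ge0 ?exprn_ge0// binom_law_ge0.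
have c'0 : 0 <= c'.
  by rewrite /c'; case: (k) => // k'; rewrite mulr_ge0 ?exprn_ge0// binom_law_ge0.
transitivity (\int[P]_z ((c * \1_(~` A) z)%:E + (c' * \1_(A `\` B) z)%:E
    + (c' * x * \1_B z)%:E))%E.
  apply: eq_integral => z _.
  under eq_integral do rewrite !hits_cons.
  rewrite !indicE in_setC in_setD.
  have [zB|zB] := boolP (z \in B).
    have -> : z \in A by apply/mem_set/BA/set_mem.
    rewrite /= !mulr0 !add0e mulr1.
    under eq_integral do rewrite add1n exprS mulrCA EFinM.
    rewrite ge0_integralZl//; last 2 first.
    - apply/measurable_EFinP.
      exact: (@measurable_hits2 _ _ _ n A B (fun i j => (i.+1 == k)%:R * x ^+ j)).
    - by move=> t _; rewrite lee_fin mulr_ge0// exprn_ge0.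
    rewrite mulrC EFinM; congr (_ * _)%E.
    rewrite /c'; case: (k) => [|k'].
      by apply: integral0_eq => t _; rewrite mul0r.
    by rewrite -IH; apply: eq_integral => t _; rewrite eqSS.
  have [zA|zA] := boolP (z \in A).
    rewrite /= !mulr0 add0e adde0 mulr1.
    under eq_integral do rewrite add1n add0n.
    rewrite /c'; case: (k) => [|k'].
      by apply: integral0_eq => t _; rewrite mul0r.
    by rewrite -IH; apply: eq_integral => t _; rewrite eqSS.
  rewrite /= !mulr0 !adde0 mulr1 -IH.
  by apply: eq_integral => t _; rewrite !add0n.
have mi (D : set T) (e : R) : measurable D ->
    measurable_fun setT (fun z => (e * \1_D z)%:E).
  by move=> mD; apply/measurable_EFinP/measurable_funM => //; exact: measurable_indic.
have ii (D : set T) (e : R) : measurable D -> 0 <= e ->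
    (\int[P]_z (e * \1_D z)%:E = e%:E * P D)%E.
  move=> mD e0; under eq_integral do rewrite EFinM.
  rewrite ge0_integralZl//; first by rewrite integral_indic// setIT.
  by apply/measurable_EFinP; exact: measurable_indic.
have mAc : measurable (~` A) by exact: measurableC.
have mAB : measurable (A `\` B) by exact: measurableD.
have c'x0 : 0 <= c' * x by exact: mulr_ge0.
have nn (D : set T) (e : R) z : 0 <= e -> (0 <= (e * \1_D z)%:E)%E.
  by move=> e0; rewrite lee_fin mulr_ge0.
rewrite ge0_integralD//; last 4 first.
- by move=> z _; rewrite adde_ge0// nn.
- by apply: emeasurable_funD; exact: mi.
- by move=> z _; exact: nn.
- exact: mi.
rewrite ge0_integralD//; last 4 first.
- by move=> z _; exact: nn.
- exact: mi.
- by move=> z _; exact: nn.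
- exact: mi.
have PAc : P (~` A) = (1 - p)%:E by rewrite probability_setC// PA.
have PAB : P (A `\` B) = (p - rho * p)%:E.
  transitivity (P A - P (A `&` B))%E; last by rewrite setIidr// PA PB.
  apply: measureD => //; apply: le_lt_trans (ltry 1); exact: probability_le1.
rewrite !ii// PAc PAB PB -!EFinM -!EFinD; congr EFin.
rewrite /= /c /c' /mu; case: (k) => [|k']; first by rewrite !expr0; ring.
by rewrite !exprS; ring.
Qed.

(** Chernoff's bound with a separate exponential weight c k * x k ^+ j for each
    value k of the first count; the failure probability delta is common to all
    k, so that summing over k costs nothing. *)
Lemma hits_tail (A B : set T) (p rho delta : R) n (q : nat -> nat -> bool)
    (c x : nat -> R) :
  measurable A -> measurable B -> B `<=` A ->
  P A = p%:E -> P B = (rho * p)%:E -> 0 <= p <= 1 -> 0 <= rho <= 1 ->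
  (forall k, 0 <= c k) -> (forall k, 0 <= x k) ->
  (forall k j, q k j -> 1 <= c k * x k ^+ j) ->
  (forall k, c k * (1 - rho + rho * x k) ^+ k <= delta) ->
  (iid_law P n [set t | q (hits A t) (hits B t)] <= delta%:E)%E.
Proof.
move=> mA mB BA PA PB p01 r01 c0 x0 qP cP.
have mq := @measurable_hits_set _ _ R n A B q mA mB.
have mh k : measurable_fun setT (fun t : n.-tuple T =>
    ((hits A t == k)%:R * x k ^+ hits B t)).
  exact: (@measurable_hits2 _ _ _ n A B (fun i j => (i == k)%:R * x k ^+ j)).
rewrite -[X in iid_law P n X]setIT -integral_indic//.
apply: (@le_trans _ _ (\int[iid_law P n]_t
    \sum_(k < n.+1) (c k)%:E * ((hits A t == k)%:R * x k ^+ hits B t)%:E)%E).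
  apply: ge0_le_integral => //.
  - by apply/measurable_EFinP; exact: measurable_indic.
  - apply: emeasurable_sum => k; apply: measurable_funeM.
    by apply/measurable_EFinP; exact: mh.
  - move=> t _.
    have hA : (hits A t < n.+1)%N by rewrite ltnS hits_le.
    rewrite (bigD1 (Ordinal hA))//= eqxx mul1r.
    apply: (@le_trans _ _ ((c (hits A t)) * x (hits A t) ^+ hits B t)%:E).
      rewrite lee_fin indicE; case: (boolP (t \in _)) => [/set_mem/= /qP//|_].
      by rewrite mulr_ge0// exprn_ge0.
    rewrite EFinM leeDl// sume_ge0// => i _.
    by rewrite -EFinM lee_fin mulr_ge0// mulr_ge0// exprn_ge0.
rewrite ge0_integral_sum//; last 2 first.
- by move=> k; apply: measurable_funeM; by apply/measurable_EFinP; exact: mh.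
- by move=> k t _; rewrite -EFinM lee_fin mulr_ge0// mulr_ge0// exprn_ge0.
apply: (@le_trans _ _ (\sum_(k < n.+1) (delta * binom_law p n k)%:E)%E).
  apply: lee_sum => k _; rewrite ge0_integralZl//; last 3 first.
  - by apply/measurable_EFinP; exact: mh.
  - by move=> t _; rewrite lee_fin mulr_ge0// exprn_ge0.
  - by rewrite lee_fin.
  rewrite (hits_mgf _ _ mA mB BA PA PB)// -EFinM lee_fin.
  by rewrite mulrCA mulrC ler_wpM2r// binom_law_ge0.
have d0 : 0 <= delta by have := cP 0%N; have := c0 0%N; rewrite expr0; lra.
rewrite sumEFin lee_fin -mulr_sumr -[leRHS]mulr1 ler_wpM2l//.
exact: binom_law_le1.
Qed.

End hits_law.

(** * Chernoff bounds for the counts *)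

Section exponential_bounds.
Context (R : realType).
Implicit Types x : R.

Lemma expR_ge_deg2 x : 0 <= x -> 1 + x + x ^+ 2 / 2 <= expR x.
Proof.
move=> x0.
have -> : 1 + x + x ^+ 2 / 2 = series (exp_coeff x) 3.
  rewrite /series/= !big_nat_recr//= big_geq// /exp_coeff/= add0r.
  by rewrite expr0 expr1 !divr1.
apply: nondecreasing_cvgn_le; last exact: is_cvg_series_exp_coeff.
by apply: nondecreasing_series => n _; rewrite /exp_coeff/= divr_ge0// exprn_ge0.
Qed.

(** The product of 1 - x + x^2/2 and 1 + x + x^2/2 is 1 + x^4/4 >= 1. *)
Lemma expRN_le_deg2 x : 0 <= x -> expR (- x) <= 1 - x + x ^+ 2 / 2.
Proof.
move=> x0; have e0 := expR_gt0 x; rewrite expRN -div1r ler_pdivrMr//.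
have h := expR_ge_deg2 x0.
have q0 : 0 <= 1 - x + x ^+ 2 / 2 by have := sqr_ge0 (1 - x); nra.
apply: le_trans (ler_wpM2l q0 h).
have -> : (1 - x + x ^+ 2 / 2) * (1 + x + x ^+ 2 / 2) = 1 + (x ^+ 2) ^+ 2 / 4.
  by field.
by rewrite lerDl divr_ge0// sqr_ge0.
Qed.

Lemma expR_le_inv1B x : x < 1 -> expR x <= (1 - x)^-1.
Proof.
move=> x1; have h := expR_ge1Dx (- x).
have x1' : 0 < 1 - x by lra.
by rewrite -[x in expR x]opprK expRN lef_pV2 ?posrE ?expR_gt0.
Qed.

Lemma pow_le_expR (rho x : R) k : 0 <= rho <= 1 -> 0 <= x ->
  (1 - rho + rho * x) ^+ k <= expR (rho * k%:R * (x - 1)).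
Proof.
move=> /andP[r0 r1] x0.
rewrite mulrAC expRM_natr; apply: lerXn2r; rewrite ?nnegrE ?expR_ge0//; first nra.
by apply: le_trans (expR_ge1Dx _); lra.
Qed.

End exponential_bounds.

Section hits_deviations.
Context d (T : measurableType d) (R : realType) (P : probability T R).
Variables (A B : set T) (p rho L : R) (n : nat).
Hypotheses (mA : measurable A) (mB : measurable B) (BA : B `<=` A).
Hypotheses (PA : P A = p%:E) (PB : P B = (rho * p)%:E).
Hypotheses (p01 : 0 <= p <= 1) (r01 : 0 <= rho <= 1).

(** The classical choice of Chernoff parameter, sqrt (2 L / (rho k)), together
    with exp (-x) <= 1 - x + x^2/2. When rho k = 0 no sample belongs to the
    event, and the weight is set to 0. *)
Lemma hits_lower_tail : 0 <= L ->
  (iid_law P n [set t : n.-tuple T | ((hits B t)%:R <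
      rho * (hits A t)%:R - Num.sqrt (2 * L * (rho * (hits A t)%:R)))%R]
   <= (expR (- L))%:E)%E.
Proof.
move=> L0; have [r0 r1] := andP r01.
pose s (k : nat) : R := Num.sqrt (rho * k%:R).
have s0 k : 0 <= s k by exact: sqrtr_ge0.
have ss k : s k ^+ 2 = rho * k%:R by rewrite sqr_sqrtr// mulr_ge0.
pose l := Num.sqrt (2 * L); have l0 : 0 <= l by exact: sqrtr_ge0.
have ll : l ^+ 2 = 2 * L by rewrite sqr_sqrtr// mulr_ge0.
have sl k : Num.sqrt (2 * L * (rho * k%:R)) = l * s k by rewrite sqrtrM// mulr_ge0.
pose lam k := l / s k.
have lam0 k : 0 <= lam k by rewrite divr_ge0.
pose c k := if s k == 0 then 0 else expR (lam k * (s k ^+ 2 - l * s k)).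
pose q k j := j%:R < rho * k%:R - Num.sqrt (2 * L * (rho * k%:R)).
apply: (@hits_tail _ _ _ P A B p rho _ n q c (fun k => expR (- lam k))) => //.
- by move=> k; rewrite /c; case: ifPn => // _; exact: expR_ge0.
- move=> k j; rewrite /q sl -ss /c => jlt; case: ifPn => [/eqP sk|sk].
    by move: jlt; rewrite sk expr0n mulr0 subr0 ltrn0.
  rewrite -expRM_natr -expRD -[leLHS]expR0 ler_expR.
  by rewrite mulNr -mulrBr mulr_ge0 ?lam0// subr_ge0 ltW.
- move=> k; rewrite /c; case: ifPn => [_|sk]; first by rewrite mul0r expR_ge0.
  have skp : 0 < s k by rewrite lt_neqAle eq_sym sk s0.
  apply: (@le_trans _ _ (expR (lam k * (s k ^+ 2 - l * s k)) *
      expR (rho * k%:R * (expR (- lam k) - 1)))).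
    by rewrite ler_wpM2l ?expR_ge0//; apply: pow_le_expR => //; exact: expR_ge0.
  rewrite -expRD ler_expR -ss.
  have h := expRN_le_deg2 (lam0 k).
  have h2 := ler_wpM2l (sqr_ge0 (s k)) h.
  have e1 : lam k * (s k ^+ 2 - l * s k) = l * s k - l ^+ 2.
    by rewrite /lam; field.
  have e2 : s k ^+ 2 * (1 - lam k + lam k ^+ 2 / 2) = s k ^+ 2 - l * s k + l ^+ 2 / 2.
    by rewrite /lam; field.
  by rewrite e1; rewrite e2 in h2; rewrite mulrBr mulr1; lra.
Qed.

(** In square-root scale: with s = sqrt (rho k) and l = sqrt L the parameter l /
    (s + l) and exp x <= 1 / (1 - x) give the exponent - l^2 exactly. *)
Lemma hits_upper_tail : 0 < L ->
  (iid_law P n [set t : n.-tuple T |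
      ((Num.sqrt (rho * (hits A t)%:R) + Num.sqrt L) ^+ 2 < (hits B t)%:R)%R]
   <= (expR (- L))%:E)%E.
Proof.
move=> L0; have [r0 r1] := andP r01.
pose s (k : nat) : R := Num.sqrt (rho * k%:R).
have s0 k : 0 <= s k by exact: sqrtr_ge0.
have ss k : s k ^+ 2 = rho * k%:R by rewrite sqr_sqrtr// mulr_ge0.
pose l := Num.sqrt L; have l0 : 0 < l by rewrite sqrtr_gt0.
have ll : l ^+ 2 = L by rewrite sqr_sqrtr// ltW.
have sl0 k : 0 < s k + l by rewrite ltr_wpDl.
pose lam k := l / (s k + l).
have lam0 k : 0 <= lam k by rewrite divr_ge0// ltW.
pose c k := expR (- (lam k * (s k + l) ^+ 2)).
pose q k j := (s k + l) ^+ 2 < j%:R.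
apply: (@hits_tail _ _ _ P A B p rho _ n q c (fun k => expR (lam k))) => //.
- by move=> k; exact: expR_ge0.
- move=> k j; rewrite /q /c => jlt.
  rewrite -expRM_natr -expRD -[leLHS]expR0 ler_expR addrC.
  by rewrite -mulrBr mulr_ge0 ?lam0// subr_ge0 ltW.
- move=> k; rewrite /c.
  apply: (@le_trans _ _ (expR (- (lam k * (s k + l) ^+ 2)) *
      expR (rho * k%:R * (expR (lam k) - 1)))).
    by rewrite ler_wpM2l ?expR_ge0//; apply: pow_le_expR => //; exact: expR_ge0.
  rewrite -expRD ler_expR -ss -ll.
  have e1 : lam k * (s k + l) ^+ 2 = l * (s k + l) by rewrite /lam; field; rewrite gt_eqF.
  have h : s k ^+ 2 * expR (lam k) <= s k * (s k + l).
    have [->|sk] := eqVneq (s k) 0; first by rewrite expr0n !mul0r.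
    have skp : 0 < s k by rewrite lt_neqAle eq_sym sk s0.
    have lam1 : lam k < 1 by rewrite /lam ltr_pdivrMr// mul1r ltrDr.
    have := ler_wpM2l (sqr_ge0 (s k)) (expR_le_inv1B lam1).
    move=> /le_trans; apply; rewrite le_eqVlt; apply/orP; left; apply/eqP.
    by rewrite /lam; field; rewrite ?addrK ?sk ?(gt_eqF (sl0 k)).
  by rewrite e1 mulrBr mulr1; nra.
Qed.

End hits_deviations.

(** * Splitting an i.i.d. sample *)

Section glue.
Context d (T : measurableType d) (R : realType).

Definition glue n1 n2 n (e : (n1 + n2)%N = n) (t1 : n1.-tuple T)
  (t2 : n2.-tuple T) : n.-tuple T := tcast e (cat_tuple t1 t2).

Lemma tnth_glue_widen n1 n2 n (e : (n1 + n2)%N = n) (le1 : (n1 <= n)%N)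
  (t1 : n1.-tuple T) (t2 : n2.-tuple T) i :
  tnth (glue e t1 t2) (widen_ord le1 i) = tnth t1 i.
Proof.
rewrite /glue tcastE (_ : cast_ord _ _ = lshift n2 i) ?tnth_lshift//.
exact: val_inj.
Qed.

Lemma sum_glue n1 n2 n (e : (n1 + n2)%N = n) (t1 : n1.-tuple T)
  (t2 : n2.-tuple T) (F : T -> R) :
  \sum_(i < n | (n1 <= i)%N) F (tnth (glue e t1 t2) i) =
  \sum_(j < n2) F (tnth t2 j).
Proof.
case: n / e; rewrite /glue tcast_id big_split_ord/= big_pred0 ?add0r; last first.
  by move=> i; rewrite leqNgt ltn_ord.
by apply: eq_big => [i|i _]; rewrite ?leq_addr// tnth_rshift.
Qed.

Lemma measurable_glue n1 n2 n (e : (n1 + n2)%N = n) :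
  measurable_fun [set: n1.-tuple T * n2.-tuple T] (fun w => glue e w.1 w.2).
Proof.
case: n / e; apply/measurable_fun_tnthP => i.
rewrite /comp; case: (split_ordP i) => j ->.
  under eq_fun do rewrite /glue tcast_id tnth_lshift.
  by apply: (measurableT_comp (measurable_tnth j)).
under eq_fun do rewrite /glue tcast_id tnth_rshift.
by apply: (measurableT_comp (measurable_tnth j)).
Qed.

(** By induction on the length of the first part, drawing one observation at a
    time. *)
Lemma iid_law_integral_glue (P : probability T R) n1 n2 n
    (e : (n1 + n2)%N = n) (f : n.-tuple T -> \bar R) :
  measurable_fun setT f -> (forall t, 0 <= f t)%E ->
  (\int[iid_law P n]_t f t =
   \int[iid_law P n1]_t1 \int[iid_law P n2]_t2 f (glue e t1 t2))%E.
Proof.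
case: n / e f => f mf f0.
rewrite /glue; under [RHS]eq_integral do under eq_integral do rewrite tcast_id.
have mcat m1 (g : (m1 + n2).-tuple T -> \bar R) : measurable_fun setT g ->
    measurable_fun setT (fun w : m1.-tuple T * n2.-tuple T => g (cat_tuple w.1 w.2)).
  move=> mg; apply: (measurableT_comp mg).
  have := @measurable_glue m1 n2 _ erefl.
  by rewrite /glue; under eq_fun do rewrite tcast_id.
elim: n1 f mf f0 => [|n1 IH] f mf f0.
  rewrite [RHS]integral_dirac//; last first.
    apply: (measurable_fun_fubini_tonelli_F
      (fun w : 0.-tuple T * n2.-tuple T => f (cat_tuple w.1 w.2))) => //.
    exact: mcat.
  rewrite diracT mul1e; apply: eq_integral => t _; congr f.
  exact: val_inj.
rewrite (@iid_law_integralS _ _ _ _ (n1 + n2))//.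
rewrite iid_law_integralS; last 2 first.
- apply: (measurable_fun_fubini_tonelli_F
    (fun w : n1.+1.-tuple T * n2.-tuple T => f (cat_tuple w.1 w.2))) => //.
  exact: mcat.
- by move=> t; exact: integral_ge0.
apply: eq_integral => z _.
rewrite (IH (fun t => f (tuple_cons (z, t))))//; last first.
  exact: (measurableT_comp mf (measurableT_comp
    (@measurable_tuple_cons _ T (n1 + n2)) (pair1_measurable z))).
apply: eq_integral => t1 _; apply: eq_integral => t2 _; congr f.
exact: val_inj.
Qed.

End glue.

(** * Weak duality for the population problem *)

Section weak_duality.
Context (R : realType) (d : nat).
Variables (P : probability (observation R d) R) (eta : {mfun covariate R d >-> R}).
Hypothesis eta01 : forall x, 0 <= eta x <= 1.
Local Notation mu := (marginal P).

Lemma regression_law_integral (f : R -> R) : measurable_fun setT f ->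
  (forall t, 0 <= t <= 1 -> 0 <= f t <= 1) ->
  (\int[regression_law P eta]_(t in `[0%R, 1%R]) (f t)%:E =
   (\int[mu]_x f (eta x))%:E)%E.
Proof.
move=> mf f01; rewrite ge0_integral_pushforward//; last 2 first.
- by apply/measurable_EFinP/measurable_funTS.
- by move=> t; rewrite inE/= in_itv/= => /f01/andP[? _]; rewrite lee_fin.
rewrite (_ : _ @^-1` _ = setT); last first.
  by apply/seteqP; split => // x _ /=; rewrite in_itv/= eta01.
rewrite -expectE//; apply: bounded_measurable01 => [|x]; last exact: f01.
exact: measurableT_comp.
Qed.

(** Weak duality: integrate [ell_ge_dual_loss] against an arbitrary admissible
    a. *)
Lemma expect_dual_loss_le_optimal_length (alpha lam : R) : 0 <= lam ->
  ((\int[mu]_x dual_loss lam (eta x))%:E <=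
   optimal_length alpha (regression_law P eta) + (lam * alpha)%:E)%E.
Proof.
move=> l0; rewrite -leeBlDr// -EFinB.
apply: le_ereal_inf_tmp => _ [a [ma a01 aalpha] <-].
pose a' : R -> R := a \_ `[0%R, 1%R].
have ma' : measurable_fun setT a'.
  by apply/(measurable_restrictT a (measurable_itv _)); exact: ma.
have a'E t : 0 <= t <= 1 -> a' t = a t.
  by move=> t01; rewrite /a' patchE mem_set//= in_itv.
have a'01 t : 0 <= t <= 1 -> 0 <= a' t <= 1.
  by move=> t01; rewrite a'E// a01//= in_itv.
have ma'e : measurable_fun setT (fun x => a' (eta x)) by exact: measurableT_comp.
rewrite (eq_integral (fun t => (ell t (a' t))%:E)); last first.
  by move=> t; rewrite inE/= in_itv/= => t01; rewrite a'E.
rewrite regression_law_integral; last 2 first.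
- exact: measurable_ell.
- by move=> t t01; apply: ell01 => //; exact: a'01.
have h : \int[mu]_x a' (eta x) <= alpha.
  rewrite -lee_fin -regression_law_integral//.
  rewrite (eq_integral (fun t => (a t)%:E))// => t.
  by rewrite inE/= in_itv/= => t01; rewrite a'E.
rewrite lee_fin lerBlDr.
have ba : bounded_measurable (fun x => a' (eta x)).
  by apply: bounded_measurable01 => // x; exact: a'01.
have be : bounded_measurable (fun x => ell (eta x) (a' (eta x))).
  by apply: bounded_measurable01 => [|x]; [exact: measurable_ell|apply: ell01 => //; exact: a'01].
apply: (@le_trans _ _ (\int[mu]_x (ell (eta x) (a' (eta x)) + lam * a' (eta x)))).
  apply: expect_le.
  - apply: bounded_measurable01 => [|x]; first exact: measurable_dual_loss.
    by rewrite dual_loss_ge0// dual_loss_le1.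
  - by bmfun.
  - by move=> x; apply: ell_ge_dual_loss => //; exact: a'01.
rewrite expectD//; last by bmfun.
by rewrite expectZ// lerD2l ler_wpM2l.
Qed.

Lemma optimal_length_ge0 (alpha : R) (Q : probability R R) :
  (0 <= optimal_length alpha Q)%E.
Proof.
apply: le_ereal_inf_tmp => _ [a [_ a01 _] <-].
apply: integral_ge0 => t t01; rewrite lee_fin.
have t01' : 0 <= t <= 1 by move: t01; rewrite /= in_itv.
by have /andP[] := ell01 t01' (a01 t t01).
Qed.

End weak_duality.

(** * Deviation events *)

Section deviation_events.
Context (R : realType) (d : nat).
Variables (P : probability (observation R d) R) (eta : {mfun covariate R d >-> R}).
Hypothesis regP : regression_function P eta.
Local Notation mu := (marginal P).
Variables (M N : nat) (B : 'I_M -> set (covariate R d)).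
Hypothesis mB : forall m, measurable (B m).
Variable L : R.
Hypothesis L0 : 0 < L.

Let eta01 : forall x, 0 <= eta x <= 1. Proof. exact: regP.1. Qed.
Let meta : measurable_fun setT eta. Proof. by []. Qed.

Local Notation massB m := (mass mu B m).
Local Notation rateB m := (rate mu eta B m).

Definition cell m : set (observation R d) := B m `*` setT.
Definition cell_of (b : bool) m : set (observation R d) := B m `*` [set b].

Lemma measurable_cell m : measurable (cell m).
Proof. exact: measurableX. Qed.

Lemma measurable_cell_of b m : measurable (cell_of b m).
Proof. exact: measurableX. Qed.

Lemma prob_cell m : P (cell m) = (massB m)%:E.
Proof.
transitivity (mu (B m)).
  by rewrite /marginal/= /distribution/= /pushforward; congr (P _);
     apply/seteqP; split => -[x y] //= [].
rewrite /mass expect_indic// fineK//.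
apply/fin_numPlt; rewrite (lt_le_trans _ (measure_ge0 _ _))//=.
by apply: le_lt_trans (ltry 1); exact: probability_le1.
Qed.

Lemma prob_cell_true m : P (cell_of true m) = (rateB m * massB m)%:E.
Proof.
rewrite rate_mass// /cell_of regP.2// integral_mkcond /ones -expectE; last first.
  apply: bounded_measurableM; first exact: bounded_measurable_indic.
  exact: bounded_measurable01.
apply: eq_integral => x _; rewrite /= patchE indicE.
by case: ifPn => _; rewrite ?mul1r ?mul0r.
Qed.

Lemma prob_cell_false m : P (cell_of false m) = ((1 - rateB m) * massB m)%:E.
Proof.
have e : cell m = cell_of true m `|` cell_of false m.
  apply/seteqP; split => -[x y] /=; last by case=> -[].
  by case: y => -[h _]; [left|right].
have : P (cell m) = (P (cell_of true m) + P (cell_of false m))%E.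
  rewrite e measureU//; try exact: measurable_cell_of.
  by apply/seteqP; split => -[x y] //= [[_ /= e1] [_ /= e2]]; rewrite e1 in e2.
rewrite prob_cell prob_cell_true => h.
have fin : P (cell_of false m) \is a fin_num by exact: fin_num_measure (measurable_cell_of _ _).
move: h; rewrite -(fineK fin) -EFinD => -[h].
by congr EFin; lra.
Qed.

Definition few_points m : set (N.-tuple (observation R d)) :=
  [set t | (hits (cell m) t)%:R < massB m * N%:R - Num.sqrt (2 * L * (massB m * N%:R))].

Definition label_rate (b : bool) m := if b then rateB m else 1 - rateB m.

Definition few_labels b m : set (N.-tuple (observation R d)) :=
  [set t | (hits (cell_of b m) t)%:R < label_rate b m * (hits (cell m) t)%:R
     - Num.sqrt (2 * L * (label_rate b m * (hits (cell m) t)%:R))].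

Definition many_labels b m : set (N.-tuple (observation R d)) :=
  [set t | (Num.sqrt (label_rate b m * (hits (cell m) t)%:R) + Num.sqrt L) ^+ 2 <
     (hits (cell_of b m) t)%:R].

Definition minority m : bool := rateB m <= 2^-1.

(** The number of failures on a sample. Its mean obeys the union bound, and it
    is at least 1 on any bad sample, so adding it to an estimate valid on good
    samples gives one valid on all samples. *)
Definition deviations (t : N.-tuple (observation R d)) : R :=
  \sum_m (\1_(few_points m) t + \1_(few_labels true m) t +
    (\1_(few_labels false m) t + \1_(many_labels (minority m) m) t)).

Lemma label_rate01 b m : 0 <= label_rate b m <= 1.
Proof.
have /andP[? ?] := rate01 mu meta eta01 mB m.
by case: b => /=; apply/andP; split; lra.
Qed.

Lemma mass01 m : 0 <= massB m <= 1.
Proof.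
rewrite mass_ge0//= -lee_fin -prob_cell; exact: (probability_le1 P (measurable_cell m)).
Qed.

Lemma prob_cell_of b m : P (cell_of b m) = (label_rate b m * massB m)%:E.
Proof. by case: b; [exact: prob_cell_true|exact: prob_cell_false]. Qed.

Lemma cell_of_sub b m : cell_of b m `<=` cell m.
Proof. by move=> z []. Qed.

Lemma hits_setT (t : N.-tuple (observation R d)) : hits setT t = N.
Proof.
rewrite /hits (eq_bigr (fun=> 1%N)) ?sum1_card ?card_ord// => i _.
by rewrite in_setT.
Qed.

Lemma measurable_few_points m : measurable (few_points m).
Proof.
exact: (@measurable_hits_set _ _ R N (cell m) (cell m) (fun i _ => i%:R <
  massB m * N%:R - Num.sqrt (2 * L * (massB m * N%:R))))
  (measurable_cell m) (measurable_cell m).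
Qed.

Lemma measurable_few_labels b m : measurable (few_labels b m).
Proof.
exact: (@measurable_hits_set _ _ R N (cell m) (cell_of b m) (fun i j => j%:R <
  label_rate b m * i%:R - Num.sqrt (2 * L * (label_rate b m * i%:R))))
  (measurable_cell m) (measurable_cell_of b m).
Qed.

Lemma measurable_many_labels b m : measurable (many_labels b m).
Proof.
exact: (@measurable_hits_set _ _ R N (cell m) (cell_of b m) (fun i j =>
  (Num.sqrt (label_rate b m * i%:R) + Num.sqrt L) ^+ 2 < j%:R))
  (measurable_cell m) (measurable_cell_of b m).
Qed.

(** A bin count is the count of the cell inside the whole space, which is hit
    every time. *)
Lemma prob_few_points m : (iid_law P N (few_points m) <= (expR (- L))%:E)%E.
Proof.
have PB : P (cell m) = (massB m * 1)%:E by rewrite mulr1 prob_cell.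
have h := @hits_lower_tail _ _ _ P setT (cell m) 1 (massB m) L N measurableT
  (measurable_cell m) (@subsetT _ _) (probability_setT P) PB _ (mass01 m) (ltW L0).
rewrite ler01 lexx in h; apply: le_trans (h isT).
by under eq_set do rewrite hits_setT.
Qed.

Lemma prob_few_labels b m : (iid_law P N (few_labels b m) <= (expR (- L))%:E)%E.
Proof.
exact: (@hits_lower_tail _ _ _ P (cell m) (cell_of b m) (massB m) (label_rate b m) L N
  (measurable_cell m) (measurable_cell_of b m) (@cell_of_sub b m)
  (prob_cell m) (prob_cell_of b m) (mass01 m) (label_rate01 b m) (ltW L0)).
Qed.

Lemma prob_many_labels b m : (iid_law P N (many_labels b m) <= (expR (- L))%:E)%E.
Proof.
exact: (@hits_upper_tail _ _ _ P (cell m) (cell_of b m) (massB m) (label_rate b m) L N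
  (measurable_cell m) (measurable_cell_of b m) (@cell_of_sub b m)
  (prob_cell m) (prob_cell_of b m) (mass01 m) (label_rate01 b m) L0).
Qed.

Lemma bounded_deviations : bounded_measurable deviations.
Proof.
apply: bounded_measurable_sum => m.
by do 2 apply: bounded_measurableD; try apply: bounded_measurableD;
  apply: bounded_measurable_indic;
  [exact: measurable_few_points|exact: measurable_few_labels
  |exact: measurable_few_labels|exact: measurable_many_labels].
Qed.

Lemma expect_deviations : \int[iid_law P N]_t deviations t <= 4 * M%:R * expR (- L).
Proof.
have b1 m := bounded_measurable_indic R (measurable_few_points m).
have b2 b m := bounded_measurable_indic R (measurable_few_labels b m).
have b3 b m := bounded_measurable_indic R (measurable_many_labels b m).
have pr (S : set (N.-tuple (observation R d))) : measurable S ->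
    (iid_law P N S <= (expR (- L))%:E)%E -> \int[iid_law P N]_t \1_S t <= expR (- L).
  by move=> mS h; rewrite -lee_fin -expectE ?integral_indic ?setIT//; exact: bounded_measurable_indic.
rewrite expect_sum => [|m]; last by do 2 apply: bounded_measurableD; try apply: bounded_measurableD.
apply: (@le_trans _ _ (\sum_(m < M) (4 * expR (- L)))); last first.
  by rewrite sumr_const card_ord -[_ *+ M]mulr_natr mulrAC.
apply: ler_sum => m _.
rewrite expectD; try by apply: bounded_measurableD.
rewrite !expectD//.
have := pr _ (measurable_few_points m) (prob_few_points m).
have := pr _ (measurable_few_labels true m) (prob_few_labels true m).
have := pr _ (measurable_few_labels false m) (prob_few_labels false m).
have := pr _ (measurable_many_labels (minority m) m) (prob_many_labels (minority m) m).
lra.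
Qed.

Lemma no_deviation t : 1 <= deviations t \/ forall m,
  [/\ ~ few_points m t, ~ few_labels true m t, ~ few_labels false m t &
      ~ many_labels (minority m) m t].
Proof.
have [h|h] := leP 1 (deviations t); [by left|right => m].
move: h; rewrite /deviations (bigD1 m)//= => h.
have {h} : \1_(few_points m) t + \1_(few_labels true m) t +
    (\1_(few_labels false m) t + \1_(many_labels (minority m) m) t) < 1 :> R.
  apply: le_lt_trans h; rewrite lerDl; apply: sumr_ge0 => i _.
  by do 2 apply: addr_ge0 => //; apply: addr_ge0.
have ge0 (S : set (N.-tuple (observation R d))) : 0 <= (\1_S t : R) by [].
have one (S : set (N.-tuple (observation R d))) : S t -> (\1_S t : R) = 1.
  by move=> St; rewrite indicE mem_set.
have := ge0 (few_points m); have := ge0 (few_labels true m).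
have := ge0 (few_labels false m); have := ge0 (many_labels (minority m) m).
by move=> h4 h3 h2 h1 lt1; split=> /one St; move: lt1; rewrite St ltNge => /negP; apply; lra.
Qed.

End deviation_events.

(** * Iterated expectations *)

Section iterated_expectation.
Context d1 d2 (T1 : measurableType d1) (T2 : measurableType d2) (R : realType).
Variables (P1 : probability T1 R) (P2 : probability T2 R).
Variable f : T1 * T2 -> R.
Hypotheses (mf : measurable_fun setT f) (f01 : forall w, 0 <= f w <= 1).

Let mE : measurable_fun setT (EFin \o f).
Proof. exact/measurable_EFinP. Qed.

Let E0 w : (0 <= (EFin \o f) w)%E.
Proof. by rewrite lee_fin; have /andP[] := f01 w. Qed.

Lemma measurable_expect : measurable_fun setT (fun t => \int[P2]_x f (t, x)).
Proof.
have h := @measurable_fun_fubini_tonelli_F _ _ _ _ _ P2 (EFin \o f) mE E0.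
exact: (measurableT_comp (fine_measurable measurableT) h).
Qed.

Lemma expect_section01 t : 0 <= \int[P2]_x f (t, x) <= 1.
Proof. by apply: expect01 => //; exact: measurable_fun_pair2. Qed.

Lemma expect_pair : (\int[P1 \x P2]_w (f w)%:E =
  \int[P1]_t (\int[P2]_x f (t, x))%:E)%E.
Proof.
rewrite (fubini_tonelli1 (EFin \o f))//; apply: eq_integral => t _.
rewrite -expectE//; apply: bounded_measurable01 => //.
exact: measurable_fun_pair2.
Qed.

End iterated_expectation.

Lemma expect_glue d (T : measurableType d) (R : realType) (P : probability T R)
    n1 n2 n (e : (n1 + n2)%N = n) (f : n.-tuple T -> R) :
  measurable_fun setT f -> (forall D, 0 <= f D <= 1) ->
  \int[iid_law P n]_D f D =
  \int[iid_law P n1]_t1 \int[iid_law P n2]_t2 f (glue e t1 t2).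
Proof.
move=> mf f01.
have mg := measurableT_comp mf (measurable_glue e).
have g01 (w : n1.-tuple T * n2.-tuple T) : 0 <= f (glue e w.1 w.2) <= 1 by [].
have [ms s01] := (measurable_expect (iid_law P n2) mg g01,
  expect_section01 (iid_law P n2) mg g01).
apply: EFin_inj; rewrite -expectE; last exact: bounded_measurable01.
rewrite -expectE; last exact: bounded_measurable01.
rewrite (iid_law_integral_glue _ e)//; last 2 first.
- exact/measurable_EFinP.
- by move=> D; rewrite lee_fin; have /andP[] := f01 D.
apply: eq_integral => t1 _; rewrite expectE//; apply: bounded_measurable01 => //.
exact: (measurable_fun_pair2 t1 mg).
Qed.

(** * Coverage and length as iterated expectations *)

Lemma product_xsection d1 d2 (T1 : measurableType d1) (T2 : measurableType d2)
    (R : realType) (P1 : probability T1 R) (P2 : probability T2 R)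
    (S : set (T1 * T2)) :
  ((P1 \x P2) S = \int[P1]_w P2 (xsection S w))%E.
Proof. by []. Qed.

Lemma integral_product d1 d2 (T1 : measurableType d1) (T2 : measurableType d2)
    (R : realType) (P1 : probability T1 R) (P2 : probability T2 R)
    (f : T1 * T2 -> \bar R) : measurable_fun setT f -> (forall w, 0 <= f w)%E ->
  (\int[P1 \x P2]_w f w = \int[P1]_t \int[P2]_x f (t, x))%E.
Proof. by move=> mf f0; rewrite fubini_tonelli1. Qed.

Section procedure.
Context (R : realType) (d n : nat) (alpha : R) (A : regression_algorithm R d).
Local Notation X := (covariate R d).
Local Notation Z := (observation R d).
Local Notation M := (nbins R n).
Local Notation N := (uphalf n).
Local Notation L := (@log_term R n alpha).
Local Notation U := (uniform_prob (@ltr01 R)).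
Local Notation leb := (@lebesgue_measure R).
Variable a : n.-tuple Z -> 'I_M -> R.
Hypotheses (M0 : (0 < M)%N) (N0 : (0 < N)%N) (L0 : 0 < L).
Hypothesis ma : forall m, measurable_fun [set: n.-tuple Z] (fun D => a D m).
Hypothesis a01 : forall D m, 0 <= a D m <= 1.
Local Notation pit := (pitilde alpha A).
Local Notation sel := (select alpha A a).
Local Notation sell := (select_length alpha A a).
Implicit Types (D : n.-tuple Z) (m : 'I_M).

Let NR0 : 0 < N%:R :> R. Proof. by rewrite ltr0n. Qed.

Lemma pitilde_gt0_lt1 D m : 0 < pit D m < 1.
Proof.
rewrite pitildeE; apply: shrunk_rate_gt0_lt1 => //.
- exact: bin_count_ge0.
- exact: bin_ones_ge0.
- exact: bin_ones_le.
Qed.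

Lemma pitilde01 D m : 0 <= pit D m <= 1.
Proof. by have /andP[/ltW -> /ltW ->] := pitilde_gt0_lt1 D m. Qed.

Lemma select01 D x s : 0 <= s <= 1 -> 0 <= sel D x s <= 1.
Proof.
move=> s01; have [m h] := bin_exists A D x M0.
by rewrite /select (sum_bin _ h) fsel01// pitilde01.
Qed.

Lemma select_length01 D x : 0 <= sell D x <= 1.
Proof.
have [m h] := bin_exists A D x M0.
by rewrite /select_length (sum_bin _ h) ell01// pitilde01.
Qed.

Lemma split_CI_select D x u :
  split_CI alpha A a D x u = [set s | (0 <= s <= 1) /\ u <= sel D x s].
Proof.
have [m h] := bin_exists A D x M0.
apply/seteqP; split => s [s01].
  move=> [m' [h' us]]; split => //.
  by rewrite /select (sum_bin _ h').
by rewrite /select (sum_bin _ h) => us; split => //; exists m.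
Qed.

Lemma integral_select D x :
  (\int[U]_u leb (split_CI alpha A a D x u) = (sell D x)%:E)%E.
Proof.
under eq_integral do rewrite split_CI_select.
rewrite uniform_superlevel_length; last 2 first.
- exact: (@measurable_select R d n alpha A a ma _ _ (fun=> D) (fun=> x) id).
- by move=> s; exact: select01.
have [m h] := bin_exists A D x M0.
rewrite /select_length (sum_bin _ h) -integral_fsel//; last exact: pitilde_gt0_lt1.
by apply: eq_integral => s _; rewrite /select (sum_bin _ h).
Qed.

Variables (P : probability Z R) (eta : {mfun X >-> R}).
Hypothesis eta01 : forall x, 0 <= eta x <= 1.
Local Notation mu := (marginal P).

Let marginal_integral (f : X -> R) : measurable_fun setT f ->
  (forall x, 0 <= f x <= 1) ->
  (\int[P]_z (f z.1)%:E = (\int[mu]_x f x)%:E)%E.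
Proof.
move=> mf f01; rewrite -expectE; last exact: bounded_measurable01.
rewrite ge0_integral_pushforward//.
  by apply/measurable_EFinP.
by move=> x _; rewrite lee_fin; have /andP[] := f01 x.
Qed.

Lemma measurable_select_eta :
  measurable_fun setT (fun w : n.-tuple Z * X => sel w.1 w.2 (eta w.2)).
Proof.
apply: (@measurable_select R d n alpha A a ma _ _ fst snd (fun w => eta w.2)) => //.
exact: measurableT_comp.
Qed.

Lemma measurable_select_length2 :
  measurable_fun setT (fun w : n.-tuple Z * X => sell w.1 w.2).
Proof. exact: (@measurable_select_length R d n alpha A a ma _ _ fst snd). Qed.

Lemma coverage_integral :
  (((iid_law P n \x P) \x U)
     [set w | split_CI alpha A a w.1.1 w.1.2.1 w.2 (eta w.1.2.1)] =
   (\int[iid_law P n]_D \int[mu]_x sel D x (eta x))%:E)%E.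
Proof.
transitivity (\int[iid_law P n \x P]_w (sel w.1 w.2.1 (eta w.2.1))%:E)%E.
  rewrite product_xsection; apply: eq_integral => w _.
  rewrite -(uniform_prob_le (select01 w.1 w.2.1 (eta01 w.2.1))); congr (U _).
  apply/seteqP; split => u; rewrite /xsection/= inE/= split_CI_select/=.
    by case.
  by split; [exact: eta01|].
have ms : measurable_fun setT (fun w : n.-tuple Z * Z => sel w.1 w.2.1 (eta w.2.1)).
  apply: (@measurable_select R d n alpha A a ma _ _ fst (fun w => w.2.1) (fun w => eta w.2.1)) => //.
  - exact: measurableT_comp.
  - by apply: measurableT_comp => //; exact: measurableT_comp.
rewrite expect_pair//; last by move=> w; exact: select01.
rewrite -expectE; last first.
  apply: bounded_measurable01; first exact: (measurable_expect mu measurable_select_eta (fun w => select01 w.1 w.2 (eta01 w.2))).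
  by move=> D; exact: (expect_section01 mu measurable_select_eta (fun w => select01 w.1 w.2 (eta01 w.2))).
apply: eq_integral => D _; rewrite -marginal_integral.
- rewrite expectE//; apply: bounded_measurable01; last by move=> z; exact: select01.
  exact: (measurable_fun_pair2 D ms).
- exact: (measurable_fun_pair2 D measurable_select_eta).
- by move=> x; exact: select01.
Qed.

Lemma expected_length_integral :
  expected_length U (split_CI alpha A a) P =
  ((\int[iid_law P n]_D \int[mu]_x sell D x)%:E)%E.
Proof.
rewrite /expected_length.
pose E : set ((n.-tuple Z * Z) * R * R) :=
  [set w | [&& 0 <= w.2, w.2 <= 1 & w.1.2 <= sel w.1.1.1 w.1.1.2.1 w.2]].
have mE : measurable E.
  rewrite -[E]setTI; apply: (_ : measurable_fun setT (fun w : (n.-tuple Z * Z) * R * R =>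
    [&& 0 <= w.2, w.2 <= 1 & w.1.2 <= sel w.1.1.1 w.1.1.2.1 w.2])) => //.
  apply: measurable_and; first exact: measurable_fun_ler.
  apply: measurable_and; first exact: measurable_fun_ler.
  apply: measurable_fun_ler; first exact: measurableT_comp.
  apply: (@measurable_select R d n alpha A a ma _ _ (fun w => w.1.1.1) (fun w => w.1.1.2.1) snd) => //.
  - by apply: measurableT_comp => //; exact: measurableT_comp.
  - by apply: measurableT_comp => //; apply: measurableT_comp => //; exact: measurableT_comp.
have CE w : split_CI alpha A a w.1.1 w.1.2.1 w.2 = xsection E w.
  rewrite split_CI_select; apply/seteqP; split => s; rewrite /xsection/= inE/= /E/=.
    by move=> [/andP[-> ->] ->].
  by move=> /and3P[-> -> ->].
under eq_integral do rewrite CE.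
have mleb := measurable_fun_xsection leb mE.
rewrite integral_product//.
transitivity (\int[iid_law P n \x P]_w (sell w.1 w.2.1)%:E)%E.
  apply: eq_integral => w _; rewrite -integral_select.
  by apply: eq_integral => u _; rewrite -(CE (w, u)).
have ms : measurable_fun setT (fun w : n.-tuple Z * Z => sell w.1 w.2.1).
  apply: (@measurable_select_length R d n alpha A a ma _ _ fst (fun w => w.2.1)) => //.
  exact: measurableT_comp.
rewrite expect_pair//; last by move=> w; exact: select_length01.
rewrite -expectE; last first.
  apply: bounded_measurable01; first exact: (measurable_expect mu measurable_select_length2 (fun w => select_length01 w.1 w.2)).
  by move=> D; exact: (expect_section01 mu measurable_select_length2 (fun w => select_length01 w.1 w.2)).
apply: eq_integral => D _; rewrite -marginal_integral.
- rewrite expectE//; apply: bounded_measurable01; last by move=> z; exact: select_length01.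
  exact: (measurable_fun_pair2 D ms).
- exact: (measurable_fun_pair2 D measurable_select_length2).
- by move=> x; exact: select_length01.
Qed.

End procedure.

(** * Bounds for a fixed first half *)

Section second_half.
Context (R : realType) (d n : nat) (alpha : R) (A : regression_algorithm R d).
Local Notation X := (covariate R d).
Local Notation Z := (observation R d).
Local Notation M := (nbins R n).
Local Notation N := (uphalf n).
Local Notation L := (@log_term R n alpha).
Variable a : n.-tuple Z -> 'I_M -> R.
Hypotheses (M0 : (0 < M)%N) (N0 : (0 < N)%N) (L0 : 0 < L) (alpha0 : 0 < alpha).
Hypothesis amin : minimizer_selection alpha A a.
Variables (P : probability Z R) (eta : {mfun X >-> R}).
Hypothesis regP : regression_function P eta.
Local Notation mu := (marginal P).
Variables (e : (n./2 + N)%N = n) (t1 : n./2.-tuple Z) (t0 : N.-tuple Z).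
Implicit Types (t : N.-tuple Z) (m : 'I_M).

Let B m : set X := bin A (glue e t1 t0) m.
Local Notation pm m := (mass mu B m).
Local Notation rm m := (rate mu eta B m).
Local Notation bad := (@deviations R d P eta M N B L).
Local Notation D t2 := (glue e t1 t2).

Let NR0 : 0 < N%:R :> R. Proof. by rewrite ltr0n. Qed.
Let eta01 : forall x, 0 <= eta x <= 1. Proof. exact: regP.1. Qed.
Let meta : measurable_fun setT eta. Proof. by []. Qed.
Let ma : forall m, measurable_fun setT (fun D => a D m). Proof. exact: amin.1. Qed.
Let a01 D m : 0 <= a D m <= 1. Proof. by have [[]] := amin.2 D. Qed.
Let mB m : measurable (B m). Proof. exact: measurable_bin. Qed.

Lemma fit_half_glue t2 : fit_half A (D t2) = fit A t1.
Proof.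
rewrite /fit_half; congr (fit A _); apply: eq_from_tnth => i.
by rewrite tnth_mktuple tnth_glue_widen.
Qed.

(** The bins are functions of the first half alone; t0 is an arbitrary second
    half that serves to name them. *)
Lemma bin_glue t2 m : bin A (D t2) m = B m.
Proof. by rewrite /B /bin !fit_half_glue. Qed.

Let partB x : exists2 m, B m x &
  forall F : 'I_M -> R, \sum_m' \1_(B m') x * F m' = F m.
Proof.
have [m h] := bin_exists A (D t0) x M0; exists m => // F; exact: (sum_bin _ h).
Qed.

Lemma bin_count_glue t2 m : bin_count A (D t2) m = (hits (cell B m) t2)%:R.
Proof.
rewrite /bin_count hitsE bin_glue (sum_glue _ _ _ (fun z => \1_(B m) z.1)).
apply: eq_bigr => i _; rewrite !indicE; congr (nat_of_bool _)%:R.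
by apply/idP/idP => /set_mem h; apply/mem_set => //; case: h.
Qed.

Lemma bin_ones_glue t2 m : bin_ones A (D t2) m = (hits (cell_of B true m) t2)%:R.
Proof.
by rewrite /bin_ones hitsE bin_glue (sum_glue _ _ _ \1_(B m `*` [set true])).
Qed.

Lemma hits_cell_split t2 m :
  (hits (cell_of B false m) t2)%:R =
  (hits (cell B m) t2)%:R - (hits (cell_of B true m) t2)%:R :> R.
Proof.
apply/eqP; rewrite -subr_eq opprK; apply/eqP; rewrite !hitsE -big_split/=.
apply: eq_bigr => i _; rewrite !indicE -natrD; congr _%:R.
case: (tnth t2 i) => x y.
have inE b : ((x, y) \in cell_of B b m) = ((x \in B m) && (y == b)).
  apply/idP/idP => [/set_mem[/= h ->]|/andP[/set_mem h /eqP ->]].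
    by rewrite eqxx andbT mem_set.
  exact/mem_set.
have -> : ((x, y) \in cell B m) = (x \in B m).
  by apply/idP/idP => /set_mem h; apply/mem_set => //; case: h.
by rewrite !inE; case: y {inE}; case: (x \in B m).
Qed.

Definition good t2 := forall m,
  [/\ ~ few_points P B L m t2, ~ few_labels P eta B L true m t2,
      ~ few_labels P eta B L false m t2 &
      ~ many_labels P eta B L (minority P eta B m) m t2].

(** The total inflation is bounded on every sample, because the empirical masses
    add up to one. *)
Lemma sum_ptilde_le (data : n.-tuple Z) : \sum_m ptilde alpha A data m <=
  1 + (Num.sqrt (3 * (L / N%:R * M%:R)) + 3 * (L / N%:R * M%:R)).
Proof.
have r0 : 0 <= L / N%:R by rewrite divr_ge0// ltW.
have ph0 m : 0 <= phat A data m by rewrite phatE divr_ge0// ?bin_count_ge0// ltW.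
under eq_bigr do rewrite ptildeE -phatE /inflate.
rewrite !big_split/= sum_phat// -addrA lerD2l; apply: lerD.
- under eq_bigr do rewrite -mulrA sqrtrM//.
  rewrite -mulr_suml mulrC (mulrA 3 (L / N%:R) M%:R).
  rewrite [leRHS]sqrtrM; last by rewrite mulr_ge0.
  rewrite ler_wpM2l ?sqrtr_ge0//.
  by apply: sum_sqrt_le => //; rewrite sum_phat.
- by rewrite sumr_const card_ord -[_ *+ M]mulr_natr !mulrA.
Qed.

Section good_sample.
Variable t2 : N.-tuple Z.
Hypothesis t2good : good t2.
Local Notation D2 := (glue e t1 t2).
Local Notation kA m := ((hits (cell B m) t2)%:R : R).
Local Notation kB m := ((hits (cell_of B true m) t2)%:R : R).

Let kBA m : kB m <= kA m.
Proof. by rewrite -bin_count_glue -bin_ones_glue; exact: bin_ones_le. Qed.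

Let rm01 m : 0 <= rm m <= 1. Proof. exact: rate01. Qed.
Let pm0 m : 0 <= pm m. Proof. exact: mass_ge0. Qed.

Lemma good_mass m : pm m + L / N%:R <= ptilde alpha A D2 m.
Proof.
rewrite ptildeE bin_count_glue; apply: inflated_mass_ge => //.
by have [] := t2good m.
Qed.

Let low0 m : ~ (kA m - kB m < (1 - rm m) * kA m -
  Num.sqrt (2 * L * ((1 - rm m) * kA m))).
Proof. by rewrite -hits_cell_split; have [] := t2good m. Qed.

Lemma good_rate m :
  (pitilde alpha A D2 m < 2^-1 -> rm m <= pitilde alpha A D2 m) /\
  (2^-1 < pitilde alpha A D2 m -> pitilde alpha A D2 m <= rm m).
Proof.
rewrite pitildeE bin_count_glue bin_ones_glue.
apply: shrunk_rate_conservative => //.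
by have [] := t2good m.
Qed.

Let high m : if rm m <= 2^-1
  then kB m <= (Num.sqrt (rm m * kA m) + Num.sqrt L) ^+ 2
  else kA m - kB m <= (Num.sqrt ((1 - rm m) * kA m) + Num.sqrt L) ^+ 2.
Proof.
have [_ _ _] := t2good m; rewrite /minority.
case: ifPn => _ /negP; rewrite -leNgt//.
by rewrite -hits_cell_split.
Qed.

Local Notation W m := (bin_price L (kA m)).

Lemma good_price m : pm m * W m <= 6 * Num.sqrt (pm m * (L / N%:R)).
Proof. by apply: bin_price_le => //; have [] := t2good m. Qed.

Lemma good_dual_loss lam m y K : 0 <= lam -> 0 <= y <= 1 -> 1 <= K ->
  Num.sqrt (2 * lam) <= K ->
  dual_loss lam (pitilde alpha A D2 m) - dual_loss lam y <=
    W m * K + Num.sqrt (2 * lam) * Num.sqrt `|rm m - y|.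
Proof.
move=> l0 y01 K1 lK; rewrite pitildeE bin_count_glue bin_ones_glue.
by apply: dual_loss_shrunk_rate => //; exact: high.
Qed.

(** As masses are at most 1, the surplus L / N in each inflated mass adds at
    least (L / N) sum_m p_m a_m to the budget actually spent. *)
Lemma good_coverage :
  1 - alpha / (1 + L / N%:R) <=
  \int[mu]_x select alpha A a D2 x (eta x).
Proof.
have cov := @coverage_given_bins _ _ _ mu eta M B meta eta01 mB partB
  (pitilde alpha A D2) (a D2) (pitilde_gt0_lt1 A N0 L0 D2) (a01 D2) good_rate.
have e1 : \int[mu]_x select alpha A a D2 x (eta x) =
    \int[mu]_x (\sum_m \1_(B m) x * fsel (pitilde alpha A D2 m) (a D2 m) (eta x)).
  apply: eq_Rintegral => x _; rewrite /select; apply: eq_bigr => m _.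
  by rewrite bin_glue.
rewrite e1; apply: le_trans cov.
have r0 : 0 < L / N%:R by rewrite divr_gt0.
have -> : \sum_m pm m * (1 - a D2 m) = 1 - \sum_m pm m * a D2 m.
  under eq_bigr do rewrite mulrBr mulr1.
  by rewrite sumrB sum_mass.
rewrite lerD2l lerN2 ler_pdivlMr; last by rewrite addr_gt0.
have [[_ feas] _] := amin.2 D2.
apply: le_trans feas; rewrite mulr_suml; apply: ler_sum => m _.
have /andP[am0 am1] := a01 D2 m.
have p1 : pm m <= 1 by have /andP[] := mass01 P mB m.
apply: (@le_trans _ _ ((pm m + L / N%:R) * a D2 m)); last first.
  exact: (ler_wpM2r am0 (good_mass m)).
rewrite -subr_ge0 (_ : _ - _ = L / N%:R * a D2 m * (1 - pm m)); last by ring.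
apply: mulr_ge0; last by rewrite subr_ge0.
exact: mulr_ge0 (ltW r0) am0.
Qed.

(** The value v stands for the optimum through its dual bounds only. The
    multiplier of the finite program satisfies lam alpha <= 1 + s, whence the
    constant K. *)
Lemma good_length (v s K th : R) : 0 < th ->
  (forall lam, 0 <= lam -> \int[mu]_x dual_loss lam (eta x) <= v + lam * alpha) ->
  s = Num.sqrt (3 * (L / N%:R * M%:R)) + 3 * (L / N%:R * M%:R) ->
  1 <= K -> K = Num.sqrt (2 * ((1 + s) / alpha)) ->
  \int[mu]_x select_length alpha A a D2 x <=
  v + s + K * (6 * Num.sqrt (L / N%:R * M%:R)) +
  K * (((2 * \int[mu]_x `|fit A t1 x - eta x| + 2 * M%:R^-1) / th + th) / 2).
Proof.
move=> th0 vP sE K1 KE.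
have r0 : 0 < L / N%:R by rewrite divr_gt0.
have pit01 := pitilde01 A N0 L0 D2.
have pt0 m : 0 <= ptilde alpha A D2 m.
  by apply: le_trans (good_mass m); rewrite addr_ge0// ltW.
have [lam [l0 lS lP]] := minimizer_le_dual_loss pt0 pit01 (a01 D2) alpha0
  (fun b b01 bc => (amin.2 D2).2 b (conj b01 bc)).
have Spt := sum_ptilde_le D2; rewrite -sE in Spt.
have lamK : Num.sqrt (2 * lam) <= K.
  rewrite KE ler_wsqrtr// ler_wpM2l// ler_pdivlMr//; lra.
have lenE : \int[mu]_x select_length alpha A a D2 x =
    \sum_m pm m * ell (pitilde alpha A D2 m) (a D2 m).
  rewrite -(@expect_bins _ _ _ mu M B mB); apply: eq_Rintegral => x _.
  by rewrite /select_length; apply: eq_bigr => m _; rewrite bin_glue.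
have len_le : \int[mu]_x select_length alpha A a D2 x <=
    \sum_m ptilde alpha A D2 m * ell (pitilde alpha A D2 m) (a D2 m).
  rewrite lenE; apply: ler_sum => m _; apply: ler_wpM2r.
    by have /andP[] := ell01 (pit01 m) (a01 D2 m).
  by have := good_mass m; lra.
have dual_loss_le : \sum_m ptilde alpha A D2 m * dual_loss lam (pitilde alpha A D2 m) <=
    \sum_m pm m * dual_loss lam (pitilde alpha A D2 m) + s.
  have -> : \sum_m ptilde alpha A D2 m * dual_loss lam (pitilde alpha A D2 m) =
      \sum_m pm m * dual_loss lam (pitilde alpha A D2 m) +
      \sum_m (ptilde alpha A D2 m - pm m) * dual_loss lam (pitilde alpha A D2 m).
    by rewrite -big_split/=; apply: eq_bigr => m _; ring.
  rewrite lerD2l; apply: (@le_trans _ _ (\sum_m (ptilde alpha A D2 m - pm m))).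
    apply: ler_sum => m _; rewrite ler_piMr ?dual_loss_le1//.
    by have := good_mass m; lra.
  rewrite sumrB sum_mass//; lra.
have price : \sum_m pm m * bin_price L (kA m) <= 6 * Num.sqrt (L / N%:R * M%:R).
  apply: (@le_trans _ _ (\sum_m 6 * Num.sqrt (L / N%:R) * Num.sqrt (pm m))).
    apply: ler_sum => m _; apply: le_trans (good_price m) _.
    by rewrite sqrtrM// mulrA mulrAC.
  rewrite -mulr_sumr [X in _ <= 6 * X]sqrtrM; last exact: ltW.
  rewrite mulrA ler_wpM2l ?mulr_ge0 ?sqrtr_ge0//.
  by apply: sum_sqrt_le => //; rewrite sum_mass.
have gap : \int[mu]_x (\sum_m \1_(B m) x * `|rm m - eta x|) <=
    2 * \int[mu]_x `|fit A t1 x - eta x| + 2 * M%:R^-1.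
  apply: expect_rate_gap => //.
  - exact: (measurable_fun_pair2 t1 (@fit_measurable R d A n./2)).
  - by move=> x; exact: fit_ge0_le1.
  - move=> m x /bin_bounds[]; rewrite fit_half_glue => h1 h2.
    have M0' : 0 < M%:R :> R by rewrite ltr0n.
    rewrite ger0_norm ?subr_ge0// lerBlDl.
    rewrite (_ : _ + _ = m.+1%:R / M%:R); last by rewrite -natr1 mulrDl mul1r.
    case: h2 => [/ltW//|->].
    by rewrite divff ?gt_eqF//; have /andP[] := fit_ge0_le1 A t1 x.
have K0 : 0 <= K by lra.
have bins := @expect_dual_loss_bins _ _ _ mu eta M B meta eta01 mB partB
  (pitilde alpha A D2) (fun m => bin_price L (kA m)) lam K th l0 th0 lamK
  (fun m y y01 => good_dual_loss m l0 y01 K1 lamK).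
have h1 := ler_wpM2l K0 price.
have h2 : K * ((\int[mu]_x (\sum_m \1_(B m) x * `|rm m - eta x|) / th + th) / 2) <=
  K * (((2 * \int[mu]_x `|fit A t1 x - eta x| + 2 * M%:R^-1) / th + th) / 2).
  by rewrite ler_wpM2l// ler_pM2r// lerD2r ler_pM2r ?invr_gt0.
have := vP lam l0; lra.
Qed.

End good_sample.

End second_half.

(** * Numerical rates *)

Lemma ler_div_half (R : realFieldType) (c l x y z : R) :
  0 <= c * y -> 0 < x -> x / 2 <= z -> l <= c * y -> l / z <= 2 * c * (y / x).
Proof.
move=> cy x0 xz ly; rewrite ler_pdivrMr; last lra.
apply: le_trans ly _; rewrite (_ : _ * z = c * y * (z / (x / 2))); last by field; lra.
by rewrite -[leLHS]mulr1; apply: ler_wpM2l => //; rewrite ler_pdivlMr ?mul1r//; lra.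
Qed.

Lemma half_sqr_ge1 (R : realFieldType) (x : R) : 3 <= x -> 4 <= x ^+ 2 / 2.
Proof. by move=> x3; nra. Qed.

Section rates.
Context (R : realType) (n : nat).
Hypothesis n3 : (3 <= n)%N.
Local Notation nR := (n%:R : R).
Local Notation M := ((nbins R n)%:R : R).
Local Notation N := ((uphalf n)%:R : R).
Local Notation kap := ((ln nR / nR) `^ (4^-1)).

Let n3R : 3 <= nR. Proof. by rewrite (ler_nat R 3 n). Qed.
Let n0 : 0 < nR. Proof. by have := n3R; lra. Qed.

Lemma expR_half_le2 : expR 2^-1 <= 2 :> R.
Proof.
have [h3 h0] := (n3R, n0).
apply: le_trans (@expR_le_inv1B R 2^-1 _) _; first lra.
by rewrite (_ : 1 - 2^-1 = 2^-1) ?invrK//; lra.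
Qed.

Lemma ln_n_ge : 2^-1 <= ln nR.
Proof.
have [h3 h0] := (n3R, n0).
by rewrite -[leLHS]expRK ler_ln ?posrE ?expR_gt0//; have := expR_half_le2; lra.
Qed.

Lemma ln_n_lt : ln nR < nR.
Proof.
have [h3 h0] := (n3R, n0).
have := @le_ln1Dx R (nR - 1); rewrite (_ : 1 + (nR - 1) = nR); last by ring.
by move=> h; have := h _; lra.
Qed.

Lemma nbins_bounds : Num.sqrt (nR / ln nR) <= M < Num.sqrt (nR / ln nR) + 1.
Proof.
have [h3 h0] := (n3R, n0).
set x := Num.sqrt _; have /andP[h2 h1] := ceil_itv x.
have x0 : 0 <= x by exact: sqrtr_ge0.
have c0 : 0 <= (Num.ceil x)%:~R :> R by apply: le_trans h1.
have -> : M = (Num.ceil x)%:~R.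
  by rewrite /nbins natr_absz ger0_norm// -(ler0z R).
by rewrite h1/=; move: h2; rewrite intrB; lra.
Qed.

Lemma sqrt_bins_gt1 : 1 < Num.sqrt (nR / ln nR).
Proof.
have [h3 h0] := (n3R, n0).
have l2 := ln_n_ge; have ln_ := ln_n_lt.
by rewrite -[ltLHS]sqrtr1 ltr_sqrt ?ltr_pdivlMr ?mul1r ?divr_gt0//; lra.
Qed.

Lemma nbins_ge2 : (2 <= nbins R n)%N.
Proof.
have [h3 h0] := (n3R, n0).
have /andP[h _] := nbins_bounds; have h1 := sqrt_bins_gt1.
by rewrite ltnNge -(ler_nat R) -ltNge; lra.
Qed.

Lemma nbins_le : M <= 2 * nR.
Proof.
have [h3 h0] := (n3R, n0).
have /andP[_ h] := nbins_bounds; have l2 := ln_n_ge.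
have : Num.sqrt (nR / ln nR) <= nR.
  by apply: sqrt_le_of_sq; [lra|rewrite ler_pdivrMr; [nra|lra]].
lra.
Qed.

Lemma uphalf_ge : nR / 2 <= N.
Proof.
have [h3 h0] := (n3R, n0).
rewrite ler_pdivrMr// -natrM ler_nat muln2 uphalf_half doubleD.
rewrite -[X in (X <= _)%N]odd_double_half leq_add2r.
by case: (odd n).
Qed.

Lemma uphalf_ge2 : 2 <= N.
Proof. by rewrite (ler_nat R 2); case: n n3 => [|[|[|[|k]]]]. Qed.

Lemma uphalf_le : N <= nR.
Proof. by rewrite ler_nat uphalf_half -[leqRHS]odd_double_half leq_add2l -addnn leq_addr. Qed.

Lemma kap4 : kap ^+ 4 = ln nR / nR.
Proof.
have [h3 h0] := (n3R, n0).
have l2 := ln_n_ge.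
rewrite -powR_mulrn ?powR_ge0// -powRrM mulVf ?powRr1//.
by rewrite divr_ge0// ?ltW//; lra.
Qed.

Lemma kap_gt0 : 0 < kap.
Proof. by have l2 := ln_n_ge; rewrite powR_gt0// divr_gt0//; lra. Qed.

Lemma kap_le1 : kap <= 1.
Proof.
have [h3 h0] := (n3R, n0).
rewrite -(@ler_pXn2r _ 4)// ?nnegrE ?powR_ge0// expr1n kap4.
by rewrite ler_pdivrMr// mul1r ltW// ln_n_lt.
Qed.

Lemma sqrt_binsE : Num.sqrt (nR / ln nR) = (kap ^+ 2)^-1.
Proof.
have [h3 h0] := (n3R, n0).
have k0 := kap_gt0.
have -> : nR / ln nR = ((kap ^+ 2)^-1) ^+ 2 by rewrite exprVn -exprM kap4 invf_div.
by rewrite sqrtr_sqr ger0_norm// invr_ge0 sqr_ge0.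
Qed.

Lemma inv_nbins_le : M^-1 <= kap ^+ 2.
Proof.
have [h3 h0] := (n3R, n0).
have k0 := kap_gt0; have /andP[h _] := nbins_bounds; rewrite sqrt_binsE in h.
have k2 : 0 < kap ^+ 2 by rewrite exprn_gt0.
rewrite -[leRHS]invrK lef_pV2// posrE ?invr_gt0//.
by apply: lt_le_trans h; rewrite invr_gt0.
Qed.

Lemma nbins_le_kap : M <= 2 / kap ^+ 2.
Proof.
have [h3 h0] := (n3R, n0).
have /andP[_ h] := nbins_bounds; have h1 := sqrt_bins_gt1.
by rewrite sqrt_binsE in h h1; lra.
Qed.

Variable alpha : R.
Hypothesis alpha01 : 0 < alpha <= 1.
Local Notation L := (@log_term R n alpha).

Let a0 : 0 < alpha. Proof. by case/andP: alpha01. Qed.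
Let a1 : alpha <= 1. Proof. by case/andP: alpha01. Qed.

Lemma log_term_arg_ge16 : 16 <= 4 * M * N / alpha.
Proof.
have [h3 h0] := (n3R, n0); have [ap ale] := (a0, a1).
have m2 : 2 <= M by rewrite (ler_nat R 2) nbins_ge2.
have N2 := uphalf_ge2.
by rewrite ler_pdivlMr//; nra.
Qed.

(** The argument is at least 16, and e^2 <= 16 because e^(1/2) <= 2. *)
Lemma log_term_ge2 : 2 <= L.
Proof.
have [h3 h0] := (n3R, n0); have [ap ale] := (a0, a1).
have h16 := log_term_arg_ge16.
have h : 2 = ln (expR (2^-1) ^+ 4) :> R.
  by rewrite -expRM_natl expRK; lra.
rewrite h /log_term ler_ln ?posrE; last 2 first.
- by rewrite exprn_gt0// expR_gt0.
- lra.
apply: le_trans h16.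
have e0 := expR_gt0 (2^-1 : R); have e2 := expR_half_le2.
have -> : 16 = 2 ^+ 4 :> R by rewrite -natrX.
apply: lerXn2r => //; rewrite nnegrE; exact: ltW.
Qed.

Lemma expR_log_term : expR (- L) = alpha / (4 * M * N).
Proof.
have [h3 h0] := (n3R, n0); have [ap ale] := (a0, a1).
by have h := log_term_arg_ge16; rewrite expRN lnK ?posrE ?invf_div//; lra.
Qed.

Lemma deviation_budget : 4 * M * expR (- L) = alpha / N.
Proof.
have [h3 h0] := (n3R, n0); have [ap ale] := (a0, a1).
rewrite expR_log_term.
have m2 : 2 <= M by rewrite (ler_nat R 2) nbins_ge2.
by have := uphalf_ge2 => ?; field; apply/andP; split; lra.
Qed.

(** Equivalent to (L - 1)(N - 1) >= 1. *)
Lemma coverage_budget : 1 - alpha <= 1 - alpha / (1 + L / N) - alpha / N.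
Proof.
have [h3 h0] := (n3R, n0); have [ap ale] := (a0, a1).
have N2 := uphalf_ge2; have l2 := log_term_ge2.
have Np : 0 < N by lra.
have -> : alpha / (1 + L / N) = alpha * (N / (N + L)) by field; apply/andP; split; lra.
suff : N / (N + L) + N^-1 <= 1 by nra.
rewrite -subr_ge0 (_ : _ - _ = ((L - 1) * (N - 1) - 1) / ((N + L) * N)); last first.
  by field; apply/andP; split; lra.
by rewrite divr_ge0 ?mulr_ge0//; nra.
Qed.

(** For alpha <= 1/n the asserted bound is at least 1, the largest possible
    length. *)
Lemma small_alpha : alpha <= nR^-1 -> 1 <= 1000 / Num.sqrt alpha * kap.
Proof.
have [h3 h0] := (n3R, n0); have [ap ale] := (a0, a1).
move=> an; have k0 := kap_gt0; have sa : 0 < Num.sqrt alpha by rewrite sqrtr_gt0.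
have l2 := ln_n_ge.
suff h : Num.sqrt alpha <= 2 * kap.
  by rewrite mulrAC ler_pdivlMr// mul1r; lra.
have k20 : 0 <= 2 * kap by lra.
rewrite -(@ler_pXn2r _ 4) ?nnegrE ?(ltW sa)//.
rewrite exprMn kap4 (_ : Num.sqrt alpha ^+ 4 = alpha ^+ 2); last first.
  by rewrite (exprM _ 2 2) sqr_sqrtr// ltW.
apply: (@le_trans _ _ nR^-1); first by apply: le_trans an; nra.
rewrite mulrA -[leLHS]mul1r ler_pM2r ?invr_gt0//; lra.
Qed.

(** The argument 4 M N / alpha is at most 8 n^3, hence at most n^5. *)
Lemma log_term_le : nR^-1 < alpha -> L <= 5 * ln nR.
Proof.
have [h3 h0] := (n3R, n0); have [ap ale] := (a0, a1); move=> na.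
have N2 := uphalf_ge2; have Nn := uphalf_le; have Mn := nbins_le.
have M0 : 0 <= M by exact: ler0n.
have -> : 5 * ln nR = ln (nR ^+ 5) by rewrite lnXn// mulr_natl.
rewrite /log_term ler_ln ?posrE ?exprn_gt0//; last by have := log_term_arg_ge16; lra.
have ai : alpha^-1 <= nR by rewrite -[leRHS]invrK lef_pV2 ?posrE ?invr_gt0// ltW.
have ai0 : 0 < alpha^-1 by rewrite invr_gt0.
have h1 : M * N <= 2 * nR * nR by apply: ler_pM.
have MN0 : 0 <= M * N by rewrite mulr_ge0.
have h2 : M * N / alpha <= 2 * nR * nR * nR by apply: ler_pM => //; exact: ltW.
have -> : 4 * M * N / alpha = 4 * (M * N / alpha) by ring.
rewrite (_ : nR ^+ 5 = (nR ^+ 2 / 2) * (2 * nR * nR * nR)); last by field.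
apply: ler_pM => //; first by rewrite divr_ge0// ltW.
exact: half_sqr_ge1.
Qed.

Lemma bins_rate_le : nR^-1 < alpha -> 0 <= L / N * M <= 20 * kap ^+ 2.
Proof.
have [h3 h0] := (n3R, n0); move=> na.
have k0 := kap_gt0; have N2 := uphalf_ge2; have Nn := uphalf_ge.
have Mk := nbins_le_kap; have L5 := log_term_le na; have l2 := log_term_ge2.
have lnn := ln_n_ge; have M0 : 0 <= M by exact: ler0n.
have h1 : L / N <= 10 * kap ^+ 4.
  rewrite kap4 (_ : 10 = 2 * 5); last by ring.
  by apply: ler_div_half => //; lra.
have LN0 : 0 <= L / N by apply: divr_ge0 => //; lra.
rewrite mulr_ge0//=; apply: (@le_trans _ _ (10 * kap ^+ 4 * (2 / kap ^+ 2))).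
  by apply: ler_pM.
by rewrite le_eqVlt; apply/orP; left; apply/eqP; field; exact: lt0r_neq0.
Qed.

Lemma deviation_rate_le : alpha / N <= 4 * kap.
Proof.
have [h3 h0] := (n3R, n0); have [ap ale] := (a0, a1).
have k0 := kap_gt0; have k1 := kap_le1; have k4 := kap4.
have N2 := uphalf_ge2; have Nn := uphalf_ge; have lnn := ln_n_ge.
apply: (@le_trans _ _ (4 * kap ^+ 4)); last first.
  rewrite ler_pM2l// exprSr -[leRHS]mul1r ler_pM2r//.
  by rewrite exprn_ile1// ltW.
rewrite k4 (_ : 4 = 2 * 2); last by ring.
by apply: ler_div_half => //; lra.
Qed.

End rates.

(** Here kap stands for the rate (ln n / n)^(1/4), r for L M / N and m for 1 / M.
    The leading term keeps its constant 2 because K sqrt (2 Delta + 2 m) equals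
    (2 / sqrt alpha) sqrt (1 + s) sqrt (Delta + m). *)
Lemma rate_bound (R : realType) (kap alpha Delta r m s K t : R) :
  0 < kap <= 1 -> 0 < alpha <= 1 -> 0 <= Delta <= 1 ->
  0 <= r <= 20 * kap ^+ 2 -> 0 <= m <= kap ^+ 2 -> t <= 4 * kap ->
  s = Num.sqrt (3 * r) + 3 * r -> K = Num.sqrt (2 * ((1 + s) / alpha)) ->
  s + K * (6 * Num.sqrt r) + K * Num.sqrt (2 * Delta + 2 * m) + t
  <= 2 * Num.sqrt (Delta / alpha) + 1000 / Num.sqrt alpha * kap.
Proof.
move=> /andP[k0 k1] /andP[ap ale] /andP[D0 D1] /andP[r0 rk] /andP[m0 mk] tk sE KE.
have kk : kap ^+ 2 <= kap by nra.
have sr : Num.sqrt r <= 5 * kap by apply: sqrt_le_of_sq; nra.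
have s0 : 0 <= s by rewrite sE addr_ge0 ?sqrtr_ge0// mulr_ge0.
have s68 : s <= 68 * kap.
  have : Num.sqrt (3 * r) <= 8 * kap by apply: sqrt_le_of_sq; nra.
  by rewrite sE; lra.
have sa : 0 < Num.sqrt alpha by rewrite sqrtr_gt0.
have qE : Num.sqrt alpha^-1 = (Num.sqrt alpha)^-1 by rewrite sqrtrV// ltW.
have q1 : 1 <= (Num.sqrt alpha)^-1 by rewrite invf_ge1// -[leRHS]sqrtr1 ler_wsqrtr.
have K0 : 0 <= K by rewrite KE sqrtr_ge0.
have s10 : 0 <= 1 + s by lra.
have KE2 : K = Num.sqrt (2 * (1 + s)) * (Num.sqrt alpha)^-1.
  by rewrite KE mulrA sqrtrM ?qE// mulr_ge0.
rewrite (sqrtrM _ D0) qE; move: (Num.sqrt alpha)^-1 q1 KE2 => q q1 KE2.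
have q0 : 0 <= q by lra.
have S0 := sqrtr_ge0 (1 + s).
have S2 : Num.sqrt (1 + s) <= 1 + s by apply: sqrt_le_of_sq => //; nra.
have S9 : Num.sqrt (1 + s) <= 9 by apply: sqrt_le_of_sq => //; lra.
have K12 : K <= 12 * q.
  rewrite KE2; apply: ler_wpM2r => //.
  by apply: sqrt_le_of_sq => //; lra.
have t1 : K * (6 * Num.sqrt r) <= 12 * q * (6 * (5 * kap)).
  have sr0 := sqrtr_ge0 r.
  by apply: ler_pM => //; lra.
have KDm : K * Num.sqrt (2 * Delta + 2 * m) =
    2 * q * (Num.sqrt (1 + s) * Num.sqrt (Delta + m)).
  rewrite -mulrDr KE2 !(sqrtrM _ (ler0n R 2)); have := sqr_sqrtr (ler0n R 2).
  by move: (Num.sqrt 2) => w ww; rewrite -[X in _ = X * q * _]ww; ring.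
have Dd := sqrtr_ge0 Delta.
have DD : Num.sqrt Delta ^+ 2 = Delta by rewrite sqr_sqrtr.
have D1' : Num.sqrt Delta <= 1 by apply: sqrt_le_of_sq => //; lra.
have Dm : Num.sqrt (Delta + m) <= Num.sqrt Delta + kap.
  apply: sqrt_le_of_sq; first lra.
  by rewrite sqrrD DD; have := mulr_ge0 Dd (ltW k0); lra.
have h : Num.sqrt (1 + s) * Num.sqrt (Delta + m) <= Num.sqrt Delta + 77 * kap.
  apply: (le_trans (ler_wpM2l S0 Dm)); rewrite mulrDr.
  have h6 := ler_wpM2r Dd S2; have h7 := ler_wpM2r (ltW k0) S9.
  have h8 := ler_wpM2l s0 D1'; lra.
have h2 := ler_wpM2l q0 h; rewrite KDm.
have qk := ler_wpM2r (ltW k0) q1; rewrite mul1r in qk.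
move: k0 t1 h2 qk s68 tk; move: (K * _) (_ * Num.sqrt (Delta + m)) (Num.sqrt Delta).
by clear => a b c; lra.
Qed.

(** * Averaging over the data *)

Section averaging.
Context (R : realType) (d n : nat) (alpha : R) (A : regression_algorithm R d).
Local Notation X := (covariate R d).
Local Notation Z := (observation R d).
Local Notation M := (nbins R n).
Local Notation N := (uphalf n).
Local Notation L := (@log_term R n alpha).
Local Notation kap := ((ln n%:R / n%:R : R) `^ (4^-1)).
Variable a : n.-tuple Z -> 'I_M -> R.
Hypotheses (n3 : (3 <= n)%N) (alpha01 : 0 < alpha <= 1).
Hypothesis amin : minimizer_selection alpha A a.
Variables (P : probability Z R) (eta : {mfun X >-> R}).
Hypothesis regP : regression_function P eta.
Local Notation mu := (marginal P).
Local Notation cov D := (\int[mu]_x select alpha A a D x (eta x)).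
Local Notation len D := (\int[mu]_x select_length alpha A a D x).
Local Notation U := (uniform_prob (@ltr01 R)).

Let M0 : (0 < M)%N. Proof. exact: ltn_trans (nbins_ge2 R n3). Qed.
Let N2 : 2 <= N%:R :> R. Proof. exact: uphalf_ge2. Qed.
Let N0 : (0 < N)%N. Proof. by rewrite -(ltr0n R); apply: lt_le_trans N2. Qed.
Let L0 : 0 < L. Proof. by apply: lt_le_trans (log_term_ge2 n3 alpha01). Qed.
Let a0 : 0 < alpha. Proof. by case/andP: alpha01. Qed.
Let eta01 : forall x, 0 <= eta x <= 1. Proof. exact: regP.1. Qed.
Let ma : forall m, measurable_fun setT (fun D => a D m). Proof. exact: amin.1. Qed.
Let a01 D m : 0 <= a D m <= 1. Proof. by have [[]] := amin.2 D. Qed.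

Let e : (n./2 + N)%N = n.
Proof. by rewrite uphalf_half addnCA addnn odd_double_half. Qed.

(* The bins depend on the first half only, so any second half defines them. *)
Let t0 : N.-tuple Z := nseq_tuple N (nseq_tuple d 0, true).

Let mcov : measurable_fun setT (fun D => cov D).
Proof.
exact: (measurable_expect mu (measurable_select_eta alpha A ma eta)
  (fun w => select01 A M0 N0 L0 a01 w.1 w.2 (eta01 w.2))).
Qed.

Let mlen : measurable_fun setT (fun D => len D).
Proof.
exact: (measurable_expect mu (measurable_select_length2 alpha A ma)
  (fun w => select_length01 A M0 N0 L0 a01 w.1 w.2)).
Qed.

Let cov01 D : 0 <= cov D <= 1.
Proof.
exact: (expect_section01 mu (measurable_select_eta alpha A ma eta)
  (fun w => select01 A M0 N0 L0 a01 w.1 w.2 (eta01 w.2))).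
Qed.

Let len01 D : 0 <= len D <= 1.
Proof.
exact: (expect_section01 mu (measurable_select_length2 alpha A ma)
  (fun w => select_length01 A M0 N0 L0 a01 w.1 w.2)).
Qed.

Local Notation B t1 := (fun m => bin A (glue e t1 t0) m).
Local Notation bad t1 := (@deviations R d P eta M N (B t1) L).

Let bbad t1 : bounded_measurable (bad t1).
Proof. by apply: bounded_deviations => m; exact: measurable_bin. Qed.

Let expect_bad t1 : \int[iid_law P N]_t2 bad t1 t2 <= alpha / N%:R.
Proof.
rewrite -(deviation_budget n3 alpha01); apply: expect_deviations => //.
by move=> m; exact: measurable_bin.
Qed.

Let bglue (f : n.-tuple Z -> R) t1 : measurable_fun setT f ->
  (forall D, 0 <= f D <= 1) ->
  bounded_measurable (fun t2 : N.-tuple Z => f (glue e t1 t2)).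
Proof.
move=> mf f01; apply: bounded_measurable01 => //.
exact: (measurable_fun_pair2 t1 (measurableT_comp mf (measurable_glue e))).
Qed.

(** On a good sample the coverage is at least 1 - alpha / (1 + L / N), and on a
    bad one it is at least that number minus the number of deviations. *)
Lemma coverage_second_half t1 :
  1 - alpha <= \int[iid_law P N]_t2 cov (glue e t1 t2).
Proof.
pose c := 1 - alpha / (1 + L / N%:R).
have c1 : c <= 1.
  by rewrite gerBl divr_ge0 ?(ltW a0)// addr_ge0// divr_ge0 ?ler0n ?(ltW L0).
apply: (@le_trans _ _ (\int[iid_law P N]_t2 (c - bad t1 t2))).
  have -> : \int[iid_law P N]_t2 (c - bad t1 t2) =
      \int[iid_law P N]_t2 (c + (-1) * bad t1 t2).
    by apply: eq_Rintegral => t2 _; rewrite mulN1r.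
  rewrite expectD; [|by bmfun|by apply: bounded_measurableM => //; bmfun].
  rewrite expectZ// expect_cst mulN1r.
  by have := expect_bad t1; have := coverage_budget n3 alpha01; rewrite -/c; lra.
apply: expect_le; [by apply: bounded_measurableB => //; bmfun|exact: (@bglue _ t1 mcov cov01)|move=> t2].
have [h|h] := @no_deviation R d P eta M N (B t1) L t2.
  by have /andP[h0 _] := cov01 (glue e t1 t2); lra.
have tgood : good alpha A P eta e t1 t0 t2 by exact: h.
have h1 := good_coverage M0 N0 L0 amin regP tgood.
have b0 : 0 <= bad t1 t2.
  by apply: sumr_ge0 => m _; do 2 apply: addr_ge0 => //; apply: addr_ge0.
by move: h1; rewrite -/c; lra.
Qed.

Lemma coverage : 1 - alpha <= \int[iid_law P n]_D cov D.
Proof.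
rewrite (expect_glue P e mcov cov01) -[leLHS](expect_cst (iid_law P n./2)).
have mg := measurableT_comp mcov (measurable_glue e).
have g01 (w : n./2.-tuple Z * N.-tuple Z) : 0 <= cov (glue e w.1 w.2) <= 1 by [].
apply: expect_le.
- exact: bounded_measurable_cst.
- apply: bounded_measurable01; first exact: (measurable_expect (iid_law P N) mg g01).
  exact: (expect_section01 (iid_law P N) mg g01).
- exact: coverage_second_half.
Qed.

Local Notation err t1 := (\int[mu]_x `|@fit R d A n./2 t1 x - eta x|).

Let mfit : measurable_fun setT
  (fun w : n./2.-tuple Z * X => `|fit A w.1 w.2 - eta w.2|).
Proof.
apply: measurableT_comp => //; apply: measurable_funB.
  exact: fit_measurable.
exact: measurableT_comp.
Qed.

Let fit01 (w : n./2.-tuple Z * X) : 0 <= `|fit A w.1 w.2 - eta w.2| <= 1.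
Proof.
rewrite normr_ge0/= ler_norml; have /andP[? ?] := fit_ge0_le1 A w.1 w.2.
by have /andP[? ?] := eta01 w.2; apply/andP; split; lra.
Qed.

Let err01 t1 : 0 <= err t1 <= 1.
Proof. exact: (expect_section01 mu mfit fit01). Qed.

Let berr : bounded_measurable (fun t1 => err t1).
Proof.
apply: bounded_measurable01 => //; exact: (measurable_expect mu mfit fit01).
Qed.

Lemma regression_errorE :
  regression_error P eta A n./2 = \int[iid_law P n./2]_t1 err t1.
Proof.
apply: EFin_inj; rewrite -[RHS]expectE//.
have h := expect_pair (iid_law P n./2) mu mfit fit01.
apply: (eq_trans _ h); rewrite expectE//; exact: bounded_measurable01.
Qed.

(** For each first half the bound on good samples is affine in the regression
    error of that half, so its average involves the mean regression error only. *)
Lemma length_average (v s K th : R) : 0 <= v -> 0 < th ->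
  (forall lam, 0 <= lam -> \int[mu]_x dual_loss lam (eta x) <= v + lam * alpha) ->
  s = Num.sqrt (3 * (L / N%:R * M%:R)) + 3 * (L / N%:R * M%:R) ->
  1 <= K -> K = Num.sqrt (2 * ((1 + s) / alpha)) ->
  \int[iid_law P n]_D len D <=
  v + s + K * (6 * Num.sqrt (L / N%:R * M%:R)) +
  K * (((2 * regression_error P eta A n./2 + 2 * M%:R^-1) / th + th) / 2) +
  alpha / N%:R.
Proof.
move=> v0 th0 vP sE K1 KE.
pose c := v + s + K * (6 * Num.sqrt (L / N%:R * M%:R)).
pose bound x : R := c + K * (((2 * x + 2 * M%:R^-1) / th + th) / 2).
have rM0 : 0 <= L / N%:R * M%:R.
  by rewrite mulr_ge0 ?ler0n// divr_ge0 ?ler0n// ltW.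
have s0 : 0 <= s by rewrite sE addr_ge0 ?sqrtr_ge0// mulr_ge0.
have K0 : 0 <= K by apply: le_trans K1.
have bound0 x : 0 <= x -> 0 <= bound x.
  move=> x0; rewrite /bound /c !addr_ge0//.
    by apply: mulr_ge0 => //; apply: mulr_ge0 => //; apply: sqrtr_ge0.
  apply: mulr_ge0 => //; apply: divr_ge0 => //; apply: addr_ge0; last exact: ltW.
  apply: divr_ge0; last exact: ltW.
  by apply: addr_ge0; apply: mulr_ge0 => //; rewrite invr_ge0 ler0n.
have boundE x : bound x = bound 0 + K / th * x.
  have Mn : M%:R != 0 :> R by rewrite pnatr_eq0 -lt0n.
  by rewrite /bound; field; rewrite ?Mn ?(gt_eqF th0).
have per_half t1 : \int[iid_law P N]_t2 len (glue e t1 t2) <= bound (err t1) + alpha / N%:R.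
  apply: (@le_trans _ _ (\int[iid_law P N]_t2 (bound (err t1) + bad t1 t2))).
    apply: expect_le; [exact: (@bglue _ t1 mlen len01)|by apply: bounded_measurableD => //; bmfun|move=> t2].
    have /andP[e0 _] := err01 t1; have bb := bound0 _ e0.
    have [h|h] := @no_deviation R d P eta M N (B t1) L t2.
      by have /andP[_ h0] := len01 (glue e t1 t2); lra.
    have tgood : good alpha A P eta e t1 t0 t2 by exact: h.
    have h1 := good_length M0 N0 L0 a0 amin regP tgood th0 vP sE K1 KE.
    have b0 : 0 <= bad t1 t2.
      by apply: sumr_ge0 => m _; do 2 apply: addr_ge0 => //; apply: addr_ge0.
    by apply: le_trans h1 _; rewrite -/c -/(bound _) lerDl.
  rewrite expectD; [|by bmfun|by []].
  by rewrite expect_cst lerD2l.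
rewrite (expect_glue P e mlen len01).
have mg := measurableT_comp mlen (measurable_glue e).
have g01 (w : n./2.-tuple Z * N.-tuple Z) : 0 <= len (glue e w.1 w.2) <= 1 by [].
apply: (@le_trans _ _ (\int[iid_law P n./2]_t1 (bound 0 + alpha / N%:R + K / th * err t1))).
  apply: expect_le.
  - apply: bounded_measurable01; first exact: (measurable_expect (iid_law P N) mg g01).
    exact: (expect_section01 (iid_law P N) mg g01).
  - by apply: bounded_measurableD; [bmfun|apply: bounded_measurableM => //; bmfun].
  - move=> t1; apply: le_trans (per_half t1) _.
    by rewrite (boundE (err t1)) addrAC.
rewrite expectD; [|by bmfun|by apply: bounded_measurableM => //; bmfun].
rewrite expectZ// expect_cst -regression_errorE addrAC -boundE.
by rewrite /bound /c.
Qed.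

Lemma split_CI_coverage :
  ((1 - alpha)%:E <= ((iid_law P n \x P) \x U)
     [set w | split_CI alpha A a w.1.1 w.1.2.1 w.2 (eta w.1.2.1)])%E.
Proof.
by rewrite (coverage_integral A M0 N0 L0 ma a01 P eta01) lee_fin coverage.
Qed.

(** The free parameter th is chosen here as the square root of 2 Delta + 2 / M,
    which turns the affine bound into the square root. *)
Lemma split_CI_expected_length :
  (expected_length U (split_CI alpha A a) P <=
   optimal_length alpha (regression_law P eta) +
   (2 * Num.sqrt (regression_error P eta A n./2 / alpha) +
    1000 / Num.sqrt alpha * kap)%:E)%E.
Proof.
rewrite (expected_length_integral A M0 N0 L0 ma a01).
have OL0 := optimal_length_ge0 alpha (regression_law P eta).
have l1 : \int[iid_law P n]_D len D <= 1.
  by have /andP[] := expect01 (iid_law P n) mlen len01.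
have D01 : 0 <= regression_error P eta A n./2 <= 1.
  by rewrite regression_errorE; exact: expect01 berr.1 err01.
have k0 : 0 < kap := kap_gt0 R n3.
have [an|na] := leP alpha n%:R^-1.
  apply: (@le_trans _ _ (2 * Num.sqrt (regression_error P eta A n./2 / alpha) +
      1000 / Num.sqrt alpha * kap)%:E); last by rewrite leeDr.
  rewrite lee_fin; have := small_alpha n3 alpha01 an.
  by have := sqrtr_ge0 (regression_error P eta A n./2 / alpha); lra.
have dual lam := @expect_dual_loss_le_optimal_length R d P eta eta01 alpha lam.
case: (optimal_length alpha _) OL0 dual => [v||] v0 dual; last 2 first.
- by rewrite addye// leey.
- by [].
rewrite lee_fin in v0; rewrite -EFinD lee_fin.
set s := Num.sqrt (3 * (L / N%:R * M%:R)) + 3 * (L / N%:R * M%:R).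
have M0R : 0 < M%:R :> R by rewrite ltr0n.
have rM0 : 0 <= L / N%:R * M%:R by apply: mulr_ge0 => //; apply: divr_ge0 => //; exact: ltW.
have s0 : 0 <= s by rewrite /s addr_ge0 ?sqrtr_ge0// mulr_ge0.
set K := Num.sqrt (2 * ((1 + s) / alpha)).
have K1 : 1 <= K.
  apply: le_sqrt_of_sq; rewrite expr1n mulrA ler_pdivlMr//.
  by have /andP[_ ?] := alpha01; lra.
set x := 2 * regression_error P eta A n./2 + 2 * M%:R^-1.
have x0 : 0 < x.
  by have /andP[? _] := D01; rewrite ltr_wpDl ?mulr_ge0// mulr_gt0// invr_gt0.
have th0 : 0 < Num.sqrt x by rewrite sqrtr_gt0.
have vP lam : 0 <= lam -> \int[mu]_y dual_loss lam (eta y) <= v + lam * alpha.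
  by move=> l0; rewrite -lee_fin EFinD; exact: dual.
have h := length_average v0 th0 vP erefl K1 erefl.
apply: le_trans h _; rewrite -/s -/K -/x.
have -> : (x / Num.sqrt x + Num.sqrt x) / 2 = Num.sqrt x.
  by rewrite -{1}(sqr_sqrtr (ltW x0)) expr2 mulfK ?gt_eqF//; lra.
have k01 : 0 < kap <= 1 by rewrite k0 kap_le1.
have m01 : 0 <= (M%:R^-1 : R) <= kap ^+ 2 by rewrite invr_ge0 ler0n inv_nbins_le.
have := rate_bound k01 alpha01 D01 (bins_rate_le n3 alpha01 na) m01
  (deviation_rate_le n3 alpha01) (erefl s) (erefl K).
by rewrite -/x; lra.
Qed.

End averaging.

Theorem corollary1 (R : realType) :
  exists c' : R,
  forall (n d : nat) (alpha : R) (A : regression_algorithm R d)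
    (a : n.-tuple (observation R d) -> 'I_(nbins R n) -> R),
  (3 <= n)%N -> (1 <= d)%N -> 0 < alpha <= 1 ->
  minimizer_selection alpha A a ->
  distribution_free_CI (uniform_prob (@ltr01 R)) alpha (split_CI alpha A a) /\
  forall (P : probability (observation R d) R) (eta : {mfun covariate R d >-> R}),
  regression_function P eta ->
  (expected_length (uniform_prob (@ltr01 R)) (split_CI alpha A a) P <=
   optimal_length alpha (regression_law P eta) +
   (2 * Num.sqrt (regression_error P eta A n./2 / alpha) +
    c' / Num.sqrt alpha * (ln n%:R / n%:R) `^ (4^-1))%:E)%E.

Proof.
exists 1000 => n d alpha A a n3 _ alpha01 amin.
split=> [P eta regP|P eta regP]; first exact: split_CI_coverage.
exact: split_CI_expected_length.
Qed.
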